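(* Let $X\subseteq\mathbb{R}^{18}$ (coordinates $c_1,s_1,\dots,c_9,s_9$) be the configuration space of the planar 3RRR-mechanism, i.e. the real zero set of the ideal $I=\langle p_1,\dots,p_{15}\rangle\subseteq\mathbb{R}[c_1,s_1,\dots,c_9,s_9]$, where $$\begin{aligned} p_1&=c_1+c_2+c_3+c_4+c_5-1, & p_2&=s_1+s_2+s_3+s_4+s_5-1,\\ p_3&=c_1+c_2+c_6+c_7+c_8-1, & p_4&=s_1+s_2+s_6+s_7+s_8,\\ p_5&=c_6+c_9-c_3, & p_6&=s_6+s_9-s_3, \end{aligned}$$ and $p_{6+i}=c_i^2+s_i^2-1$ for $i=1,\dots,9$. Then every point of $X$ that is a singularity and is not an isolated point of $X$ is not a manifold point of $X$. In particular, the point of $X$ given by $(c_1,s_1)=(\tfrac{\sqrt3}{2},-\tfrac12)$, $(c_2,s_2)=(1,0)$, $(c_3,s_3)=(-\tfrac{\sqrt3}{2},-\tfrac12)$, $(c_4,s_4)=(0,1)$, $(c_5,s_5)=(0,1)$, $(c_6,s_6)=(-\tfrac{\sqrt3}{2},\tfrac12)$, $(c_7,s_7)=(0,1)$, $(c_8,s_8)=(0,-1)$, $(c_9,s_9)=(0,-1)$ is not a manifold point of $X$.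
   Context: A point $p\in X$ is a singularity if the localization at the maximal ideal of $p$ of the reduction (quotient by the nilradical) of $\mathbb{C}[c_1,s_1,\dots,c_9,s_9]/I\,\mathbb{C}[c_1,s_1,\dots,c_9,s_9]$ is not a regular local ring. A $d$-dimensional analytic submanifold of $\mathbb{R}^n$ is a set $M\subseteq\mathbb{R}^n$ such that for every $p\in M$ there are a Euclidean open neighborhood $U\subseteq\mathbb{R}^n$ of $p$ and a real-analytic diffeomorphism $\phi\colon U\to V$ onto an open set $V\subseteq\mathbb{R}^n$ with $M\cap U=\{x\in U : \phi_{d+1}(x)=\dots=\phi_n(x)=0\}$. A point $p$ of a set $X\subseteq\mathbb{R}^n$ is a manifold point of $X$ if there is a Euclidean open neighborhood $U$ of $p$ such that $X\cap U$ is an analytic submanifold of $\mathbb{R}^n$ (of some dimension $0\le d\le n$). ''Isolated'' is meant in the Euclidean topology. *)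

(* Defs.v *)
From HB Require Import structures.
From mathcomp Require Import all_boot all_order all_algebra.
From mathcomp Require Import generic_quotient ring_quotient.
From mathcomp Require Import finmap complex ring.
From mathcomp Require Import boolp classical_sets reals topology normedtype.
From mathcomp Require Import summability.
(* The notations of mpoly are incompatible with those of topology. *)
From mathcomp Require mpoly.
Import -(notations) mpoly.

Set Implicit Arguments.
Unset Strict Implicit.
Unset Printing Implicit Defensive.

Import Order.TTheory GRing.Theory Num.Theory.
Import numFieldNormedType.Exports.

Local Open Scope classical_set_scope.
Local Open Scope ring_scope.
Local Open Scope quotient_scope.

Section CommutativeAlgebra.
Variable A : comNzRingType.

(* Unlike [idealr], [is_ideal] allows the unit ideal. *)
Definition is_ideal (J : set A) : Prop :=
  J 0 /\ forall a u v, J u -> J v -> J (a * u + v).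

Definition ideal_gen (S : set A) : set A :=
  [set x | exists (n : nat) (a s : 'I_n -> A),
    (forall i, S (s i)) /\ x = \sum_(i < n) a i * s i].

Definition generated_by (J : set A) (d : nat) : Prop :=
  exists g : 'I_d -> A, J = ideal_gen (range g).

Definition noetherian : Prop :=
  forall J, is_ideal J -> exists d, generated_by J d.

Definition maximal_ideal (m : set A) : Prop :=
  [/\ is_ideal m, ~ m 1 &
      forall J, is_ideal J -> m `<=` J -> ~ J 1 -> J = m].

(* A strictly increasing chain P 0 < ... < P d of prime ideals; the values of
   P beyond d play no role. *)
Definition prime_chain (d : nat) : Prop :=
  exists P : nat -> prime_idealr A, forall i, (i < d)%N ->
    {subset (P i : pred A) <= (P i.+1 : pred A)} /\
    ~ {subset (P i.+1 : pred A) <= (P i : pred A)}.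

Definition krull_dim (d : nat) : Prop :=
  prime_chain d /\ forall e, prime_chain e -> (e <= d)%N.

Definition min_generators (J : set A) (d : nat) : Prop :=
  generated_by J d /\ forall e, generated_by J e -> (d <= e)%N.

Definition regular_local_ring : Prop :=
  noetherian /\
  exists m : set A,
    [/\ maximal_ideal m, forall m', maximal_ideal m' -> m' = m &
        exists d, krull_dim d /\ min_generators m d].

Definition nilradical : A -> bool := fun x => `[< exists k, x ^+ k = 0 >].

Lemma nilradical_idealr_closed : idealr_closed nilradical.
Proof.
split.
- by apply/asboolP; exists 1%N; rewrite expr1.
- apply/asboolP => -[k /eqP]; rewrite expr1n oner_eq0 //.
- move=> a u v /asboolP[j uj] /asboolP[k vk]; apply/asboolP.
  exists (j + k)%N; rewrite exprDn big1 // => i _.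
  have [ij|ij] := leqP i k.
    have ji : (j <= j + k - i)%N by rewrite -addnBA // leq_addr.
    by rewrite exprMn -(subnK ji) [u ^+ _]exprD uj !(mulr0, mul0r) mul0rn.
  by rewrite -(subnK (ltnW ij)) [v ^+ _]exprD vk !mulr0 mul0rn.
Qed.

HB.instance Definition _ := isIdealr.Build A nilradical nilradical_idealr_closed.

Definition reduction : comNzRingType := {ideal_quot (nilradical : idealr A)}.

End CommutativeAlgebra.

(* Localization of A at a prime ideal P: the fractions x / s with s not in P,
   modulo x / s = y / t iff u (x t - y s) = 0 for some u not in P. *)
Section Localization.
Variables (A : comNzRingType) (P : prime_idealr A).
Local Notation PP := (P : pred A).

Definition frac : Type := {x : A * A | x.2 \notin PP}.
HB.instance Definition _ := Choice.on frac.

Definition numer (x : frac) : A := (val x).1.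
Definition denom (x : frac) : A := (val x).2.

Lemma denomP (x : frac) : denom x \notin PP. Proof. exact: (valP x). Qed.

Lemma compl_primeM (s t : A) : s \notin PP -> t \notin PP -> s * t \notin PP.
Proof. by move=> sP tP; rewrite prime_idealrM negb_or sP. Qed.

Lemma compl_prime1 : (1 : A) \notin PP. Proof. by rewrite idealr1. Qed.

Definition mkfrac (x s : A) (sP : s \notin PP) : frac := exist _ (x, s) sP.

Definition frac_equiv (x y : frac) : bool :=
  `[< exists2 u, u \notin PP & u * (numer x * denom y - numer y * denom x) = 0 >].

Lemma frac_equiv_is_equiv : equiv_class_of frac_equiv.
Proof.
split=> [x|x y|y x z].
- by apply/asboolP; exists 1; [exact: compl_prime1|rewrite subrr mulr0].
- by apply/asboolP/asboolP => -[u uP e]; exists u => //;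
    rewrite -opprB mulrN e oppr0.
- move=> /asboolP[u uP e] /asboolP[v vP f]; apply/asboolP.
  exists (u * v * denom y).
    by rewrite !compl_primeM // denomP.
  have -> : u * v * denom y * (numer x * denom z - numer z * denom x) =
    v * denom z * (u * (numer x * denom y - numer y * denom x)) +
    u * denom x * (v * (numer y * denom z - numer z * denom y)).
    by ring.
  by rewrite e f !mulr0 addr0.
Qed.

Canonical frac_equiv_equiv := EquivRelPack frac_equiv_is_equiv.
Canonical frac_equiv_encModRel := defaultEncModRel frac_equiv.

Definition localization : Type := {eq_quot frac_equiv}.
HB.instance Definition _ : EqQuotient frac frac_equiv localization :=
  EqQuotient.on localization.
HB.instance Definition _ := Choice.on localization.

Lemma localization_eqP (x y : frac) :
  reflect
    (exists2 u, u \notin PP & u * (numer x * denom y - numer y * denom x) = 0)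
    (x == y %[mod localization]).
Proof. by rewrite piE; apply: (iffP (asboolP _)). Qed.

Definition zerof : frac := mkfrac 0 compl_prime1.
Definition onef : frac := mkfrac 1 compl_prime1.
Definition oppf (x : frac) : frac := mkfrac (- numer x) (denomP x).
Definition addf (x y : frac) : frac :=
  mkfrac (numer x * denom y + numer y * denom x)
    (compl_primeM (denomP x) (denomP y)).
Definition mulf (x y : frac) : frac :=
  mkfrac (numer x * numer y) (compl_primeM (denomP x) (denomP y)).

Definition loc0 : localization := lift_cst localization zerof.
Definition loc1 : localization := lift_cst localization onef.
Definition loc_opp := lift_op1 localization oppf.
Definition loc_add := lift_op2 localization addf.
Definition loc_mul := lift_op2 localization mulf.

Canonical pi_loc0_morph := PiConst loc0.
Canonical pi_loc1_morph := PiConst loc1.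

Lemma pi_loc_opp : {morph \pi_localization : x / oppf x >-> loc_opp x}.
Proof.
move=> x; unlock loc_opp; apply/eqP/localization_eqP.
have /eqP/localization_eqP := reprK (\pi_localization x).
case: (repr _) => -[a s] /= sP; case: x => -[b t] /= tP [u uP].
rewrite /numer /denom /= => e; exists u => //.
by rewrite /numer /denom /= -[RHS]e; ring.
Qed.
Canonical pi_loc_opp_morph := PiMorph1 pi_loc_opp.

Lemma pi_loc_add : {morph \pi_localization : x y / addf x y >-> loc_add x y}.
Proof.
move=> x y; unlock loc_add; apply/eqP/localization_eqP.
have /eqP/localization_eqP := reprK (\pi_localization x).
have /eqP/localization_eqP := reprK (\pi_localization y).
case: (repr _) => -[a s] /= sP; case: y => -[b t] /= tP [u uP].
rewrite /numer /denom /= => e.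
case: (repr _) => -[a' s'] /= sP'; case: x => -[b' t'] /= tP' [u' uP'].
rewrite /numer /denom /= => e'.
exists (u * u'); first exact: compl_primeM.
rewrite /numer /denom /=.
transitivity (- (u' * s' * t' * (u * (a * t - b * s))) -
              u * s * t * (u' * (a' * t' - b' * s'))); first by ring.
by rewrite e e' !mulr0 oppr0 addr0.
Qed.
Canonical pi_loc_add_morph := PiMorph2 pi_loc_add.

Lemma pi_loc_mul : {morph \pi_localization : x y / mulf x y >-> loc_mul x y}.
Proof.
move=> x y; unlock loc_mul; apply/eqP/localization_eqP.
have /eqP/localization_eqP := reprK (\pi_localization x).
have /eqP/localization_eqP := reprK (\pi_localization y).
case: (repr _) => -[a s] /= sP; case: y => -[b t] /= tP [u uP].
rewrite /numer /denom /= => e.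
case: (repr _) => -[a' s'] /= sP'; case: x => -[b' t'] /= tP' [u' uP'].
rewrite /numer /denom /= => e'.
exists (u * u'); first exact: compl_primeM.
rewrite /numer /denom /=.
transitivity (- (u' * a' * t' * (u * (a * t - b * s))) -
              u * b * s * (u' * (a' * t' - b' * s'))); first by ring.
by rewrite e e' !mulr0 oppr0 addr0.
Qed.
Canonical pi_loc_mul_morph := PiMorph2 pi_loc_mul.

Local Ltac loc_solve :=
  rewrite !piE; apply/eqP/localization_eqP; exists 1; first exact: compl_prime1;
  rewrite /oppf /addf /mulf /mkfrac /numer /denom /=; ring.

Lemma loc_addA : associative loc_add.
Proof. by move=> x y z; rewrite -[x]reprK -[y]reprK -[z]reprK; loc_solve. Qed.

Lemma loc_addC : commutative loc_add.
Proof. by move=> x y; rewrite -[x]reprK -[y]reprK; loc_solve. Qed.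

Lemma loc_add0 : left_id loc0 loc_add.
Proof. by move=> x; rewrite -[x]reprK; loc_solve. Qed.

Lemma loc_addN : left_inverse loc0 loc_opp loc_add.
Proof. by move=> x; rewrite -[x]reprK; loc_solve. Qed.

HB.instance Definition _ :=
  GRing.isZmodule.Build localization loc_addA loc_addC loc_add0 loc_addN.

Lemma loc_mulA : associative loc_mul.
Proof. by move=> x y z; rewrite -[x]reprK -[y]reprK -[z]reprK; loc_solve. Qed.

Lemma loc_mulC : commutative loc_mul.
Proof. by move=> x y; rewrite -[x]reprK -[y]reprK; loc_solve. Qed.

Lemma loc_mul1 : left_id loc1 loc_mul.
Proof. by move=> x; rewrite -[x]reprK; loc_solve. Qed.

Lemma loc_mulDl : left_distributive loc_mul loc_add.
Proof. by move=> x y z; rewrite -[x]reprK -[y]reprK -[z]reprK; loc_solve. Qed.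

Lemma loc1_neq0 : loc1 != loc0.
Proof.
rewrite piE; apply/asboolP => -[u uP].
by rewrite /numer /denom /= !mul1r mul0r subr0 mulr1 => u0; rewrite u0 rpred0 in uP.
Qed.

HB.instance Definition _ := GRing.Zmodule_isComNzRing.Build localization
  loc_mulA loc_mulC loc_mul1 loc_mulDl loc1_neq0.

End Localization.

Arguments localization {A} P.

Section AffineVarieties.
Variables (R : realType) (n : nat).

Definition zero_set (I : set (mpoly n R)) : set 'rV[R]_n :=
  [set x | forall f, I f -> meval (x 0) f = 0].

Definition complex_point (x : 'rV[R]_n) : 'I_n -> R[i] :=
  fun k => real_complex R (x 0 k).

(* The extension of I to an ideal of the complex polynomial ring. *)
Definition complex_ideal (I : set (mpoly n R)) : set (mpoly n R[i]) :=
  ideal_gen [set map_mpoly (real_complex R) f | f in I].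

Lemma meval_map_complex (p : 'rV[R]_n) (g : mpoly n R) :
  meval (complex_point p) (map_mpoly (real_complex R) g) =
  real_complex R (meval (p 0) g).
Proof.
rewrite [in RHS]mevalE rmorph_sum /map_mpoly /mmap raddf_sum /=.
apply: eq_bigr => m _; rewrite mevalM mevalC mmap1_id mevalX rmorphM rmorph_prod.
by congr (_ * _); apply: eq_bigr => k _; rewrite rmorphXn.
Qed.

Variable I : set (mpoly n R).

Lemma complex_ideal_vanish (p : 'rV[R]_n) (f : mpoly n R[i]) :
  zero_set I p -> complex_ideal I f -> meval (complex_point p) f = 0.
Proof.
move=> Ip [m [a [s [sI ->]]]]; rewrite raddf_sum big1 //= => k _.
have [g Ig <-] := sI k; rewrite mevalM.
rewrite meval_map_complex Ip // rmorph0 mulr0 //.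
Qed.

Lemma complex_ideal_is_ideal : is_ideal (complex_ideal I).
Proof.
split; first by exists 0%N, (fun=> 0), (fun=> 0); split=> [[]//|]; rewrite big_ord0.
move=> a _ _ [j [b [s [sI ->]]]] [k [c [t [tI ->]]]].
exists (j + k)%N.
exists (fun i => match split i with inl i => a * b i | inr i => c i end).
exists (fun i => match split i with inl i => s i | inr i => t i end).
split=> [i|]; first by case: split.
rewrite big_split_ord /= mulr_sumr; congr (_ + _); apply: eq_bigr => i _.
  by rewrite (unsplitK (inl i)) mulrA.
by rewrite (unsplitK (inr i)).
Qed.

(* The quotient construction requires proper ideals, and the extension of I is
   proper as soon as I has a real zero. *)
Definition complex_idealr (I0 : zero_set I !=set0) : mpoly n R[i] -> bool :=
  fun f => `[< complex_ideal I f >].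

Lemma complex_idealr_closed (I0 : zero_set I !=set0) :
  idealr_closed (complex_idealr I0).
Proof.
have [J0 JD] := complex_ideal_is_ideal.
split; first exact/asboolP.
- apply/asboolP => J1; case: I0 => p Ip.
  by have /eqP := complex_ideal_vanish Ip J1; rewrite meval1 oner_eq0.
- by move=> a u v /asboolP uJ /asboolP vJ; apply/asboolP/JD.
Qed.

HB.instance Definition _ (I0 : zero_set I !=set0) :=
  isIdealr.Build (mpoly n R[i]) (complex_idealr I0) (complex_idealr_closed I0).

Definition complex_coordinate_ring (I0 : zero_set I !=set0) : comNzRingType :=
  {ideal_quot (complex_idealr I0 : idealr (mpoly n R[i]))}.

Definition reduced_coordinate_ring (I0 : zero_set I !=set0) : comNzRingType :=
  reduction (complex_coordinate_ring I0).

Definition to_reduced (I0 : zero_set I !=set0) (f : mpoly n R[i]) :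
    reduced_coordinate_ring I0 :=
  \pi_(reduced_coordinate_ring I0) (\pi_(complex_coordinate_ring I0) f).

Lemma to_reducedP (I0 : zero_set I !=set0) (p : 'rV[R]_n) (f g : mpoly n R[i]) :
  zero_set I p -> to_reduced I0 f = to_reduced I0 g ->
  meval (complex_point p) f = meval (complex_point p) g.
Proof.
move=> Ip /eqP; rewrite -Quotient.idealrBE => /asboolP[k].
rewrite -rmorphB -rmorphXn => /eqP; rewrite -(rmorph0 \pi).
rewrite -Quotient.idealrBE subr0 => /asboolP/(complex_ideal_vanish Ip).
by rewrite rmorphXn rmorphB => /eqP; rewrite expf_eq0 => /andP[_ /eqP/subr0_eq].
Qed.

(* The maximal ideal, in the reduced complex coordinate ring, of a real zero p
   of I. *)
Definition point_ideal (I0 : zero_set I !=set0) (p : 'rV[R]_n)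
    (Ip : zero_set I p) : reduced_coordinate_ring I0 -> bool :=
  fun b => `[< exists2 f, meval (complex_point p) f = 0 & to_reduced I0 f = b >].
Arguments point_ideal I0 {p} Ip b.

Lemma to_reduced_surj (I0 : zero_set I !=set0) (b : reduced_coordinate_ring I0) :
  exists f, to_reduced I0 f = b.
Proof. by exists (repr (repr b)); rewrite /to_reduced !reprK. Qed.

Lemma point_ideal_closed (I0 : zero_set I !=set0) (p : 'rV[R]_n)
  (Ip : zero_set I p) : idealr_closed (point_ideal I0 Ip).
Proof.
split.
- by apply/asboolP; exists 0; rewrite ?meval0 // /to_reduced !rmorph0.
- apply/asboolP => -[f f0 f1].
  have : to_reduced I0 f = to_reduced I0 1 by rewrite f1 /to_reduced !rmorph1.
  by move/(to_reducedP Ip)/eqP; rewrite f0 meval1 eq_sym oner_eq0.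
- move=> a u v /asboolP[f f0 <-] /asboolP[g g0 <-]; apply/asboolP.
  have [h <-] := to_reduced_surj a.
  exists (h * f + g); first by rewrite mevalD mevalM f0 g0 mulr0 addr0.
  by rewrite /to_reduced !rmorphD !rmorphM.
Qed.

Lemma point_ideal_prime (I0 : zero_set I !=set0) (p : 'rV[R]_n)
  (Ip : zero_set I p) : prime_idealr_closed (point_ideal I0 Ip).
Proof.
move=> u v; have [f <-] := to_reduced_surj u; have [g <-] := to_reduced_surj v.
move=> /asboolP[h h0]; rewrite /to_reduced -!rmorphM => /(to_reducedP Ip).
rewrite h0 mevalM => /esym/eqP; rewrite mulf_eq0.
by case/orP => /eqP e; apply/orP; [left|right]; apply/asboolP;
  [exists f|exists g].
Qed.

HB.instance Definition _ (I0 : zero_set I !=set0) (p : 'rV[R]_n)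
    (Ip : zero_set I p) :=
  isIdealr.Build (reduced_coordinate_ring I0) (point_ideal I0 Ip)
    (point_ideal_closed I0 Ip).
HB.instance Definition _ (I0 : zero_set I !=set0) (p : 'rV[R]_n)
    (Ip : zero_set I p) :=
  isPrimeIdealrClosed.Build (reduced_coordinate_ring I0) (point_ideal I0 Ip)
    (@point_ideal_prime I0 p Ip).

Definition local_ring_at (p : 'rV[R]_n) (Ip : zero_set I p) : comNzRingType :=
  localization
    (point_ideal (ex_intro _ p Ip) Ip : prime_idealr (reduced_coordinate_ring _)).

Definition singularity (p : 'rV[R]_n) : Prop :=
  exists Ip : zero_set I p, ~ regular_local_ring (local_ring_at Ip).

End AffineVarieties.

Section AnalyticSubmanifolds.
Variables (R : realType) (n : nat).

(* Near a, f is the sum of a power series, in the sense of unconditional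
   (equivalently, absolute) convergence over the multi-indices. *)
Definition analytic_at (f : 'rV[R]_n -> R) (a : 'rV[R]_n) : Prop :=
  exists c : {ffun 'I_n -> nat} -> R, nbhs a [set x : 'rV[R]_n |
    partial_sum (fun m => c m * \prod_(i < n) (x 0 i - a 0 i) ^+ m i)
      @ totally --> f x].

Definition analytic_map_on (U : set 'rV[R]_n) (f : 'rV[R]_n -> 'rV[R]_n) : Prop :=
  forall a, U a -> forall i, analytic_at (fun x => f x 0 i) a.

Definition analytic_diffeo (U V : set 'rV[R]_n) (phi : 'rV[R]_n -> 'rV[R]_n) :
    Prop :=
  exists psi : 'rV[R]_n -> 'rV[R]_n,
    [/\ phi @` U `<=` V, psi @` V `<=` U,
        {in U, cancel phi psi}, {in V, cancel psi phi} &
        analytic_map_on U phi /\ analytic_map_on V psi].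

(* Coordinates are numbered from 0, so phi_(d+1), ..., phi_n are the phi i
   with d <= i. *)
Definition analytic_submanifold (d : nat) (M : set 'rV[R]_n) : Prop :=
  forall p, M p -> exists U V : set 'rV[R]_n, exists phi : 'rV[R]_n -> 'rV[R]_n,
    [/\ open U, U p, open V, analytic_diffeo U V phi &
        M `&` U = [set x | U x /\ forall i : 'I_n, (d <= i)%N -> phi x 0 i = 0]].

Definition manifold_point (X : set 'rV[R]_n) (p : 'rV[R]_n) : Prop :=
  exists U : set 'rV[R]_n, [/\ open U, U p &
    exists2 d, (d <= n)%N & analytic_submanifold d (X `&` U)].

End AnalyticSubmanifolds.

(* The coordinates c_i and s_i, 1 <= i <= 9, of R^18 are the entries of index
   2 (i - 1) and 2 (i - 1) + 1. *)
Definition c_index (i : nat) : 'I_18 := inord (i.-1).*2.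
Definition s_index (i : nat) : 'I_18 := inord (i.-1).*2.+1.

Section ThreeRRR.
Variable R : realType.

Definition cvar (i : nat) : mpoly 18 R := mpolyX R (mnm1 (c_index i)).
Definition svar (i : nat) : mpoly 18 R := mpolyX R (mnm1 (s_index i)).

Definition rrr_polys : seq (mpoly 18 R) :=
  let c := cvar in let s := svar in
  [:: c 1%N + c 2%N + c 3%N + c 4%N + c 5%N - 1;
      s 1%N + s 2%N + s 3%N + s 4%N + s 5%N - 1;
      c 1%N + c 2%N + c 6%N + c 7%N + c 8%N - 1;
      s 1%N + s 2%N + s 6%N + s 7%N + s 8%N;
      c 6%N + c 9%N - c 3%N;
      s 6%N + s 9%N - s 3%N]
  ++ [seq c i ^+ 2 + s i ^+ 2 - 1 | i <- iota 1 9].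

Definition rrr_ideal : set (mpoly 18 R) := ideal_gen [set` rrr_polys].

Definition rrr_space : set 'rV[R]_18 := zero_set rrr_ideal.

Definition rrr_point : 'rV[R]_18 :=
  let r := Num.sqrt 3%:R / 2%:R : R in let h := 1 / 2%:R : R in
  \row_(k < 18) nth 0
    [:: r; - h;
        1; 0;
        - r; - h;
        0; 1;
        0; 1;
        - r; h;
        0; 1;
        0; -1;
        0; -1] k.

End ThreeRRR.

Arguments rrr_polys : clear implicits.
Arguments rrr_ideal : clear implicits.
Arguments rrr_space : clear implicits.
Arguments rrr_point : clear implicits.

(* Main.v *)
(** A complete intersection with linearly independent differentials at a point has
    a regular local ring O there: by Nakayama its maximal ideal has d generators;
    sending a function to its Taylor series along formal arcs with independent
    parameters s_1, ..., s_d, and setting s_1, ..., s_i to 0, one gets d + 1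
    nested kernels, which are primes; and a longer chain P_0 < ... < P_e of primes is
    impossible, because the monomials in elements y_i of P_(i+1) outside P_i are
    independent modulo high powers of the maximal ideal (Artin-Rees), and there
    are too many of them.

    So a singularity carries an equilibrium stress of the linkage. If the three
    legs 1-2, 4-5 and 7-8 are all loaded, they are folded or stretched, and the
    lengths exclude both; otherwise the links 1, 2, 6, 7, 8 are horizontal or the
    links 4, 5, 7, 8, 9 are vertical. A reflection exchanges the two cases. In the
    first one sum_i c_i(p) |u_i - u_i(p)|^2 vanishes on X, the sum being over
    i = 1, 2, 6, 7, 8 and u_i = (c_i, s_i), but X contains motions that are not
    orthogonal for this quadratic form, whereas on a manifold two small motions
    can be added up to second order. *)

(* Regularity equates the Krull dimension with the least number of generators of the maximal ideal.
   One inequality serves both sides: no chain of primes is longer than a family generating the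
   maximal ideal. For the d linear parameters it bounds every chain; for the chain of arc kernels it
   bounds every generating family. The ring is the local ring of a reduced quotient whose radical is
   not computed: g maps to 0 iff some (h g)^k lies in I with h nonzero at the point, and a prime
   that contains I and consists of functions vanishing there ignores both h and k.

   On the geometric side neither a tangent cone nor the dimension of X at p is computed. On a
   manifold, displacements x - p and y - p of size e add up to a point of X with an error O(e^2); a
   quadratic form vanishing on X then has a polar form O(e^3) on such pairs. Two rotations that
   share exactly one link, of size t with e proportional to t, give a polar value of at least 2 t^2.

   The links 3, 6, 9 form an equilateral triangle, so a number w with w^2 = 3 enters the equations;
   stretched legs are excluded because every case forces a rational value of w. *)
From HB Require Import structures.
Require Import Defs.
From mathcomp Require Import all_boot all_order all_algebra.
From mathcomp Require Import generic_quotient ring_quotient.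
From mathcomp Require Import finmap complex ring lra zify.
From mathcomp Require Import boolp classical_sets reals topology normedtype.
From mathcomp Require Import summability.
From mathcomp Require mpoly.
Import -(notations) mpoly.

Set Implicit Arguments.
Unset Strict Implicit.
Unset Printing Implicit Defensive.

Import Order.TTheory GRing.Theory Num.Theory.
Import numFieldNormedType.Exports.

Local Open Scope classical_set_scope.
Local Open Scope ring_scope.
Local Open Scope quotient_scope.

(** * Noetherian rings *)

Section Noetherian.
Variable A : comNzRingType.

Lemma ideal_sum (J : set A) (k : nat) (a s : 'I_k -> A) :
  is_ideal J -> (forall i, J (s i)) -> J (\sum_(i < k) a i * s i).
Proof.
move=> [J0 JD] Js; elim/big_ind: _ => // [u v Ju Jv|i _].
  by rewrite -[u]mul1r; exact: JD.
by rewrite -[_ * _]addr0; exact: JD.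
Qed.

Lemma idealD (J : set A) u v : is_ideal J -> J u -> J v -> J (u + v).
Proof. by move=> [_ JD] Ju Jv; rewrite -[u]mul1r; exact: JD. Qed.

Lemma idealM (J : set A) a u : is_ideal J -> J u -> J (a * u).
Proof. by move=> [J0 JD] Ju; rewrite -[_ * _]addr0; exact: JD. Qed.

Lemma idealN (J : set A) u : is_ideal J -> J u -> J (- u).
Proof. by move=> J_ Ju; rewrite -mulN1r; exact: idealM. Qed.

Lemma idealB (J : set A) u v : is_ideal J -> J u -> J v -> J (u - v).
Proof. by move=> J_ Ju Jv; apply: idealD => //; exact: idealN. Qed.

(** Coefficients are indexed by [nat], not by ['I_(size s)], so that they can be composed with a
    morphism and used with [map f s] without casts between ordinals. *)
Definition span (s : seq A) : set A :=
  [set x | exists a : nat -> A, x = \sum_(i < size s) a i * s`_i].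

Lemma span_ideal s : is_ideal (span s).
Proof.
split; first by exists (fun=> 0); rewrite big1 // => i _; rewrite mul0r.
move=> a _ _ [b ->] [c ->]; exists (fun i => a * b i + c i).
by rewrite mulr_sumr -big_split /=; apply: eq_bigr => i _; rewrite mulrDl mulrA.
Qed.

Lemma span_mem s x : x \in s -> span s x.
Proof.
move=> xs; exists (fun i => (i == index x s)%:R).
have ilt : (index x s < size s)%N by rewrite index_mem.
rewrite (bigD1 (Ordinal ilt)) //= eqxx mul1r nth_index // big1 ?addr0 //.
move=> i; rewrite -val_eqE /= => /negbTE ->.
by rewrite mul0r.
Qed.

Lemma span_min (J : set A) s :
  is_ideal J -> (forall x, x \in s -> J x) -> span s `<=` J.
Proof.
move=> J_ sJ _ [a ->]; apply: (@ideal_sum J _ a (fun i : 'I_(size s) => s`_i)) => // i.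
exact/sJ/mem_nth.
Qed.

Lemma generated_by_ideal (J : set A) d : generated_by J d -> is_ideal J.
Proof.
move=> [g ->]; split.
  exists 0%N, (fun=> 0), (fun=> 0); split=> [[]//|].
  by rewrite big_ord0.
move=> a _ _ [j [b [s [sI ->]]]] [k [c [t [tI ->]]]].
exists (j + k)%N.
exists (fun i => match split i with inl i => a * b i | inr i => c i end).
exists (fun i => match split i with inl i => s i | inr i => t i end).
split=> [i|]; first by case: split.
rewrite big_split_ord /= mulr_sumr; congr (_ + _); apply: eq_bigr => i _.
  by rewrite (unsplitK (inl i)) mulrA.
by rewrite (unsplitK (inr i)).
Qed.

Lemma generated_byP (J : set A) d : generated_by J d <->
  is_ideal J /\ exists g : 'I_d -> A,
    (forall i, J (g i)) /\ forall x, J x -> exists a, x = \sum_(i < d) a i * g i.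
Proof.
split=> [Jd|[J_ [g [gJ Jg]]]].
  split; first exact: generated_by_ideal Jd.
  case: Jd => g ->; exists g; split=> [i|x [k [a [s [sg ->]]]]].
    exists 1%N, (fun=> 1), (fun=> g i); split=> [_|]; first by exists i.
    by rewrite big_ord1 mul1r.
  have /choice[f fE] : forall i, exists j, g j = s i.
    by move=> i; have [j _ <-] := sg i; exists j.
  exists (fun j => \sum_(i < k | f i == j) a i).
  under [RHS]eq_bigr do rewrite mulr_suml.
  rewrite (exchange_big_dep xpredT) //=; apply: eq_bigr => i _.
  by rewrite (big_pred1 (f i)) ?fE // => j; rewrite eq_sym.
exists g; rewrite eqEsubset; split=> [x /Jg[a ->]|_ [k [a [s [sg ->]]]]].
  by exists d, a, g; split=> // i; exists i.
by apply: ideal_sum => // i; have [j _ <-] := sg i.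
Qed.

Lemma noetherianP : noetherian A <->
  forall J, is_ideal J -> exists s : seq A, (forall x, x \in s -> J x) /\ J `<=` span s.
Proof.
split=> [noeA J J_|H J J_].
  have [d /generated_byP[_ [g [gJ Jg]]]] := noeA _ J_.
  exists (codom g); split=> [_ /codomP[i ->] //|x /Jg[a ->]].
  apply: ideal_sum; first exact: span_ideal.
  by move=> i; apply/span_mem/codom_f.
have [s [sJ Js]] := H _ J_.
exists (size s); apply/generated_byP; split=> //.
exists (fun i => s`_i); split=> [i|x /Js[a ->]]; first exact/sJ/mem_nth.
by exists a.
Qed.

End Noetherian.

Lemma span_subset (A : comNzRingType) (s t : seq A) :
  {subset s <= t} -> span s `<=` span t.
Proof.
move=> st; apply: span_min; first exact: span_ideal.
by move=> x /st; exact: span_mem.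
Qed.

Lemma noetherian_surj (A B : comNzRingType) (f : {rmorphism A -> B}) :
  (forall b, exists a, f a = b) -> noetherian A -> noetherian B.
Proof.
move=> fsurj /noetherianP noeA; apply/noetherianP => J J_.
have [s [sJ Js]] : exists s : seq A, (forall x, x \in s -> J (f x)) /\
    [set x | J (f x)] `<=` span s.
  apply: noeA; case: J_ => J0 JD; split=> [|a u v Ju Jv] /=.
    by rewrite rmorph0.
  by rewrite rmorphD rmorphM; exact: JD.
exists (map f s); split=> [_ /mapP[x /sJ Jx ->] //|b].
have [a <-] := fsurj b => /Js[c ->].
exists (f \o c); rewrite rmorph_sum size_map; apply: eq_bigr => i _.
by rewrite rmorphM (nth_map 0).
Qed.

(** * Hilbert's basis theorem *)

Section HilbertBasis.
Variable A : comNzRingType.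
Hypothesis noeA : noetherian A.
Variable J : set {poly A}.
Hypothesis J_ : is_ideal J.

(** The coefficient at n is taken even when the degree is smaller; it is then 0, which is what makes
    [lead n] an ideal. *)
Let lead (n : nat) : set A := [set a | exists2 p, J p & (size p <= n.+1)%N /\ p`_n = a].

Let lead_ideal n : is_ideal (lead n).
Proof.
split; first by exists 0; [case: J_|rewrite size_poly0 coef0].
move=> a _ _ [p Jp [sp <-]] [q Jq [sq <-]]; exists (a%:P * p + q).
  by case: J_ => _; exact.
split; last by rewrite coefD coefCM.
rewrite (leq_trans (size_polyD _ _)) // geq_max sq andbT mul_polyC.
exact: leq_trans (size_scale_leq _ _) sp.
Qed.

Let leads : set A := [set a | exists n, lead n a].

Let lead_up n m : (n <= m)%N -> lead n `<=` lead m.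
Proof.
move=> nm _ [p Jp [sp <-]]; exists ('X^(m - n) * p); first exact: idealM.
split; last by rewrite coefXnM ltnNge leq_subr /= subKn.
apply: leq_trans (size_polyMleq _ _) _; rewrite size_polyXn.
lia.
Qed.

Let leads_ideal : is_ideal leads.
Proof.
split; first by exists 0%N; case: (lead_ideal 0).
move=> a u v [n un] [m vm]; exists (n + m)%N; apply: (lead_ideal _).2.
  by apply: lead_up un; rewrite leq_addr.
by apply: lead_up vm; rewrite leq_addl.
Qed.

Let lift n (t : seq A) : (forall a, a \in t -> lead n a) ->
  exists u : seq {poly A}, [/\ forall p, p \in u -> J p,
    forall p, p \in u -> (size p <= n.+1)%N & map (fun p : {poly A} => p`_n) u = t].
Proof.
elim: t => [|a t IH] H; first by exists [::].
have [u [uJ us <-]] := IH (fun b bt => H b (mem_behead (s := a :: t) bt)).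
have [p Jp [sp <-]] := H a (mem_head a t).
exists (p :: u); split=> // q; rewrite inE => /predU1P[-> //|].
  exact: uJ.
exact: us.
Qed.

Let reduce n (t : seq A) (u : seq {poly A}) (p : {poly A}) : (forall q : {poly A}, q \in u -> (size q <= n.+1)%N) ->
  map (fun p : {poly A} => p`_n) u = t -> (size p <= n.+1)%N -> span t p`_n ->
  exists2 q, span u q & (size (p - q)%R <= n)%N.
Proof.
move=> us ut sp [a pE]; exists (\sum_(i < size u) (a i)%:P * u`_i).
  by exists (fun i => (a i)%:P).
apply/leq_sizeP => j nj; rewrite coefB coef_sum.
have [jn|jn] := eqVneq j n.
  rewrite jn pE -ut size_map.
  under [X in _ - X]eq_bigr do rewrite coefCM.
  apply/eqP; rewrite subr_eq0; apply/eqP/eq_bigr => i _.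
  by rewrite (nth_map 0).
have nj' : (n < j)%N by rewrite ltn_neqAle eq_sym jn.
rewrite nth_default ?(leq_trans sp) // big1 ?subr0 // => i _.
by rewrite coefCM nth_default ?mulr0 // (leq_trans _ nj') // us // mem_nth.
Qed.

(** Bounded degrees are treated one at a time: generators of [lead n] are lifted to J, and
    subtracting a combination of the lifts lowers the degree. *)
Let fg_le n : exists s : seq {poly A}, (forall p, p \in s -> J p) /\
  forall p, J p -> (size p <= n)%N -> span s p.
Proof.
elim: n => [|n [s [sJ Js]]].
  exists [::]; split=> // p _; rewrite leqn0 size_poly_eq0 => /eqP ->.
  exact: (span_ideal _).1.
have [t [tL Lt]] := (noetherianP A).1 noeA _ (lead_ideal n).
have [u [uJ us ut]] := lift tL.
exists (s ++ u); split=> [p|p Jp sp].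
  by rewrite mem_cat => /orP[/sJ|/uJ].
have [|q uq spq] := reduce us ut sp; first by apply: Lt; exists p.
rewrite -[p](subrK q); apply: idealD; first exact: span_ideal.
  apply: (span_subset (s := s)); first by move=> x xs; rewrite mem_cat xs.
  apply: Js => //; apply: idealB => //.
  exact: span_min uq.
by apply: span_subset uq => x xs; rewrite mem_cat xs orbT.
Qed.

Lemma hilbert_basis_ideal :
  exists s : seq {poly A}, (forall p, p \in s -> J p) /\ J `<=` span s.
Proof.
have [t [tL Lt]] := (noetherianP A).1 noeA _ leads_ideal.
(* Finite generation of the union [leads] replaces the ascending chain condition: all its generators
   already occur in one degree N. *)
have [N tN] : exists N, forall a, a \in t -> lead N a.
  elim: t tL {Lt} => [|a t IH] H; first by exists 0%N.
  have [N HN] := IH (fun b bt => H b (mem_behead (s := a :: t) bt)).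
  have [n an] := H a (mem_head a t).
  exists (n + N)%N => b; rewrite inE => /predU1P[->|/HN].
    by apply: lead_up an; rewrite leq_addr.
  by apply: lead_up; rewrite leq_addl.
have [s [sJ Js]] := fg_le N.+1.
have [u [uJ us ut]] := lift tN.
exists (s ++ u); split=> [p|p].
  by rewrite mem_cat => /orP[/sJ|/uJ].
have [n] := ubnP (size p); elim: n p => // n IH p spn Jp.
have [spN|spN] := leqP (size p) N.+1.
  by apply: (span_subset (s := s)); [move=> x xs; rewrite mem_cat xs|exact: Js].
have [m sm] : exists m, size p = m.+1 by exists (size p).-1; rewrite prednK ?(leq_trans _ spN).
have Nm : (N <= m)%N by rewrite sm in spN; exact: ltnW.
(* Above degree N, the lifts u are shifted to the degree m of p, where they cancel its leading
   coefficient. *)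
pose v := map (fun q => 'X^(m - N) * q) u.
have [q vq spq] : exists2 q, span v q & (size (p - q)%R <= m)%N.
  apply: (@reduce m t v) => [_ /mapP[q qu ->]|||].
  - apply: leq_trans (size_polyMleq _ _) _; rewrite size_polyXn.
    by have := us _ qu; lia.
  - rewrite -ut -map_comp; apply: eq_map => q /=.
    by rewrite coefXnM ltnNge leq_subr /= subKn.
  - by rewrite sm.
  - by apply: Lt; exists m, p => //; rewrite sm.
have uq : span u q.
  move: vq; apply: span_min; first exact: span_ideal.
  move=> _ /mapP[r ru ->]; apply: idealM; first exact: span_ideal.
  exact: span_mem.
rewrite -[p](subrK q); apply: idealD; first exact: span_ideal.
  apply: IH; first by rewrite -ltnS (leq_trans _ spn) // sm !ltnS.
  by apply: idealB => //; exact: span_min uq.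
by apply: span_subset uq => x xs; rewrite mem_cat xs orbT.
Qed.

End HilbertBasis.

Lemma noetherian_poly (A : comNzRingType) : noetherian A -> noetherian {poly A}.
Proof. by move=> noeA; apply/noetherianP => J; exact: hilbert_basis_ideal. Qed.

Lemma noetherian_field (K : fieldType) : noetherian K.
Proof.
apply/noetherianP => J J_; have [[x Jx x0]|H] := pselect (exists2 x, J x & x != 0).
  exists [:: x]; split=> [y|y Jy]; first by rewrite inE => /eqP ->.
  by exists (fun=> y / x); rewrite big_ord1 divfK.
exists [::]; split=> // x Jx; exists (fun=> 0); rewrite big_ord0.
by apply/eqP; apply: contrapT => /negP x0; apply: H; exists x.
Qed.

Lemma mpoly_ind_alg (n : nat) (A : nzRingType) (P : mpoly n A -> Prop) :
  (forall c, P (mpolyC n c)) -> (forall i, P (mpolyX A (mnm1 i))) ->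
  (forall p q, P p -> P q -> P (p + q)) -> (forall p q, P p -> P q -> P (p * q)) ->
  forall p, P p.
Proof.
move=> PC PX PD PM p; rewrite [p]mpolyE.
apply: (big_ind P) => [||m _]; [exact: (PC 0)|exact: PD|].
rewrite -mul_mpolyC; apply: (PM) => //; rewrite mpolyXE_id.
have P1 : P 1 by exact: (PC 1).
apply: (big_ind P) => [//||i _]; [exact: PM|elim: (m i)] => [|k IH]; first by rewrite expr0.
by rewrite exprS; exact: PM.
Qed.

(** A surjection from [{poly (mpoly n A)}] suffices for the induction; it sends the variable to the
    last one. *)
Lemma noetherian_mpoly (n : nat) (A : comNzRingType) : noetherian A -> noetherian (mpoly n A).
Proof.
move=> noeA; elim: n => [|n IH].
  apply: (noetherian_surj (f := @mpolyC 0 A)) noeA => p.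
  by exists (mcoeff (@mnm0 0) p); rewrite [RHS]nvar0_mpolyC.
have cX : commr_rmorph (@mwiden n A) (mpolyX A (mnm1 ord_max)) by move=> p; exact: mulrC.
apply: (noetherian_surj (f := horner_morph cX)) (noetherian_poly IH).
elim/mpoly_ind_alg => [c|i|p q [a <-] [b <-]|p q [a <-] [b <-]].
- by exists (mpolyC n c)%:P; rewrite [LHS]horner_morphC; exact: mwidenC.
- have [j ->|->] := unliftP ord_max i.
    exists (mpolyX A (mnm1 j))%:P; rewrite [LHS]horner_morphC [LHS]mwidenX mnmwiden1.
    by congr (mpolyX _ (mnm1 _)); apply: val_inj; rewrite /= /bump leqNgt ltn_ord.
  by exists 'X; rewrite [LHS]horner_morphX.
- by exists (a + b); rewrite rmorphD.
- by exists (a * b); rewrite rmorphM.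
Qed.

(** * Chains of primes in a local ring with d generators of the maximal ideal *)

Section IdealPowers.
Variables (A : comNzRingType) (d : nat) (l : 'I_d -> A).

Fixpoint ipow (N : nat) : set A :=
  if N is N'.+1 then
    [set x | exists z : 'I_d -> A, (forall i, ipow N' (z i)) /\ x = \sum_(i < d) z i * l i]
  else setT.

Lemma ipow_ideal N : is_ideal (ipow N).
Proof.
elim: N => [//|N [I0 ID]]; split=> /=.
  by exists (fun=> 0); split=> //; rewrite big1 // => i _; rewrite mul0r.
move=> a _ _ [z [Iz ->]] [w [Iw ->]]; exists (fun i => a * z i + w i).
split=> [i|]; first exact: ID.
by rewrite mulr_sumr -big_split /=; apply: eq_bigr => i _; rewrite mulrDl mulrA.
Qed.

Lemma ipowS N : ipow N.+1 `<=` ipow N.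
Proof.
move=> x [z [Iz ->]].
rewrite (eq_bigr (fun i => l i * z i)); last by move=> i _; rewrite mulrC.
exact: ideal_sum (ipow_ideal N) Iz.
Qed.

Lemma ipow_le M N : (M <= N)%N -> ipow N `<=` ipow M.
Proof.
elim: N => [|N IH]; first by rewrite leqn0 => /eqP ->.
by rewrite leq_eqVlt ltnS => /predU1P[-> //|/IH MN] x /ipowS/MN.
Qed.

Lemma ipowM M N x y : ipow M x -> ipow N y -> ipow (M + N) (x * y).
Proof.
elim: M x => [|M IH] x; first by move=> _ Iy; exact: idealM (ipow_ideal N) Iy.
rewrite addSn => -[z [Iz ->]] Iy; exists (fun i => z i * y).
split=> [i|]; first exact: IH (Iz i) Iy.
by rewrite mulr_suml; apply: eq_bigr => i _; rewrite mulrAC.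
Qed.

Lemma ipow_gen i : ipow 1 (l i).
Proof.
exists (fun j => (j == i)%:R); split=> //.
rewrite (bigD1 i) //= eqxx mul1r big1 ?addr0 // => j /negbTE ->.
by rewrite mul0r.
Qed.

Lemma ipowXn i k : ipow k (l i ^+ k).
Proof.
elim: k => [//|k IH]; rewrite exprS -add1n.
by apply: ipowM => //; exact: ipow_gen.
Qed.

Lemma ipow_monomial (m : 'I_d -> nat) : ipow (\sum_i m i) (\prod_i l i ^+ m i).
Proof.
apply: (big_ind2 (fun (k : nat) (x : A) => ipow k x)) => // [*|i _].
  exact: ipowM.
exact: ipowXn.
Qed.

Lemma ipow_dhomog N F : F \in ishomog1 N (@mdeg d) -> ipow N (meval l F).
Proof.
move=> /dhomogP homF; rewrite mevalE big_seq.
elim/big_ind: _ => [|x y|m mF]; [exact: (ipow_ideal N).1|exact: idealD (ipow_ideal N)|].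
apply: idealM (ipow_ideal N) _.
have <- : mdeg m = N := homF _ mF.
by rewrite mdegE; exact: ipow_monomial.
Qed.

(** Powers of the ideal become degrees of forms, so that Hilbert's basis theorem in A[X_1, ..., X_d]
    can play the role of a Noetherian Rees algebra. *)
Lemma ipow_homogeneous N x : ipow N x ->
  exists2 F : mpoly d A, F \in ishomog1 N (@mdeg d) & meval l F = x.
Proof.
elim: N x => [|N IH] x /=.
  move=> _; exists (mpolyC d x); last exact: mevalC.
  apply/dhomogP => m; rewrite msuppC; case: ifP => // _; rewrite inE => /eqP ->.
  exact: mdeg0.
move=> [z [Iz ->]].
have /choice[F FE] i : exists F : mpoly d A,
    F \in ishomog1 N (@mdeg d) /\ meval l F = z i.
  by have [F ? ?] := IH _ (Iz i); exists F.
exists (\sum_i F i * mpolyX A (mnm1 i)).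
  apply: rpred_sum => i _; rewrite -addn1; apply: dhomogM; first by case: (FE i).
  by rewrite dhomogX /= mdeg1.
rewrite raddf_sum; apply: eq_bigr => i _ /=.
by rewrite mevalM mevalXU (FE i).2.
Qed.

End IdealPowers.

Lemma pihomogM (n : nat) (A : comNzRingType) (p q : mpoly n A) (j k N : nat) :
  (mmeasure (@mdeg n) p <= j)%N -> (mmeasure (@mdeg n) q <= k)%N ->
  pihomog (@mdeg n) N (p * q) = \sum_(a < j) \sum_(b < k | (a + b)%N == N)
    pihomog (@mdeg n) a p * pihomog (@mdeg n) b q.
Proof.
move=> pj qk; rewrite {1}(pihomog_partitionE pj) {1}(pihomog_partitionE qk).
rewrite big_distrlr /= raddf_sum; apply: eq_bigr => a _.
rewrite raddf_sum [RHS]big_mkcond; apply: eq_bigr => b _ /=.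
have hab : pihomog (@mdeg n) a p * pihomog (@mdeg n) b q \in ishomog1 (a + b) (@mdeg n).
  by apply: dhomogM; exact: pihomogP.
case: eqP => [<-|/eqP ab]; first exact: pihomog_dE.
exact: pihomog_ne0 ab hab.
Qed.

(** The polynomials all of whose homogeneous components take values in P + (y) at l form a finitely
    generated ideal; let k exceed the degrees of its generators. A form of degree N + k with value w
    is a combination of them, and its cofactors have degree at least N, so w = y w' modulo P with w'
    in the N-th power. As P is prime, y cancels in y x = y w'. *)
Lemma artin_rees_colon (A : comNzRingType) (d : nat) (l : 'I_d -> A) (P : set A) (y : A) :
  noetherian A -> is_ideal P -> (forall u v, P (u * v) -> P u \/ P v) -> ~ P y ->
  exists k, forall N x w, ipow l (N + k) w -> P (y * x - w) ->
    exists2 w', ipow l N w' & P (x - w').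
Proof.
move=> noeA P_ Pprime Py.
pose J : set A := [set x | exists z, P (x - y * z)].
have J_ : is_ideal J.
  split; first by exists 0; rewrite mulr0 subrr; case: P_.
  move=> a u v [z Pz] [t Pt]; exists (a * z + t).
  have -> : a * u + v - y * (a * z + t) = a * (u - y * z) + (v - y * t) by ring.
  by case: P_ => _; exact.
pose FF : set (mpoly d A) := [set F | forall N, J (meval l (pihomog (@mdeg d) N F))].
have FF_ : is_ideal FF.
  split=> [N|G F F' FJ FJ' N]; first by rewrite raddf0 meval0; case: J_.
  rewrite raddfD /= mevalD; apply: idealD => //.
  rewrite (pihomogM _ (leqnn _) (leqnn _)) raddf_sum.
  elim/big_ind: _ => [|u v|a _]; [by case: J_|exact: idealD|].
  rewrite raddf_sum; elim/big_ind: _ => [|u v|b _]; [by case: J_|exact: idealD|].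
  by rewrite /= mevalM; exact: idealM.
have [s [sFF FFs]] := (noetherianP _).1 (noetherian_mpoly (n := d) noeA) _ FF_.
have [k sk] : exists k, forall F, F \in s -> (mmeasure (@mdeg d) F <= k)%N.
  elim: s {sFF FFs} => [|F s [k sk]]; first by exists 0%N.
  exists (mmeasure (@mdeg d) F + k)%N => G; rewrite inE => /predU1P[->|/sk Gk].
    exact: leq_addr.
  exact: leq_trans Gk (leq_addl _ _).
exists k => N x w Iw Pw; have [F homF Fw] := ipow_homogeneous Iw.
pose Q : set A := [set f | exists2 w', ipow l N w' & P (f - y * w')].
have [I0 ID] := ipow_ideal l N.
have Q0 : Q 0 by exists 0 => //; rewrite mulr0 subrr; case: P_.
have QD u v : Q u -> Q v -> Q (u + v).
  move=> [u' Iu Pu] [v' Iv Pv]; exists (u' + v').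
    exact: idealD (ipow_ideal l N) Iu Iv.
  have -> : u + v - y * (u' + v') = (u - y * u') + (v - y * v') by ring.
  exact: idealD.
suff [w' Iw' Pw'] : Q w.
  exists w' => //; case: (Pprime y (x - w')) => //.
  have -> : y * (x - w') = (y * x - w) + (w - y * w') by ring.
  exact: idealD.
have [G FE] : span s F.
  apply: FFs => M; have [<-|NM] := eqVneq (N + k)%N M.
    rewrite pihomog_dE // Fw; exists x; rewrite -opprB; exact: idealN.
  by rewrite (pihomog_ne0 NM homF) meval0; case: J_.
rewrite -Fw -(pihomog_dE homF) FE [pihomog _ _ _]raddf_sum [meval _ _]raddf_sum.
elim/big_ind: _ => // i _.
have Fk : (mmeasure (@mdeg d) s`_i <= k)%N by apply: sk; exact: mem_nth.
rewrite -[X in Q X]/(meval l (pihomog (@mdeg d) (N + k) (G i * s`_i))).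
rewrite (pihomogM _ (leqnn _) Fk) [meval _ _]raddf_sum.
elim/big_ind: _ => // a _; rewrite [X in Q X]raddf_sum.
elim/big_ind: _ => // b /eqP ab; rewrite [X in Q X]mevalM.
have [z Pz] : J (meval l (pihomog (@mdeg d) b s`_i)).
  by apply: sFF; exact: mem_nth.
set g := meval l _; set f := meval l _ in Pz *.
exists (g * z).
  rewrite mulrC; apply: idealM; first exact: ipow_ideal.
  (* [mmeasure] is the degree plus one, so b < k; as a + b = N + k, the cofactor has degree at least
     N. *)
  have Na : (N <= a)%N by have := ltn_ord b; lia.
  by apply: (ipow_le Na); apply: ipow_dhomog; exact: pihomogP.
have -> : g * f - y * (g * z) = g * (f - y * z) by ring.
exact: idealM.
Qed.

Section ChainBound.
Variables (A : comNzRingType) (K : fieldType) (iota : {rmorphism K -> A}).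
Variables (d : nat) (l : 'I_d -> A).
Hypothesis residue : forall a, exists c, ipow l 1 (a - iota c).

Let mono (m : 'I_d -> nat) : A := \prod_i l i ^+ m i.

Let lincomb (N : nat) (c : {ffun 'I_d -> 'I_N} -> K) : A :=
  \sum_nu iota (c nu) * mono (fun i => nu i).

Let lincombD N c1 c2 : lincomb c1 + lincomb c2 = lincomb (N := N) (fun nu => c1 nu + c2 nu).
Proof. by rewrite -big_split /=; apply: eq_bigr => nu _; rewrite rmorphD mulrDl. Qed.

Let lincombM N (m : 'I_d -> nat) c : (forall i, m i < N)%N ->
  exists c', iota c * mono m = lincomb (N := N) c'.
Proof.
move=> mN; pose nu0 := [ffun i => Ordinal (mN i)].
exists (fun nu => if nu == nu0 then c else 0); rewrite /lincomb (bigD1 nu0) //= eqxx.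
rewrite big1 ?addr0 => [|nu /negbTE ->]; last by rewrite rmorph0 mul0r.
by congr (_ * _); apply: eq_bigr => i _; rewrite ffunE.
Qed.

Let lincomb_sum N (I : finType) (F : I -> A) :
  (forall i, exists c, F i = lincomb (N := N) c) -> exists c, \sum_i F i = lincomb (N := N) c.
Proof.
move=> H; elim/big_ind: _ => [|_ _ [c ->] [c' ->]|i _]; last exact: H.
  by exists (fun=> 0); rewrite /lincomb big1 // => nu _; rewrite rmorph0 mul0r.
by exists (fun nu => c nu + c' nu); rewrite lincombD.
Qed.

(** Modulo the N-th power, A is spanned over K by the N^d monomials with every exponent below N.
    This overcounts the monomials of degree below N, but only the growth of order N^d matters. *)
Let residue_pow N a : exists c, ipow l N (a - lincomb (N := N) c).
Proof.
elim: N a => [|N IH] a; first by exists (fun=> 0).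
have [c [z [_ zE]]] := residue a.
have /choice[b bz] i : exists b, ipow l N (z i - lincomb (N := N) b) by exact: IH.
have [c0 c0E] : exists c', iota c * mono (fun=> 0%N) = lincomb (N := N.+1) c'.
  exact: lincombM.
have [c1 c1E] : exists c', \sum_i lincomb (b i) * l i = lincomb (N := N.+1) c'.
  apply: lincomb_sum => i.
  rewrite /lincomb mulr_suml; apply: lincomb_sum => nu.
  rewrite -mulrA; have -> : mono (fun i => nu i) * l i = mono (fun j => nu j + (j == i))%N.
    rewrite /mono; under [RHS]eq_bigr do rewrite exprD.
    rewrite big_split; congr (_ * _); rewrite (bigD1 i) //= eqxx big1 ?mulr1 //.
    by move=> j /negbTE ->.
  by apply: lincombM => j; have := ltn_ord (nu j); case: (j == i); lia.
exists (fun nu => c0 nu + c1 nu); rewrite -lincombD -c0E -c1E.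
have -> : mono (fun=> 0%N) = 1 by rewrite /mono big1.
exists (fun i => z i - lincomb (b i)); split=> //.
rewrite mulr1 opprD addrA zE -sumrB; apply: eq_bigr => i _.
by rewrite mulrBl.
Qed.

(** Exponent vectors are nested pairs, so that induction on e splits off the exponent of the first
    variable and shifts the sequence y. *)
Fixpoint mon_index (M e : nat) : finType :=
  if e is e'.+1 then ('I_M * mon_index M e')%type else unit.

Fixpoint monomial (M e : nat) : (nat -> A) -> mon_index M e -> A :=
  match e with
  | 0 => fun _ _ => 1
  | e'.+1 => fun y mu => y 0%N ^+ mu.1 * monomial (fun i => y i.+1) mu.2
  end.

Lemma card_mon_index M e : #|mon_index M e| = (M ^ e)%N.
Proof. by elim: e => [|e IH] /=; rewrite ?card_unit // card_prod card_ord IH expnS. Qed.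

Let addp (P : set A) N : set A := [set x | exists2 w, ipow l N w & P (x - w)].

Let addp_ideal P N : is_ideal P -> is_ideal (addp P N).
Proof.
move=> P_; have I_ := ipow_ideal l N; split.
  by exists 0; [exact: I_.1|rewrite subrr; exact: P_.1].
move=> a u v [u' Iu Pu] [v' Iv Pv]; exists (a * u' + v'); first exact: I_.2.
have -> : a * u + v - (a * u' + v') = a * (u - u') + (v - v') by ring.
exact: P_.2.
Qed.

Let addp_le P M N : (M <= N)%N -> addp P N `<=` addp P M.
Proof. by move=> MN x [w Iw Pw]; exists w => //; exact: ipow_le Iw. Qed.

Let addp_ipow P N x : is_ideal P -> ipow l N x -> addp P N x.
Proof. by move=> P_ Ix; exists x => //; rewrite subrr; exact: P_.1. Qed.

Let addp_mem P N x : P x -> addp P N x.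
Proof. by exists 0; [exact: (ipow_ideal l N).1|rewrite subr0]. Qed.

(* The lexicographically smallest monomial is peeled off variable by variable:
   modulo P_i, cancelling y_i costs k powers of the maximal ideal, and y_i is
   zero modulo P_(i+1). *)
Let monomial_independent (k M e : nat) (P : nat -> set A) (y : nat -> A) :
  ~ ipow l 1 1 -> P e `<=` ipow l 1 ->
  (forall i, is_ideal (P i)) -> (forall i, (i < e)%N -> P i `<=` P i.+1) ->
  (forall i, (i < e)%N -> P i.+1 (y i)) ->
  (forall i, (i < e)%N -> forall N x, addp (P i) (N + k) (y i * x) -> addp (P i) N x) ->
  forall v : mon_index M e -> K,
    addp (P 0%N) (1 + k * M * e) (\sum_mu iota (v mu) * monomial y mu) ->
  forall mu, v mu = 0.
Proof.
move=> I1; elim: e P y => [|e IH] P y Pe P_ PS Py colon v.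
  move=> [w Iw Pw] []; apply/eqP; apply: contrapT => /negP v0; apply: I1.
  rewrite -(rmorph1 iota) -(mulVf v0) rmorphM; apply: idealM; first exact: ipow_ideal.
  have -> : iota (v tt) = (\sum_(mu : unit) iota (v mu) * 1 - w) + w.
    by rewrite subrK (big_pred1 tt) ?mulr1 // => -[].
  by apply: idealD; [exact: ipow_ideal|exact: Pe|rewrite muln0 addn0 in Iw].
pose v2 (j : 'I_M) (mu : mon_index M e) : K := v (@pair (Finite.sort _) (Finite.sort (mon_index M e)) j mu).
pose S (j : 'I_M) := \sum_mu iota (v2 j mu) * monomial (fun i => y i.+1) mu.
have -> : \sum_mu iota (v mu) * monomial y mu = \sum_(j < M) y 0%N ^+ j * S j.
  rewrite (eq_bigr (fun mu : 'I_M * mon_index M e =>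
    iota (v2 mu.1 mu.2) * (y 0%N ^+ mu.1 * monomial (fun i => y i.+1) mu.2)));
    last by case.
  rewrite -(pair_bigA _ (fun j mu =>
    iota (v2 j mu) * (y 0%N ^+ j * monomial (fun i => y i.+1) mu))) /=.
  apply: eq_bigr => j _; rewrite mulr_sumr; apply: eq_bigr => mu _.
  by rewrite mulrCA.
move=> H [j mu]; rewrite -[v _]/(v2 j mu); have [n] := ubnP (val j); elim: n j mu => // n IHn j mu jn.
have below (i : 'I_M) : (i < j)%N -> S i = 0.
  move=> ij; rewrite /S big1 // => nu _; rewrite IHn ?rmorph0 ?mul0r //.
  by rewrite ltnS in jn; exact: leq_trans ij jn.
pose T := \sum_(i < M | (j < i)%N) y 0%N ^+ (i - j.+1) * S i.
have HT : \sum_(i < M) y 0%N ^+ i * S i = y 0%N ^+ j * (S j + y 0%N * T).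
  rewrite (bigD1 j) //= mulrDr; congr (_ + _).
  rewrite (bigID (fun i : 'I_M => (j < i)%N)) /= [X in _ + X]big1 ?addr0.
    rewrite mulrA -exprSr mulr_sumr; apply: eq_big => [i|i /andP[_ ji]].
      by rewrite -val_eqE /=; case: (ltngtP (val i) (val j)).
    by rewrite mulrA -exprD subnKC.
  move=> i /andP[ij]; rewrite -leqNgt => ij'.
  by rewrite below ?mulr0 // ltn_neqAle ij' andbT.
have strip m N x : addp (P 0%N) (N + k * m) (y 0%N ^+ m * x) -> addp (P 0%N) N x.
  elim: m N x => [|m IHm] N x; first by rewrite muln0 addn0 expr0 mul1r.
  by rewrite mulnS addnA exprSr -mulrA => /IHm; exact: colon.
(* Stripping y_0^j costs k * j, at most k * M, which leaves the exponent needed for the other e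
   variables; the remainder y_0 T lies in P_1. *)
have DSj : addp (P 1%N) (1 + k * M * e) (S j).
  have D0 : addp (P 0%N) (1 + k * M * e) (S j + y 0%N * T).
    apply: (strip j); rewrite -HT; apply: addp_le H.
    by rewrite -addnA leq_add2l mulnS addnC leq_add2r leq_mul2l (ltnW (ltn_ord j)) orbT.
  rewrite -(addrK (y 0%N * T) (S j)); apply: idealB; first exact: addp_ideal.
    by case: D0 => w Iw Pw; exists w => //; exact: PS.
  by apply: addp_mem; rewrite mulrC; apply: idealM => //; exact: Py.
by apply: (IH (fun i => P i.+1) (fun i => y i.+1) _ _ _ _ _ (v2 j)) => //;
  move=> i ie; [exact: PS|exact: Py|exact: colon].
Qed.

Lemma prime_chain_bound (e : nat) (P : nat -> set A) :
  noetherian A -> ~ ipow l 1 1 ->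
  (forall i, is_ideal (P i)) -> (forall i u v, P i (u * v) -> P i u \/ P i v) ->
  (forall i, (i < e)%N -> P i `<=` P i.+1 /\ ~ (P i.+1 `<=` P i)) ->
  P e `<=` ipow l 1 -> (e <= d)%N.
Proof.
move=> noeA I1 P_ Pprime Pchain Pe; rewrite leqNgt; apply/negP => de.
have /choice[y yP] i : exists y, (i < e)%N -> P i.+1 y /\ ~ P i y.
  have [ie|_] := ltnP i e; last by exists 0.
  apply: contrapT => H; apply: (Pchain _ ie).2 => x Px; apply: contrapT => nPx.
  by apply: H; exists x.
have /choice[kk kkP] i : exists k, (i < e)%N ->
    forall N x, addp (P i) (N + k) (y i * x) -> addp (P i) N x.
  have [ie|_] := ltnP i e; last by exists 0%N.
  have [k kP] := artin_rees_colon l noeA (P_ i) (@Pprime i) (yP i ie).2.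
  by exists k => _ N x [w]; exact: kP.
pose k := (\sum_(i < e) kk i)%N.
have colon i : (i < e)%N -> forall N x, addp (P i) (N + k) (y i * x) -> addp (P i) N x.
  move=> ie N x H; apply: (kkP _ ie); apply: addp_le H.
  by rewrite leq_add2l /k (bigD1 (Ordinal ie)) //= leq_addr.
(* N is at most (k e + 1) M, so N^d <= (k e + 1)^d M^d < M^(d+1) <= M^e: M is chosen to make the
   middle inequality strict. *)
pose M := ((k * e).+1 ^ d).+1; pose N := (1 + k * M * e)%N.
have card_lt : (#|{ffun 'I_d -> 'I_N}| < #|mon_index M e|)%N.
  rewrite card_ffun !card_ord card_mon_index.
  have NM : (N <= (k * e).+1 * M)%N by rewrite /N /M; nia.
  apply: (@leq_ltn_trans (((k * e).+1 * M) ^ d)).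
    by have [->//|d0] := posnP d; rewrite leq_exp2r.
  rewrite expnMn; apply: (@leq_trans (M * M ^ d)).
    by rewrite ltn_pmul2r ?expn_gt0.
  by rewrite -expnS; exact: leq_pexp2l.
have /choice[c cP] mu : exists c, ipow l N (monomial (M := M) (e := e) y mu - lincomb (N := N) c).
  exact: residue_pow.
(* The rows are the expansions of the monomials in y. There are more rows than columns, so a
   nontrivial K-combination of these monomials lies in the N-th power, against their
   independence. *)
pose C := \matrix_(i < #|mon_index M e|, j < #|{ffun 'I_d -> 'I_N}|) c (enum_val i) (enum_val j).
have /rowV0Pn[v /sub_kermxP vC v0] : kermx C != 0.
  rewrite kermx_eq0 /row_free neq_ltn; apply/orP; left.
  exact: leq_ltn_trans (rank_leq_col _) card_lt.
have [i vi] : exists i, v 0 i != 0.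
  apply: contrapT => H; case/negP: v0; apply/eqP/rowP => i; rewrite mxE.
  by apply/eqP; apply: contrapT => /negP vi; apply: H; exists i.
case/negP: vi; apply/eqP.
rewrite -(enum_valK i).
apply: (@monomial_independent k M e P y I1 Pe P_ _ _ colon (fun mu => v 0 (enum_rank mu))).
- by move=> j /Pchain[].
- by move=> j /yP[].
apply: addp_ipow => //.
have -> : \sum_mu iota (v 0 (enum_rank mu)) * monomial y mu =
    \sum_mu iota (v 0 (enum_rank mu)) * (monomial (M := M) y mu - lincomb (c mu)).
  apply/esym/eqP; rewrite -subr_eq0 -sumrB; apply/eqP.
  transitivity (- \sum_(mu : mon_index M e) iota (v 0 (enum_rank mu)) * lincomb (c mu)).
    by rewrite -sumrN; apply: eq_bigr => mu _; ring.
  apply/eqP; rewrite oppr_eq0; apply/eqP.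
  under eq_bigr do rewrite mulr_sumr.
  rewrite exchange_big big1 //= => nu _.
  under eq_bigr do rewrite mulrA -rmorphM.
  rewrite -mulr_suml -rmorph_sum.
  have := congr1 (fun u : 'rV_ _ => u 0 (enum_rank nu)) vC; rewrite !mxE => E.
  have -> : \sum_mu v 0 (enum_rank mu) * c mu nu = 0; last by rewrite rmorph0 mul0r.
  rewrite -[RHS]E (reindex (@enum_rank (mon_index M e))) /=; last first.
    by apply: onW_bij; exact: enum_rank_bij.
  by apply: eq_bigr => mu _; rewrite !mxE !enum_rankK.
elim/big_ind: _ => [|u w|mu _]; first exact: (ipow_ideal l N).1.
  exact: idealD (ipow_ideal l N).
exact: idealM (ipow_ideal l N) (cP mu).
Qed.

End ChainBound.

(** * Formal arcs and the Jacobian criterion *)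

(** A first order expansion without remainder: the error is hidden in the b_i, which equal the
    partial derivatives only after pi. It serves for arcs, with pi the constant coefficient, and for
    polynomials at [pt], with pi the evaluation. *)
Lemma mpoly_taylor (n : nat) (F W V : comNzRingType) (iota : {rmorphism F -> W})
    (pi : {rmorphism W -> V}) (x x' : 'I_n -> W) (g : mpoly n F) :
  (forall i, pi (x' i) = pi (x i)) ->
  exists b : 'I_n -> W,
    mmap iota x' g - mmap iota x g = \sum_i (x' i - x i) * b i /\
    forall i, pi (b i) = pi (mmap iota x (mderiv i g)).
Proof.
move=> xx'.
have pi_mmap p : pi (mmap iota x' p) = pi (mmap iota x p).
  elim/mpoly_ind_alg: p => [c|i|p q pE qE|p q pE qE].
  - by rewrite !mmapC.
  - by rewrite !mmapX !mmap1U.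
  - by rewrite !mmapD !rmorphD pE qE.
  - by rewrite !rmorphM pE qE.
elim/mpoly_ind_alg: g => [c|j|p q [b [bE pib]] [b' [b'E pib']]|p q [b [bE pib]] [b' [b'E pib']]].
- exists (fun=> 0); rewrite !mmapC subrr big1 => [|i _]; last by rewrite mulr0.
  by split=> // i; rewrite mderivC mmap0.
- exists (fun i => (j == i)%:R); rewrite !mmapX !mmap1U; split=> [|i].
    rewrite (bigD1 j) //= eqxx mulr1 big1 ?addr0 // => i.
    by rewrite eq_sym => /negbTE ->; rewrite mulr0.
  rewrite mderivX mnm1E; case: eqP => [->|_]; last by rewrite scale0r mmap0.
  have -> : mnm_sub (mnm1 i) (mnm1 i) = mnm0 by apply/mnmP => k; rewrite mnmBE subnn mnm0E.
  by rewrite scale1r mmapX mmap11.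
- exists (fun i => b i + b' i); split=> [|i].
    rewrite !mmapD opprD addrACA bE b'E -big_split /=.
    by apply: eq_bigr => i _; rewrite mulrDr.
  by rewrite mderivD mmapD !rmorphD pib pib'.
- exists (fun i => b i * mmap iota x' q + mmap iota x p * b' i); split=> [|i].
    rewrite !rmorphM /=.
    have -> : mmap iota x' p * mmap iota x' q - mmap iota x p * mmap iota x q =
        (mmap iota x' p - mmap iota x p) * mmap iota x' q +
        mmap iota x p * (mmap iota x' q - mmap iota x q) by ring.
    rewrite bE b'E mulr_suml mulr_sumr -big_split /=.
    by apply: eq_bigr => i _; ring.
  by rewrite mderivM mmapD !rmorphD !rmorphM pib pib' pi_mmap.
Qed.

Lemma mmapC_id (n : nat) (F : comNzRingType) (g : mpoly n F) :
  mmap (@mpolyC n F) (fun i => mpolyX F (mnm1 i)) g = g.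
Proof.
elim/mpoly_ind_alg: g => [c|i|p q pE qE|p q pE qE].
- exact: mmapC.
- by rewrite mmapX mmap1U.
- by rewrite mmapD pE qE.
- by rewrite rmorphM /= pE qE.
Qed.

Lemma mmapC_const (m n : nat) (F : comNzRingType) (v : 'I_n -> F) (g : mpoly n F) :
  mmap (@mpolyC m F) (fun i => mpolyC m (v i)) g = mpolyC m (meval v g).
Proof.
elim/mpoly_ind_alg: g => [c|i|p q pE qE|p q pE qE].
- by rewrite mmapC mevalC.
- by rewrite mmapX mmap1U mevalXU.
- by rewrite mmapD pE qE mevalD mpolyCD.
- by rewrite rmorphM /= pE qE mevalM mpolyCM.
Qed.

Section FormalArc.
Variables (F : fieldType) (c d : nat) (pt : 'I_(c + d) -> F).
Variables (f : 'I_c -> mpoly (c + d) F) (L : 'M[F]_(d, c + d)).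
Hypothesis f_pt : forall j, meval pt (f j) = 0.

Definition jacobian : 'M[F]_(c, c + d) := \matrix_(j, i) meval pt (mderiv i (f j)).

Hypothesis JL_unit : col_mx jacobian L \in unitmx.

Variables (K : comNzRingType) (kC : {rmorphism F -> K}) (s : 'I_d -> K).

Definition arc_embed : {rmorphism F -> {poly K}} := polyC \o kC.

(** The Newton correction in degree N + 1: the Jacobian part cancels the coefficient of each f_j
    there, and the L part prescribes s in degree 1 and nothing in higher degrees. *)
Definition arc_step (N : nat) (x : 'I_(c + d) -> {poly K}) : 'cV[K]_(c + d) :=
  map_mx (kC) (invmx (col_mx jacobian L)) *m
  col_mx (\col_j - (mmap arc_embed x (f j))`_N.+1)
         (\col_a (if N == 0%N then s a else 0)).

(* The arc through pt with L (arc - pt) = t s, where t is the variable of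
   {poly K}; the N-th iterate is the truncation modulo t^(N+1). *)
Fixpoint arc (N : nat) : 'I_(c + d) -> {poly K} :=
  if N is N'.+1 then
    fun i => arc N' i + 'X^(N'.+1) * (arc_step N' (arc N') i 0)%:P
  else fun i => (kC (pt i))%:P.

Definition arc_eval (N : nat) (g : mpoly (c + d) F) : {poly K} :=
  mmap arc_embed (arc N) g.

(** The k-th Taylor coefficient along the formal arc. Later corrections do not change it
    ([arc_eval_stable]), so the power series itself is never formed. *)
Definition arc_coef (g : mpoly (c + d) F) (k : nat) : K := (arc_eval k g)`_k.

Lemma arc_coef0 N i : (arc N i)`_0 = kC (pt i).
Proof. by elim: N => [|N IH] /=; rewrite ?coefC // coefD IH coefXnM addr0. Qed.

Lemma size_arc N i : (size (arc N i) <= N.+1)%N.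
Proof.
elim: N => [|N IH] /=; first exact: size_polyC_leq1.
rewrite (leq_trans (size_polyD _ _)) // geq_max (leq_trans IH) //=.
rewrite (leq_trans (size_polyMleq _ _)) // size_polyXn.
by have := size_polyC_leq1 (arc_step N (arc N) i 0); lia.
Qed.

Lemma arc_eval_pt N g : (arc_eval N g)`_0 = kC (meval pt g).
Proof.
rewrite /arc_eval; elim/mpoly_ind_alg: g => [a|i|p q pE qE|p q pE qE].
- by rewrite mmapC mevalC coefC.
- by rewrite mmapX mmap1U mevalXU arc_coef0.
- by rewrite mmapD coefD pE qE mevalD rmorphD.
- by rewrite rmorphM coef0M pE qE mevalM rmorphM.
Qed.

Lemma arc_evalS N g : exists b : 'I_(c + d) -> {poly K},
  arc_eval N.+1 g = arc_eval N g + 'X^(N.+1) * \sum_i (arc_step N (arc N) i 0)%:P * b i /\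
  forall i, (b i)`_0 = kC (meval pt (mderiv i g)).
Proof.
have [|b [bE b0]] := @mpoly_taylor _ _ _ _ arc_embed (coefp 0) (arc N) (arc N.+1) g.
  by move=> i; rewrite /= !arc_coef0 coefD arc_coef0 coefXnM addr0.
exists b; split=> [|i]; last by rewrite -(arc_eval_pt N); exact: b0.
apply/eqP; rewrite addrC -subr_eq; apply/eqP; rewrite [LHS]bE mulr_sumr.
by apply: eq_bigr => i _ /=; rewrite addrC addKr mulrA.
Qed.

Lemma arc_eval_low N g k : (k <= N)%N -> (arc_eval N.+1 g)`_k = (arc_eval N g)`_k.
Proof. by move=> kN; have [b [-> _]] := arc_evalS N g; rewrite coefD coefXnM ltnS kN addr0. Qed.

Lemma arc_eval_top N g : (arc_eval N.+1 g)`_N.+1 =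
  (arc_eval N g)`_N.+1 +
  \sum_i kC (meval pt (mderiv i g)) * arc_step N (arc N) i 0.
Proof.
have [b [-> b0]] := arc_evalS N g; rewrite coefD [X in _ + X]coefXnM ltnn subnn [X in _ + X]coef_sum.
by congr (_ + _); apply: eq_bigr => i _; rewrite coefCM b0 mulrC.
Qed.

Lemma arc_eval_stable N g k : (k <= N)%N -> (arc_eval N g)`_k = arc_coef g k.
Proof.
elim: N => [|N IH]; first by rewrite leqn0 => /eqP ->.
rewrite leq_eqVlt => /predU1P[-> //|kN].
by rewrite arc_eval_low // IH.
Qed.

Lemma arc_coefD g h k : arc_coef (g + h) k = arc_coef g k + arc_coef h k.
Proof. by rewrite /arc_coef /arc_eval mmapD coefD. Qed.

Lemma arc_coefM g h k :
  arc_coef (g * h) k = \sum_(j < k.+1) arc_coef g j * arc_coef h (k - j).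
Proof.
rewrite /arc_coef /arc_eval rmorphM coefM /=; apply: eq_bigr => j _.
by rewrite -!/(arc_eval _ _) !arc_eval_stable ?leq_subr // -ltnS.
Qed.

Lemma arc_stepP N : map_mx (kC) (col_mx jacobian L) *m arc_step N (arc N) =
  col_mx (\col_j - (arc_eval N (f j))`_N.+1)
         (\col_a (if N == 0%N then s a else 0)).
Proof. by rewrite /arc_step mulmxA -map_mxM mulmxV // map_mx1 mul1mx. Qed.

Lemma arc_on_zeros j k : arc_coef (f j) k = 0.
Proof.
case: k => [|k]; rewrite /arc_coef; first by rewrite arc_eval_pt f_pt rmorph0.
rewrite arc_eval_top.
have := congr1 (fun u : 'cV_ _ => u (lshift d j) 0) (arc_stepP k).
rewrite /= [RHS]col_mxEu [in LHS]mxE [RHS]mxE => E.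
apply/eqP; rewrite addrC addr_eq0 -E; apply/eqP/eq_bigr => i _.
by congr (_ * _); rewrite [RHS]mxE col_mxEu [in RHS]mxE.
Qed.

Definition arc_linear (a : 'I_d) : mpoly (c + d) F :=
  \sum_i mpolyC (c + d) (L a i) * (mpolyX F (mnm1 i) - mpolyC (c + d) (pt i)).

Lemma mderiv_linear a i : mderiv i (arc_linear a) = mpolyC (c + d) (L a i).
Proof.
rewrite /arc_linear raddf_sum (bigD1 i) //= big1 ?addr0 => [|j ji].
  rewrite mderivM mderivC mul0r add0r mderivB mderivC subr0 mderivX mnm1E eqxx.
  have -> : mnm_sub (mnm1 i) (mnm1 i) = mnm0 by apply/mnmP => k; rewrite mnmBE subnn mnm0E.
  by rewrite mpolyX0 scale1r mulr1.
rewrite mderivM mderivC mul0r add0r mderivB mderivC subr0 mderivX mnm1E.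
by rewrite (negbTE ji) scale0r mulr0.
Qed.

Lemma arc_coef_linear a k : arc_coef (arc_linear a) k = if k == 1%N then s a else 0.
Proof.
case: k => [|k]; rewrite /arc_coef.
  rewrite arc_eval_pt /arc_linear [meval _ _]raddf_sum big1 ?rmorph0 // => i _.
  by rewrite [LHS]mevalM mevalB mevalXU !mevalC subrr mulr0.
rewrite arc_eval_top nth_default ?add0r; last first.
  rewrite /arc_eval /arc_linear rmorph_sum (leq_trans (size_sum _ _ _)) //.
  apply/bigmax_leqP => i _; rewrite rmorphM rmorphB /= !mmapC mmapX mmap1U /=.
  rewrite mul_polyC (leq_trans (size_scale_leq _ _)) //.
  rewrite (leq_trans (size_polyD _ _)) // geq_max size_arc size_polyN.
  by rewrite (leq_trans (size_polyC_leq1 _)).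
have := congr1 (fun u : 'cV_ _ => u (rshift c a) 0) (arc_stepP k).
rewrite /= [RHS]col_mxEd [in LHS]mxE [RHS]mxE eqSS => <-; apply: eq_bigr => i _.
by rewrite mderiv_linear mevalC; congr (_ * _); rewrite [RHS]mxE col_mxEd.
Qed.

End FormalArc.

(** At full row rank, J is an invertible matrix times the first c rows of [row_ebase J]; the
    remaining rows complete it. *)
Lemma row_free_completion (F : fieldType) (c d : nat) (J : 'M[F]_(c, c + d)) :
  row_free J -> exists L : 'M[F]_(d, c + d), col_mx J L \in unitmx.
Proof.
move=> /eqP rJ; pose E : 'M[F]_(c + d) := row_ebase J; exists (dsubmx E).
have JE : J = col_ebase J *m usubmx E.
  rewrite -{1}(mulmx_ebase J) -mulmxA rJ; congr (_ *m _).
  rewrite -[row_ebase J]/E -{1}(vsubmxK E).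
  have -> : pid_mx c = row_mx 1%:M 0 :> 'M[F]_(c, c + d).
    apply/matrixP => i j; rewrite mxE ltn_ord andbT.
    have [k ->|k ->] := split_ordP j; rewrite ?row_mxEl ?row_mxEr !mxE //.
    by have -> : (i == rshift c k :> nat) = false by have := ltn_ord i; rewrite /=; lia.
  by rewrite mul_row_col mul1mx mul0mx addr0.
have -> : col_mx J (dsubmx E) = block_mx (col_ebase J) 0 0 1%:M *m E.
  by rewrite -{2}(vsubmxK E) mul_block_col !mul0mx mul1mx addr0 add0r -JE.
rewrite unitmx_mul row_ebase_unit andbT unitmxE det_ublock det1 mulr1 -unitmxE.
exact: col_ebase_unit.
Qed.

Section PrimeOfSet.
Variables (A : comNzRingType) (Q : set A).

(** The proofs are arguments of the predicate so that the structures declared below can recover them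
    from the term. *)
Definition pred_of_prime (Q_ : is_ideal Q) (Q1 : ~ Q 1)
  (Qprime : forall u v, Q (u * v) -> Q u \/ Q v) : A -> bool := fun x => `[< Q x >].

Variables (Q_ : is_ideal Q) (Q1 : ~ Q 1) (Qprime : forall u v, Q (u * v) -> Q u \/ Q v).
Local Notation QQ := (pred_of_prime Q_ Q1 Qprime).

Lemma pred_of_prime_idealr : idealr_closed QQ.
Proof.
split; first by apply/asboolP; exact: Q_.1.
  by apply/asboolP.
by move=> a u v /asboolP Qu /asboolP Qv; apply/asboolP; exact: Q_.2.
Qed.

Lemma pred_of_prime_prime : prime_idealr_closed QQ.
Proof.
by move=> u v /asboolP/Qprime[Qu|Qv]; apply/orP; [left|right]; apply/asboolP.
Qed.

HB.instance Definition _ := isIdealr.Build A QQ pred_of_prime_idealr.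
HB.instance Definition _ := isPrimeIdealrClosed.Build A QQ pred_of_prime_prime.

Lemma prime_idealr_of_set : exists P : prime_idealr A, forall x, (x \in (P : pred A)) <-> Q x.
Proof. by exists QQ => x; split=> [/asboolP|Qx] //; apply/asboolP. Qed.

End PrimeOfSet.

Section PrimeIdealr.
Variables (A : comNzRingType) (P : prime_idealr A).

Lemma prime_idealr_is_ideal : is_ideal [set x | x \in (P : pred A)].
Proof.
split; first exact: rpred0.
by move=> a u v uP vP; apply: rpredD => //; exact: idealMr.
Qed.

Lemma prime_idealr_prime u v : u * v \in (P : pred A) -> u \in (P : pred A) \/ v \in (P : pred A).
Proof. by rewrite prime_idealrM => /orP. Qed.

End PrimeIdealr.

Lemma mpoly_rmorph_ext (n : nat) (A W : comNzRingType) (phi psi : {rmorphism mpoly n A -> W}) :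
  (forall a, phi (mpolyC n a) = psi (mpolyC n a)) ->
  (forall i, phi (mpolyX A (mnm1 i)) = psi (mpolyX A (mnm1 i))) -> phi =1 psi.
Proof.
move=> eqC eqX; elim/mpoly_ind_alg => // p q pE qE.
  by rewrite !rmorphD pE qE.
by rewrite !rmorphM pE qE.
Qed.

Definition kill_first (d : nat) (F : comNzRingType) (i : nat) :
    {rmorphism mpoly d F -> mpoly d F} :=
  mmap (@mpolyC d F) (fun a : 'I_d => if (a < i)%N then 0 else mpolyX F (mnm1 a)).

Lemma kill_firstC (d : nat) (F : comNzRingType) (i : nat) (a : F) :
  kill_first d F i (mpolyC d a) = mpolyC d a.
Proof. exact: mmapC. Qed.

Lemma kill_firstX (d : nat) (F : comNzRingType) (i : nat) (a : 'I_d) :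
  kill_first d F i (mpolyX F (mnm1 a)) = if (a < i)%N then 0 else mpolyX F (mnm1 a).
Proof. by rewrite [LHS]mmapX mmap1U. Qed.

Lemma kill_firstS (d : nat) (F : comNzRingType) (i : nat) (u : mpoly d F) :
  kill_first d F i.+1 (kill_first d F i u) = kill_first d F i.+1 u.
Proof.
apply: (mpoly_rmorph_ext (phi := kill_first d F i.+1 \o kill_first d F i)) => [a|a] /=.
  by rewrite !kill_firstC.
rewrite [in LHS]kill_firstX; case: ifP => ai; last by [].
by rewrite [RHS]kill_firstX ltnS (ltnW ai); exact: rmorph0.
Qed.

(** * The Jacobian criterion, for any ring behaving like the local ring of a reduced zero scheme *)

Section JacobianCriterion.
Variables (F : fieldType) (c d : nat) (pt : 'I_(c + d) -> F).
Local Notation S := (mpoly (c + d) F).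
Variables (f : 'I_c -> S) (I : set S) (O : comNzRingType) (rho : {rmorphism S -> O}).
Hypothesis f_pt : forall j, meval pt (f j) = 0.
Hypothesis I_f : forall j, I (f j).
Hypothesis I_min : forall J, is_ideal J -> (forall j, J (f j)) -> I `<=` J.
Hypothesis rho_frac : forall b, exists g h, meval pt h != 0 /\ b * rho h = rho g.
Hypothesis rho_unit : forall h, meval pt h != 0 -> exists b, b * rho h = 1.
Hypothesis rho0 : forall g,
  rho g = 0 <-> exists h k, meval pt h != 0 /\ I ((h * g) ^+ k).
Hypothesis free_jac : row_free (jacobian pt f).

Let res : {rmorphism S -> F} := meval pt.

Let ker_pt_ideal : is_ideal [set g : S | meval pt g = 0].
Proof.
split=> /=; first exact: meval0.
by move=> a u v u0 v0; rewrite mevalD mevalM u0 v0 mulr0 addr0.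
Qed.

Let rho0_pt g : rho g = 0 -> meval pt g = 0.
Proof.
move=> /rho0[h [k [h0 /(I_min ker_pt_ideal f_pt)]]].
rewrite /= -[meval pt _]/(res _) rmorphXn => /eqP; rewrite expf_eq0 => /andP[_].
by rewrite rmorphM mulf_eq0 [_ == 0](negbTE h0) => /eqP.
Qed.

Let max : set O := [set b | exists g h, [/\ meval pt h != 0, b * rho h = rho g & meval pt g = 0]].

(** Membership in [max] does not depend on the fraction, because an element of the kernel of rho
    vanishes at [pt]. *)
Let max_repr b g h : max b -> b * rho h = rho g -> meval pt g = 0.
Proof.
move=> [g' [h' [h'0 E' g'0]]] E.
have : rho (g * h' - g' * h) = 0.
  by rewrite rmorphB !rmorphM -E -E' mulrAC subrr.
move=> /rho0_pt/eqP; rewrite mevalB !mevalM g'0 mul0r subr0 mulf_eq0.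
by rewrite (negbTE h'0) orbF => /eqP.
Qed.

Let max_rho g : meval pt g = 0 -> max (rho g).
Proof. by exists g, 1; rewrite meval1 oner_eq0 rmorph1 mulr1. Qed.

Let max_ideal : is_ideal max.
Proof.
split; first by rewrite -(rmorph0 rho); apply: max_rho; rewrite meval0.
move=> a u v [g [h [h0 E g0]]] [g' [h' [h'0 E' g'0]]].
have [p [q [q0 Ea]]] := rho_frac a.
exists (p * g * h' + g' * q * h), (q * h * h'); split.
- by rewrite !mevalM !mulf_neq0.
- by rewrite !(rmorphD, rmorphM) -E -E' -Ea; ring.
- by rewrite mevalD !mevalM g0 g'0 !(mulr0, mul0r) addr0.
Qed.

Let max1 : ~ max 1.
Proof.
move=> m1; have /eqP := max_repr (g := 1) (h := 1) m1 (mul1r _).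
by rewrite meval1 oner_eq0.
Qed.

Let max_top J : is_ideal J -> ~ J 1 -> J `<=` max.
Proof.
move=> J_ J1 b Jb; have [g [h [h0 E]]] := rho_frac b.
have [g0|g0] := eqVneq (meval pt g) 0; first by exists g, h.
case: J1; have [u u1] := rho_unit g0.
by rewrite -u1 -E mulrCA mulrC; exact: idealM.
Qed.

Let max_residue b : exists a, max (b - rho (mpolyC (c + d) a)).
Proof.
have [g [h [h0 E]]] := rho_frac b; exists (meval pt g / meval pt h).
set a := _ / _; exists (g - mpolyC (c + d) a * h), h; split=> //.
  by rewrite mulrBl E rmorphB [rho (_ * h)]rmorphM.
by rewrite mevalB mevalM mevalC /a divfK // subrr.
Qed.

Let noetherianO : noetherian O.
Proof.
apply/noetherianP => J J_.
have J'_ : is_ideal [set g | J (rho g)].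
  case: J_ => J0 JD; split=> [|a u v Ju Jv] /=; first by rewrite rmorph0.
  by rewrite rmorphD rmorphM; exact: JD.
have [s [sJ Js]] :=
  (noetherianP _).1 (noetherian_mpoly (n := c + d) (noetherian_field (K := F))) _ J'_.
exists (map rho s); split=> [_ /mapP[g /sJ Jg ->] //|b Jb].
have [g [h [h0 E]]] := rho_frac b; have [u u1] := rho_unit h0.
have [a gE] : span s g by apply: Js; rewrite /= -E mulrC; exact: idealM.
have -> : b = u * rho g by rewrite -E mulrCA u1 mulr1.
apply: idealM; first exact: span_ideal.
exists (rho \o a); rewrite gE rmorph_sum size_map; apply: eq_bigr => i _.
by rewrite rmorphM (nth_map 0).
Qed.

Let ipow1_min e (l : 'I_e -> O) J : is_ideal J -> (forall i, J (l i)) -> ipow l 1 `<=` J.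
Proof. by move=> J_ Jl _ [z [_ ->]]; exact: ideal_sum. Qed.

Section SystemOfParameters.
Variable L : 'M[F]_(d, c + d).
Hypothesis JL_unit : col_mx (jacobian pt f) L \in unitmx.

Variables (K : idomainType) (kC : {rmorphism F -> K}) (s : 'I_d -> K).
Variable sp : nat -> {rmorphism K -> K}.
Hypothesis sp_kC : forall i a, sp i (kC a) = kC a.
Hypothesis sp_s : forall i a, sp i (s a) = if (a < i)%N then 0 else s a.
Hypothesis sp_le : forall i u, sp i.+1 (sp i u) = sp i.+1 u.
Hypothesis s_neq0 : forall a, s a != 0.

Let l (a : 'I_d) : O := rho (arc_linear pt L a).
Let xi i : S := mpolyX F (mnm1 i) - mpolyC (c + d) (pt i).

Let taylor g : exists b : 'I_(c + d) -> S,
  g - mpolyC (c + d) (meval pt g) = \sum_i xi i * b i /\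
  forall i, meval pt (b i) = meval pt (mderiv i g).
Proof.
have [|b [bE b0]] := @mpoly_taylor _ F S F (@mpolyC (c + d) F) res
    (fun i => mpolyC (c + d) (pt i)) (fun i => mpolyX F (mnm1 i)) g.
  by move=> i; rewrite /= mevalXU mevalC.
exists b; split=> [|i]; first by rewrite -bE mmapC_id mmapC_const.
by rewrite [LHS]b0 mmapC_const [LHS]mevalC.
Qed.

Let params_vanish a : meval pt (arc_linear pt L a) = 0.
Proof.
rewrite /arc_linear [meval _ _]raddf_sum big1 // => i _.
by rewrite [LHS]mevalM mevalB mevalXU !mevalC subrr mulr0.
Qed.

(** Nakayama's lemma by Cramer's rule: the f_j and the linear parameters are a matrix M times the
    coordinates xi, and det M is a unit because its value at [pt] is the determinant of the Jacobian
    completed by L. Since rho kills the f_j, the xi lie in the ideal of the parameters. *)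
Let ipow_max : ipow l 1 = max.
Proof.
rewrite eqEsubset; split.
  apply: ipow1_min max_ideal _ => a; exact/max_rho/params_vanish.
have /choice[B BP] j : exists b : 'I_(c + d) -> S,
    f j = \sum_i xi i * b i /\ forall i, meval pt (b i) = meval pt (mderiv i (f j)).
  by have [b [bE b0]] := taylor (f j); exists b; rewrite -bE f_pt mpolyC0 subr0.
pose M : 'M[S]_(c + d) := col_mx (\matrix_(j, i) B j i) (map_mx (@mpolyC (c + d) F) L).
have detM : meval pt (\det M) != 0.
  rewrite -[meval pt _]/(res _) -det_map_mx -unitfE -unitmxE.
  suff -> : map_mx res M = col_mx (jacobian pt f) L by [].
  rewrite map_col_mx; congr col_mx; apply/matrixP => j i; rewrite !mxE.
    exact: (BP j).2.
  exact: mevalC.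
pose v : 'cV[S]_(c + d) := \col_i xi i.
have Mv : M *m v = col_mx (\col_j f j) (\col_a arc_linear pt L a).
  rewrite mul_col_mx; congr col_mx; apply/matrixP => j i; rewrite !mxE.
    by rewrite (BP j).1; apply: eq_bigr => k _; rewrite !mxE mulrC.
  by apply: eq_bigr => k _; rewrite !mxE.
have xi_in i : ipow l 1 (rho (xi i)).
  have [u u1] := rho_unit detM.
  have E : \det M * xi i = \sum_j \adj M i j * (M *m v) j 0.
    have := congr1 (fun w : 'cV_ _ => w i 0) (mulmxA (\adj M) M v).
    by rewrite mul_adj_mx mul_scalar_mx /= mxE => ->; rewrite !mxE.
  have -> : rho (xi i) = \sum_j (u * rho (\adj M i j)) * rho ((M *m v) j 0).
    rewrite -[LHS]mul1r -u1 -mulrA -rmorphM E rmorph_sum mulr_sumr.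
    by apply: eq_bigr => j _; rewrite rmorphM mulrA.
  apply: ideal_sum (ipow_ideal l 1) _ => j; rewrite Mv.
  have [k ->|k ->] := split_ordP j; rewrite ?col_mxEu ?col_mxEd mxE.
    have -> : rho (f k) = 0; last exact: (ipow_ideal l 1).1.
    by apply/rho0; exists 1, 1%N; rewrite meval1 oner_eq0 mul1r expr1.
  exact: ipow_gen.
move=> b [g [h [h0 E g0]]]; have [u u1] := rho_unit h0.
have -> : b = u * rho g by rewrite -E mulrCA u1 mulr1.
apply: idealM (ipow_ideal l 1) _.
have [a [gE _]] := taylor g; rewrite g0 mpolyC0 subr0 in gE.
rewrite gE rmorph_sum; under eq_bigr do rewrite rmorphM mulrC.
exact: ideal_sum (ipow_ideal l 1) xi_in.
Qed.

Lemma ipow1_generated e (g : 'I_e -> O) : generated_by (ipow g 1) e.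
Proof.
apply/generated_byP; split; first exact: ipow_ideal.
by exists g; split=> [i|x [z [_ ->]]]; [exact: ipow_gen|exists z].
Qed.

Let coef g k : K :=
  arc_coef pt f L kC s g k.

Definition arc_prime (i : nat) : set S := [set g | forall k, sp i (coef g k) = 0].

Let arc_prime_ideal i : is_ideal (arc_prime i).
Proof.
split=> [k|a u v u0 v0 k].
  by rewrite /coef /arc_coef /arc_eval mmap0 coef0 rmorph0.
rewrite /coef arc_coefD arc_coefM rmorphD v0 addr0 rmorph_sum big1 // => j _.
by rewrite rmorphM u0 mulr0.
Qed.

(** As for power series over a domain, the first nonzero coefficients of two factors multiply to a
    nonzero coefficient of the product. *)
Let arc_prime_prime i u v : arc_prime i (u * v) -> arc_prime i u \/ arc_prime i v.
Proof.
have first g : ~ arc_prime i g -> exists k, sp i (coef g k) != 0 /\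
    forall j, (j < k)%N -> sp i (coef g j) = 0.
  move=> Pg; have ex : exists k, sp i (coef g k) != 0.
    apply: contrapT => H; apply: Pg => k; apply/eqP; apply: contrapT => /negP gk.
    by apply: H; exists k.
  case: (ex_minnP ex) => k gk kmin; exists k; split=> // j jk.
  by apply/eqP; apply: contraTT jk => /kmin; rewrite -leqNgt.
move=> uv; apply: contrapT => /not_orP[/first[j [uj ju]] /first[k [vk kv]]].
have := uv (j + k)%N; rewrite /coef arc_coefM rmorph_sum.
have jlt : (j < (j + k).+1)%N by rewrite ltnS leq_addr.
rewrite (bigD1 (Ordinal jlt)) //= big1 ?addr0 => [|a].
  rewrite -!/(coef _ _) rmorphM addKn => /eqP; rewrite mulf_eq0.
  by rewrite [_ == 0](negbTE uj) [_ == 0](negbTE vk).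
rewrite -val_eqE /= rmorphM -!/(coef _ _) neq_ltn => /orP[aj|ja].
  by rewrite ju // mul0r.
by rewrite [X in _ * X]kv ?mulr0 //; have := ltn_ord a; lia.
Qed.

Let arc_prime_sub i : I `<=` arc_prime i.
Proof.
apply: I_min; first exact: arc_prime_ideal.
by move=> j k; rewrite /coef arc_on_zeros ?rmorph0.
Qed.

Let arc_prime_pt i g : arc_prime i g -> meval pt g = 0.
Proof.
move=> /(_ 0%N); rewrite /coef /arc_coef arc_eval_pt sp_kC => /eqP.
by rewrite fmorph_eq0 => /eqP.
Qed.

Let arc_prime_le i : arc_prime i `<=` arc_prime i.+1.
Proof. by move=> g gi k; rewrite -sp_le gi rmorph0. Qed.

(** The linear parameter of index i separates the two kernels: its Taylor series along the arc is
    s_i t. *)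
Let arc_prime_lt i : (i < d)%N -> ~ (arc_prime i.+1 `<=` arc_prime i).
Proof.
move=> id /(_ (arc_linear pt L (Ordinal id))) H.
have lin k : coef (arc_linear pt L (Ordinal id)) k =
    if k == 1%N then s (Ordinal id) else 0.
  exact: arc_coef_linear.
have := H _ 1%N; rewrite lin /= sp_s ltnn => X0.
case/eqP: (s_neq0 (Ordinal id)); apply: X0 => k; rewrite lin.
by case: eqP => _; rewrite ?rmorph0 // sp_s /= ltnSn.
Qed.

Definition arc_local_prime (i : nat) : set O :=
  [set b | exists g h, [/\ meval pt h != 0, b * rho h = rho g & arc_prime i g]].

(** Some (h g)^k lies in I, hence in this prime, and h does not, since h is nonzero at [pt]. *)
Let arc_prime_rho i g : rho g = 0 -> arc_prime i g.
Proof.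
move=> /rho0[h [k [h0 /(@arc_prime_sub i _)]]].
have Nh : ~ arc_prime i h by move=> /arc_prime_pt/eqP; rewrite (negbTE h0).
elim: k => [/arc_prime_pt/eqP|k IH]; first by rewrite expr0 meval1 oner_eq0.
by rewrite exprS => /arc_prime_prime[/arc_prime_prime[]//|/IH].
Qed.

Let arc_local_prime_repr i b g h : arc_local_prime i b -> meval pt h != 0 ->
  b * rho h = rho g -> arc_prime i g.
Proof.
move=> [g' [h' [h'0 E' Pg']]] h0 E.
have /(arc_prime_rho i) P0 : rho (g * h' - g' * h) = 0.
  by rewrite rmorphB !rmorphM -E -E' mulrAC subrr.
have /arc_prime_prime[//|/arc_prime_pt/eqP] : arc_prime i (g * h').
  rewrite -[g * h'](subrK (g' * h)); apply: (idealD (arc_prime_ideal i)) => //.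
  by rewrite mulrC; exact: idealM (arc_prime_ideal i) Pg'.
by rewrite (negbTE h'0).
Qed.

Let arc_local_prime_ideal i : is_ideal (arc_local_prime i).
Proof.
split.
  exists 0, 1; rewrite meval1 oner_eq0 mul0r rmorph0; split=> //.
  exact: (arc_prime_ideal i).1.
move=> a u v [g [h [h0 E Pg]]] [g' [h' [h'0 E' Pg']]].
have [p [q [q0 Ea]]] := rho_frac a.
exists (p * h' * g + q * h * g'), (q * h * h'); split.
- by rewrite !mevalM !mulf_neq0.
- by rewrite !(rmorphD, rmorphM) -E -E' -Ea; ring.
- by apply: (idealD (arc_prime_ideal i)); exact: idealM (arc_prime_ideal i) _.
Qed.

Let arc_local_prime_max i : arc_local_prime i `<=` max.
Proof. by move=> b [g [h [h0 E /arc_prime_pt g0]]]; exists g, h. Qed.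

Let arc_local_prime_prime i u v :
  arc_local_prime i (u * v) -> arc_local_prime i u \/ arc_local_prime i v.
Proof.
have [g [h [h0 E]]] := rho_frac u; have [g' [h' [h'0 E']]] := rho_frac v.
move=> uv; have /arc_prime_prime[Pg|Pg'] : arc_prime i (g * g').
  apply: (arc_local_prime_repr (h := h * h') uv); first by rewrite mevalM mulf_neq0.
  by rewrite !rmorphM -E -E'; ring.
- by left; exists g, h.
- by right; exists g', h'.
Qed.

Let arc_local_prime_le i : arc_local_prime i `<=` arc_local_prime i.+1.
Proof. by move=> b [g [h [h0 E Pg]]]; exists g, h; split=> //; exact: arc_prime_le. Qed.

Let arc_local_prime_lt i : (i < d)%N -> ~ (arc_local_prime i.+1 `<=` arc_local_prime i).
Proof.
move=> id H; apply: (arc_prime_lt id) => g Pg.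
apply: (arc_local_prime_repr (b := rho g) (h := 1)).
- by apply: H; exists g, 1; rewrite meval1 oner_eq0 rmorph1 mulr1.
- by rewrite meval1 oner_eq0.
- by rewrite rmorph1 mulr1.
Qed.

(** Applied below to all chains with the d parameters, and to the chain of arc kernels with all
    generating families. *)
Let bound e (g : 'I_e -> O) m (P : nat -> set O) : ipow g 1 = max ->
  (forall i, is_ideal (P i)) -> (forall i u v, P i (u * v) -> P i u \/ P i v) ->
  (forall i, (i < m)%N -> P i `<=` P i.+1 /\ ~ (P i.+1 `<=` P i)) ->
  P m `<=` max -> (m <= e)%N.
Proof.
move=> gmax P_ Pprime Pchain Pmax.
apply: (@prime_chain_bound O F (rho \o @mpolyC (c + d) F) e g _ m P) => //.
- by rewrite gmax; exact: max_residue.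
- by rewrite gmax; exact: max1.
- by rewrite gmax.
Qed.

Lemma jacobian_criterion_params : regular_local_ring O.
Proof.
split; first exact: noetherianO.
exists max; split.
- split; [exact: max_ideal|exact: max1|].
  move=> J J_ maxJ J1; rewrite eqEsubset; split=> //; exact: max_top.
- move=> J [J_ J1 Jmax]; apply/esym/Jmax; [exact: max_ideal|exact: max_top|exact: max1].
- exists d; split; split.
  + have /choice[P PE] i : exists P : prime_idealr O,
        forall x, (x \in (P : pred O)) <-> arc_local_prime i x.
      apply: prime_idealr_of_set; [exact: arc_local_prime_ideal| |exact: arc_local_prime_prime].
      by move=> /arc_local_prime_max/max1.
    exists P => i id; split=> [x /PE/arc_local_prime_le/PE //|H].
    by apply: (arc_local_prime_lt id) => x /PE/H/PE.
  + move=> e [P Pchain].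
    apply: (bound (g := l) (P := fun i => [set x | x \in (P i : pred O)])) => //.
    * by move=> i; exact: prime_idealr_is_ideal.
    * by move=> i u v; exact: prime_idealr_prime.
    * apply: max_top; first exact: prime_idealr_is_ideal.
      by rewrite /= idealr1.
  + by rewrite -ipow_max; exact: ipow1_generated.
  + move=> e /generated_byP[_ [g [gmax maxg]]].
    apply: (bound (g := g) (P := arc_local_prime)) => //; try by [].
    * rewrite eqEsubset; split; first exact: ipow1_min.
      by move=> x /maxg[z ->]; exists z.
    * by move=> i id; split; [exact: arc_local_prime_le|exact: arc_local_prime_lt].
Qed.

End SystemOfParameters.

Theorem jacobian_criterion : regular_local_ring O.
Proof.
have [L JL_unit] := row_free_completion free_jac.
apply: (@jacobian_criterion_params L JL_unit (mpoly d F) (@mpolyC d F)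
  (fun a => mpolyX F (mnm1 a)) (kill_first d F)).
- exact: kill_firstC.
- exact: kill_firstX.
- exact: kill_firstS.
- by move=> a; rewrite -msupp_eq0 msuppX.
Qed.

End JacobianCriterion.

(** * The local ring of a real zero *)

Section LocalizationMap.
Variables (A : comNzRingType) (P : prime_idealr A).

Definition loc_map (a : A) : localization P := \pi_(localization P) (mkfrac a (compl_prime1 P)).

Lemma loc_map_zmod : zmod_morphism loc_map.
Proof.
move=> a b; rewrite /loc_map -[RHS]/(loc_add _ (loc_opp _)) !piE.
apply/eqP/localization_eqP; exists 1; first exact: compl_prime1.
by rewrite /Defs.oppf /Defs.addf /mkfrac /numer /denom /=; ring.
Qed.

Lemma loc_map_monoid : monoid_morphism loc_map.
Proof.
split; first by rewrite /loc_map -[RHS]/(loc1 P) !piE.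
move=> a b; rewrite /loc_map -[RHS]/(loc_mul _ _) !piE.
apply/eqP/localization_eqP; exists 1; first exact: compl_prime1.
by rewrite /Defs.mulf /mkfrac /numer /denom /=; ring.
Qed.

HB.instance Definition _ := GRing.isZmodMorphism.Build A (localization P) loc_map loc_map_zmod.
HB.instance Definition _ := GRing.isMonoidMorphism.Build A (localization P) loc_map loc_map_monoid.

Lemma loc_map_frac (b : localization P) :
  exists a s, s \notin (P : pred A) /\ b * loc_map s = loc_map a.
Proof.
rewrite -[b]reprK; case: (repr b) => -[a s] sP; exists a, s; split=> //.
rewrite /loc_map -[LHS]/(loc_mul _ _) !piE.
apply/eqP/localization_eqP; exists 1; first exact: compl_prime1.
by rewrite /Defs.mulf /mkfrac /numer /denom /=; ring.
Qed.

Lemma loc_map_unit s : s \notin (P : pred A) -> exists b, b * loc_map s = 1.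
Proof.
move=> sP; exists (\pi_(localization P) (mkfrac 1 sP)).
rewrite /loc_map -[LHS]/(loc_mul _ _) -[RHS]/(loc1 P) !piE.
apply/eqP/localization_eqP; exists 1; first exact: compl_prime1.
by rewrite /Defs.mulf /mkfrac /numer /denom /=; ring.
Qed.

Lemma loc_map_eq0 a : loc_map a = 0 <-> exists2 u, u \notin (P : pred A) & u * a = 0.
Proof.
rewrite /loc_map -[X in _ = X]/(loc0 P) !piE; split.
  move=> /eqP/localization_eqP[u uP]; rewrite /numer /denom /= !mulr1 subr0.
  by exists u.
move=> [u uP ua]; apply/eqP/localization_eqP; exists u => //.
by rewrite /numer /denom /= !mulr1 subr0.
Qed.

End LocalizationMap.

Section LocalRingAt.
Variables (R : realType) (n : nat) (I : set (mpoly n R)) (p : 'rV[R]_n) (Ip : zero_set I p).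
Let I0 : zero_set I !=set0 := ex_intro _ p Ip.

Let to_red (f : mpoly n R[i]) : reduced_coordinate_ring I0 := to_reduced I0 f.

Definition to_local (f : mpoly n R[i]) : local_ring_at Ip := loc_map _ (to_red f).

Lemma to_local_zmod : zmod_morphism to_local.
Proof. by move=> f g; rewrite /to_local /to_red /to_reduced !rmorphB. Qed.

Lemma to_local_monoid : monoid_morphism to_local.
Proof.
split; first by rewrite /to_local /to_red /to_reduced !rmorph1.
by move=> f g; rewrite /to_local /to_red /to_reduced !rmorphM.
Qed.

HB.instance Definition _ := GRing.isZmodMorphism.Build _ (local_ring_at Ip) to_local to_local_zmod.
HB.instance Definition _ := GRing.isMonoidMorphism.Build _ (local_ring_at Ip) to_local to_local_monoid.

Lemma notin_point_ideal f :
  (to_red f \notin (point_ideal (I0 := I0) Ip : pred _)) = (meval (complex_point p) f != 0).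
Proof.
congr negb; apply/asboolP/eqP => [[g g0 /(to_reducedP Ip) <-] //|f0].
by exists f.
Qed.

Lemma to_local_frac b : exists g h,
  meval (complex_point p) h != 0 /\ b * to_local h = to_local g.
Proof.
have [a [s [sP E]]] := loc_map_frac b.
have [g gE] := to_reduced_surj a; have [h hE] := to_reduced_surj s.
exists g, h; split; last by rewrite /to_local /to_red gE hE.
by rewrite -notin_point_ideal /to_red hE.
Qed.

Lemma to_local_unit h : meval (complex_point p) h != 0 -> exists b, b * to_local h = 1.
Proof. by rewrite -notin_point_ideal; exact: loc_map_unit. Qed.

Lemma to_reduced_eq0 f : to_red f = 0 <-> exists k, complex_ideal I (f ^+ k).
Proof.
rewrite /to_red /to_reduced; split=> [/eqP|[k fk]].
  rewrite -(rmorph0 \pi) -Quotient.idealrBE subr0 => /asboolP[k].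
  rewrite -rmorphXn => /eqP; rewrite -(rmorph0 \pi) -Quotient.idealrBE subr0.
  by move=> /asboolP; exists k.
apply/eqP; rewrite -(rmorph0 \pi) -Quotient.idealrBE subr0; apply/asboolP; exists k.
rewrite -rmorphXn; apply/eqP; rewrite -(rmorph0 \pi) -Quotient.idealrBE subr0.
exact/asboolP.
Qed.

Lemma to_local_eq0 g : to_local g = 0 <->
  exists h k, meval (complex_point p) h != 0 /\ complex_ideal I ((h * g) ^+ k).
Proof.
split=> [/loc_map_eq0[u uP]|[h [k [h0 hg]]]].
  have [h hE] := to_reduced_surj u; move: uP; rewrite -hE notin_point_ideal => h0 E.
  have [|k hg] := (to_reduced_eq0 (h * g)).1; last by exists h, k.
  by rewrite -[RHS]E /to_red /to_reduced !rmorphM.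
apply/loc_map_eq0; exists (to_red h); first by rewrite notin_point_ideal.
transitivity (to_red (h * g)); first by rewrite /to_red /to_reduced !rmorphM.
by apply/to_reduced_eq0; exists k.
Qed.

End LocalRingAt.

Lemma mderiv_map_mpoly (n : nat) (A B : comNzRingType) (phi : {rmorphism A -> B}) i
    (g : mpoly n A) : mderiv i (map_mpoly phi g) = map_mpoly phi (mderiv i g).
Proof.
elim/mpoly_ind_alg: g => [a|k|u v uE vE|u v uE vE].
- by rewrite map_mpolyC !mderivC rmorph0.
- by rewrite map_mpolyX !mderivX mnm1E map_mpolyZ rmorph_nat map_mpolyX.
- by rewrite rmorphD !mderivD rmorphD uE vE.
- by rewrite rmorphM !mderivM rmorphD !rmorphM uE vE.
Qed.

Theorem regular_of_free_jacobian (R : realType) (c d : nat) (I : set (mpoly (c + d) R))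
    (f : 'I_c -> mpoly (c + d) R) (p : 'rV[R]_(c + d)) (Ip : zero_set I p) :
  (forall j, I (f j)) -> (forall J, is_ideal J -> (forall j, J (f j)) -> I `<=` J) ->
  row_free (jacobian (p 0) f) -> regular_local_ring (local_ring_at Ip).
Proof.
move=> If Imin free.
pose fC j : mpoly (c + d) R[i] := map_mpoly (real_complex R) (f j).
have fC_pt j : meval (complex_point p) (fC j) = 0.
  by rewrite meval_map_complex (Ip (f j)) ?rmorph0.
apply: (@jacobian_criterion R[i] c d (complex_point p) fC (complex_ideal I) _
  (to_local Ip)) => //.
- move=> j; exists 1%N, (fun=> 1), (fun=> fC j); split=> [_|]; first by exists (f j).
  by rewrite big_ord1 mul1r.
- move=> J J_ JfC _ [k [a [s [sI ->]]]]; apply: ideal_sum => // i.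
  pose J' : set (mpoly (c + d) R) := [set g | J (map_mpoly (real_complex R) g)].
  have J'_ : is_ideal J'.
    split=> [|u v w Jv Jw]; rewrite /J' /mkset; first by rewrite raddf0; exact: J_.1.
    have -> : map_mpoly (real_complex R) (u * v + w) = map_mpoly (real_complex R) u *
      map_mpoly (real_complex R) v + map_mpoly (real_complex R) w by rewrite rmorphD rmorphM.
    exact (J_.2 _ _ _ Jv Jw).
  have [g Ig <-] := sI i; exact: Imin J'_ JfC g Ig.
- exact: to_local_frac.
- exact: to_local_unit.
- exact: to_local_eq0.
- suff -> : jacobian (complex_point p) fC = map_mx (real_complex R) (jacobian (p 0) f).
    by rewrite row_free_map.
  apply/matrixP => j i; rewrite !mxE -meval_map_complex; congr meval.
  exact: mderiv_map_mpoly.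
Qed.

(** * Analytic submanifolds *)

Section UnconditionalSums.
Variables (R : realType) (I : choiceType).

Lemma cvg_totally (g : I -> R) (S e : R) : partial_sum g @ totally --> S -> 0 < e ->
  exists J : {fset I}, forall K : {fset I}, (J `<=` K)%fset -> `|\sum_(i <- K) g i - S| < e.
Proof.
move=> /(@cvgrPdist_lt _ _ _ totally (@totally_filter I)) H e0.
have [J _ JK] := H _ e0.
exists J => K /JK /=; rewrite distrC /partial_sum.
by rewrite -(@big_seq_fsetE _ _ _ _ K xpredT g).
Qed.

(** All sums over finite sets containing J are within 1 of S. Enlarging J by the nonnegative terms
    of K, respectively by the negative ones, gives two such sums; their difference is below 2 and
    contains the absolute values of all terms outside J. *)
Lemma cvg_totally_bounded (g : I -> R) (S : R) : partial_sum g @ totally --> S ->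
  exists M, forall K : {fset I}, \sum_(i <- K) `|g i| <= M.
Proof.
move=> gS; have [J JP] := cvg_totally gS ltr01.
exists (2 + 2 * \sum_(i <- J) `|g i|) => K.
pose U := (J `|` K)%fset; pose Up := [fset i in U | (i \in J) || (0 <= g i)]%fset.
pose Un := [fset i in U | (i \in J) || (g i < 0)]%fset.
have JUp : (J `<=` Up)%fset by apply/fsubsetP => i iJ; rewrite !inE /= iJ.
have JUn : (J `<=` Un)%fset by apply/fsubsetP => i iJ; rewrite !inE /= iJ.
have := JP _ JUp; have := JP _ JUn; rewrite !big_fset /= => Hn Hp.
have KU : \sum_(i <- K) `|g i| <= \sum_(i <- U) `|g i|.
  have -> : \sum_(i <- K) `|g i| = \sum_(i <- U | i \in K) `|g i|.
    by rewrite [RHS]big_fset_condE; apply: eq_fbigl => i; rewrite !inE; case: (i \in K); rewrite ?orbT ?andbF.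
  rewrite [leRHS](bigID (fun i => i \in K)) /= lerDl.
  by apply: sumr_ge0.
have JU : \sum_(i <- J) `|g i| = \sum_(i <- U | i \in J) `|g i|.
  by rewrite [RHS]big_fset_condE; apply: eq_fbigl => i; rewrite !inE; case: (i \in J); rewrite ?andbF.
have : \sum_(i <- U) `|g i| <= \sum_(i <- U | (i \in J) || (0 <= g i)) g i
   - \sum_(i <- U | (i \in J) || (g i < 0)) g i + 2 * \sum_(i <- U | i \in J) `|g i|.
  rewrite !(big_mkcond (fun i => _ || _)) (big_mkcond (fun i => i \in J)) /=.
  rewrite mulr_sumr -sumrB -big_split /=; apply: ler_sum => i _.
  case: (i \in J) => /=; first by have := normr_ge0 (g i); lra.
  by case: (leP 0 (g i)) => gi; [rewrite ger0_norm //; lra|rewrite ltr0_norm //; lra].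
rewrite -JU; move: Hn Hp; rewrite !ltr_norml => /andP[? ?] /andP[? ?] ?; lra.
Qed.

End UnconditionalSums.

Section AnalyticExpansion.
Variables (R : realType) (n : nat).
Implicit Types (x a : 'rV[R]_n) (m : {ffun 'I_n -> nat}).

Let deg m := (\sum_i m i)%N.

Let affine_part : exists low : {fset {ffun 'I_n -> nat}},
  (forall m, (deg m < 2)%N -> m \in low) /\
  forall (c : R) a m, m \in low -> exists (b : R) (l : 'I_n -> R), forall x,
    c * \prod_i (x 0 i - a 0 i) ^+ m i = b + \sum_i l i * (x 0 i - a 0 i).
Proof.
pose unit_exp i : {ffun 'I_n -> nat} := [ffun j => nat_of_bool (j == i)].
exists ([fset [ffun=> 0%N]] `|` [fset unit_exp i | i in 'I_n])%fset; split=> [m m2|c a m].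
  rewrite !inE; have [[i mi]|H] := pselect (exists i, m i != 0%N).
    apply/orP; right; apply/imfsetP; exists i => //; apply/ffunP => j; rewrite ffunE.
    move: m2; rewrite /deg (bigD1 i) //=; have [->|ji] := eqVneq j i; first by lia.
    by rewrite (bigD1 j) //=; lia.
  apply/orP; left; apply/eqP/ffunP => j; rewrite ffunE; apply/eqP.
  by apply: contrapT => /negP mj; apply: H; exists j.
rewrite !inE => /orP[/eqP ->|/imfsetP[i _ ->]].
  exists c, (fun=> 0) => x; rewrite !big1 ?mulr1 ?addr0 // => i _.
    by rewrite mul0r.
  by rewrite ffunE.
exists 0, (fun j => if j == i then c else 0) => x; rewrite add0r.
rewrite [in LHS](bigD1 i) //= [in RHS](bigD1 i) //= ffunE !eqxx.
rewrite !big1 ?addr0 ?mulr1 // => j /negbTE ji.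
  by rewrite ji mul0r.
by rewrite ffunE ji.
Qed.

(** Absolute convergence at the corner a + (r, ..., r) bounds the sum of |c_m| r^deg(m) by some M.
    At distance e <= r, the terms of degree at least 2 shrink by a factor of at most (e / r)^2,
    whence the constant M / r^2. *)
Lemma analytic_expansion (f : 'rV[R]_n -> R) a : analytic_at f a ->
  exists (l : 'I_n -> R) (C r : R), [/\ 0 <= C, 0 < r & forall x e,
    0 <= e -> (forall i, `|x 0 i - a 0 i| <= e) -> e <= r ->
    `|f x - f a - \sum_i l i * (x 0 i - a 0 i)| <= C * e ^+ 2].
Proof.
move=> [c /nbhs_ballP[r0 /= r0_gt0 cvg_f]].
have [low [lowP monomial_affine]] := affine_part.
pose r := r0 / 2; have r_gt0 : 0 < r by rewrite divr_gt0.
have cvg_r x : (forall i, `|x 0 i - a 0 i| <= r) ->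
    partial_sum (fun m => c m * \prod_(i < n) (x 0 i - a 0 i) ^+ m i) @ totally --> f x.
  move=> xr; apply: cvg_f; split=> // i j; rewrite (ord1 i) -ball_normE /= distrC.
  by apply: le_lt_trans (xr j) _; rewrite ltr_pdivrMr // ltr_pMr // ltr1n.
have [M MP] : exists M, forall K : {fset _}, \sum_(m <- K) `|c m| * r ^+ deg m <= M.
  pose x0 : 'rV[R]_n := \row_i (a 0 i + r).
  have x0E i : x0 0 i - a 0 i = r by rewrite mxE addrAC subrr add0r.
  have [|M MP] := cvg_totally_bounded (cvg_r x0 _).
    by move=> i; rewrite x0E ger0_norm // ltW.
  exists M => K; apply: le_trans (MP K); apply: ler_sum => m _.
  rewrite normrM ler_wpM2l // /deg expr_sum ger0_norm; last first.
    by apply: prodr_ge0 => i _; rewrite x0E exprn_ge0 // ltW.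
  by apply: ler_prod => i _; rewrite x0E lexx exprn_ge0 // ltW.
have M_ge0 : 0 <= M by apply: le_trans (MP fset0); rewrite big_seq_fset0.
have [b [l lowE]] : exists (b : R) (l : 'I_n -> R), forall x,
    \sum_(m <- low) c m * \prod_i (x 0 i - a 0 i) ^+ m i = b + \sum_i l i * (x 0 i - a 0 i).
  have : forall m, m \in (low : seq _) -> m \in low by [].
  elim: (low : seq _) => [|m s IH] sub.
    exists 0, (fun=> 0) => x; rewrite big_nil big1 ?addr0 // => i _.
    by rewrite mul0r.
  have [b1 [l1 E1]] := monomial_affine (c m) a m (sub m (mem_head _ _)).
  have [|b2 [l2 E2]] := IH; first by move=> m' m's; apply: sub; rewrite inE m's orbT.
  exists (b1 + b2), (fun i => l1 i + l2 i) => x; rewrite big_cons E1 E2 addrACA.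
  by congr (_ + _); rewrite -big_split /=; apply: eq_bigr => i _; rewrite mulrDl.
have near_f x e : 0 <= e -> (forall i, `|x 0 i - a 0 i| <= e) -> e <= r ->
    `|f x - b - \sum_i l i * (x 0 i - a 0 i)| <= M / r ^+ 2 * e ^+ 2.
  move=> e0 xe er; apply/ler_addgt0Pr => eps eps0.
  have xr i : `|x 0 i - a 0 i| <= r := le_trans (xe i) er.
  have [J JP] := cvg_totally (cvg_r x xr) eps0.
  pose K := (J `|` low)%fset; have := JP K (fsubsetUl _ _).
  pose g m := c m * \prod_i (x 0 i - a 0 i) ^+ m i.
  rewrite -/(\sum_(m <- K) g m) (bigID (fun m => m \in low)) /=.
  have -> : \sum_(m <- K | m \in low) g m = b + \sum_i l i * (x 0 i - a 0 i).
    rewrite -lowE [LHS]big_fset_condE; apply: eq_fbigl => m.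
    by rewrite !inE; case: (m \in low); rewrite ?orbT ?andbF.
  have : `|\sum_(m <- K | m \notin low) g m| <= M / r ^+ 2 * e ^+ 2.
    apply: le_trans (ler_norm_sum _ _ _) _.
    apply: (@le_trans _ _ (\sum_(m <- K) (`|c m| * r ^+ deg m) * (r ^- 2 * e ^+ 2))).
      rewrite [leLHS]big_mkcond /=; apply: ler_sum => m _; case: ifPn => mlow.
        have m2 : (2 <= deg m)%N by rewrite leqNgt; apply: contra mlow; exact: lowP.
        rewrite normrM -mulrA ler_wpM2l // normr_prod.
        apply: (@le_trans _ _ (e ^+ deg m)).
          rewrite /deg expr_sum; apply: ler_prod => i _.
          by rewrite normrX exprn_ge0 // lerXn2r ?nnegrE // (le_trans _ (xe i)).
        rewrite -(subnK m2) !exprD -mulrA [r ^+ 2 * _]mulrA divff ?mul1r; last first.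
          by rewrite expf_neq0 // gt_eqF.
        by rewrite ler_wpM2r ?exprn_ge0 // lerXn2r ?nnegrE // ltW.
      by rewrite !mulr_ge0 ?exprn_ge0 ?invr_ge0 ?exprn_ge0 // ltW.
    rewrite -mulr_suml mulrA ler_wpM2r ?exprn_ge0 //.
    by rewrite ler_wpM2r ?invr_ge0 ?exprn_ge0 // ltW.
  set A := b + _; set G := \sum_(m <- K | _) _ => G_le /ltW G_near.
  have -> : f x - b - \sum_i l i * (x 0 i - a 0 i) = G - (A + G - f x) by rewrite /A; ring.
  by apply: le_trans (ler_normB _ _) _; exact: lerD.
have fa : f a = b.
  have := near_f a 0 (lexx _) _ (ltW r_gt0).
  rewrite expr0n mulr0 [\sum_i _]big1 => [|i _]; last by rewrite subrr mulr0.
  rewrite subr0 normr_le0 subr_eq0 => H; apply/eqP/H => i.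
  by rewrite subrr normr0.
exists l, (M / r ^+ 2), r; split=> //; last by rewrite fa.
by rewrite divr_ge0 // exprn_ge0 // ltW.
Qed.

End AnalyticExpansion.

Lemma analytic_map_expansion (R : realType) (n : nat) (f : 'rV[R]_n -> 'rV[R]_n) (a : 'rV[R]_n) :
  (forall i, analytic_at (fun x => f x 0 i) a) ->
  exists (l : 'I_n -> 'I_n -> R) (C r : R), [/\ 0 <= C, 0 < r & forall (x : 'rV[R]_n) (e : R),
    0 <= e -> (forall i, `|x 0 i - a 0 i| <= e) -> e <= r -> forall i,
    `|f x 0 i - f a 0 i - \sum_j l i j * (x 0 j - a 0 j)| <= C * e ^+ 2].
Proof.
move=> fa; have /choice[l lP] i := analytic_expansion (fa i).
have /choice[C CP] := lP; have {CP}/choice[r CrP] := CP.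
have r_gt0 i : 0 < r i by case: (CrP i).
have C_ge0 i : 0 <= C i by case: (CrP i).
have s_ge0 : 0 <= \sum_i (r i)^-1 by apply: sumr_ge0 => i _; rewrite invr_ge0 ltW.
(* A positive radius below every [r i], obtained without a minimum and meaningful also for n = 0. *)
exists l, (\sum_i C i), (1 + \sum_i (r i)^-1)^-1; split.
- exact: sumr_ge0.
- by rewrite invr_gt0 ltr_pwDl.
move=> x e e0 xe er i; have [_ _ /(_ x e e0 xe)H] := CrP i.
apply: le_trans (H _) _.
  apply: le_trans er _; rewrite -[leRHS]invrK lef_pV2 ?posrE ?invr_gt0 ?ltr_pwDl //.
  by rewrite (bigD1 i) //= addrCA lerDl addr_ge0 // sumr_ge0 // => j _; rewrite invr_ge0 ltW.
by rewrite ler_wpM2r ?exprn_ge0 // (bigD1 i) //= lerDl sumr_ge0.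
Qed.

Lemma open_box (R : realType) (n : nat) (U : set 'rV[R]_n) (p : 'rV[R]_n) :
  open U -> U p -> exists2 r : R, 0 < r &
    forall x : 'rV[R]_n, (forall i, `|x 0 i - p 0 i| <= r) -> U x.
Proof.
move=> oU Up; have /nbhs_ballP[r /= r0 rU] : nbhs p U by apply: open_nbhs_nbhs.
exists (r / 2); first by rewrite divr_gt0.
move=> x xr; apply: rU; split=> // i j; rewrite (ord1 i) -ball_normE /= distrC.
by apply: le_lt_trans (xr j) _; rewrite ltr_pdivrMr // ltr_pMr // ltr1n.
Qed.

(** The only consequence of smoothness that is used: displacements of X from p can be added up to
    second order. It mentions no dimension and no chart. *)
Definition additive_at (R : realType) (n : nat) (X : set 'rV[R]_n) (p : 'rV[R]_n) : Prop :=
  exists (C r : R), [/\ 0 <= C, 0 < r & forall (x y : 'rV[R]_n) (e : R),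
    X x -> X y -> 0 <= e -> e <= r ->
    (forall i, `|x 0 i - p 0 i| <= e) -> (forall i, `|y 0 i - p 0 i| <= e) ->
    exists2 z, X z & forall i, `|z 0 i - (x 0 i + y 0 i - p 0 i)| <= C * e ^+ 2].

(* In a chart phi that straightens X, phi x + phi y - phi p is again a point of
   the linear space phi X. *)
Lemma manifold_point_additive (R : realType) (n : nat) (X : set 'rV[R]_n) (p : 'rV[R]_n) :
  X p -> manifold_point X p -> additive_at X p.
Proof.
move=> Xp [U0 [oU0 U0p [d _ /(_ p (conj Xp U0p))]]].
move=> [U [V [phi [oU Up oV [psi [phiU psiV phiK psiK [phi_an psi_an]] XU]]]]].
have {}phiU (x : 'rV[R]_n) : U x -> V (phi x) by move=> Ux; apply: phiU; exists x.
have {}psiV (v : 'rV[R]_n) : V v -> U (psi v) by move=> Vv; apply: psiV; exists v.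
have {}phiK (x : 'rV[R]_n) : U x -> psi (phi x) = x by move=> Ux; apply: phiK; rewrite inE.
have {}psiK (v : 'rV[R]_n) : V v -> phi (psi v) = v by move=> Vv; apply: psiK; rewrite inE.
have [r1 r1_gt0 r1U] := open_box oU Up.
have [r2 r2_gt0 r2U0] := open_box oU0 U0p.
have [r3 r3_gt0 r3V] := open_box oV (phiU _ Up).
have [l [C [r4 [C_ge0 r4_gt0 lC]]]] := analytic_map_expansion (phi_an _ Up).
have [l' [C' [r5 [C'_ge0 r5_gt0 l'C']]]] := analytic_map_expansion (psi_an _ (phiU _ Up)).
pose Lam := C + \sum_i \sum_j `|l i j|.
have Lam_ge0 : 0 <= Lam by rewrite addr_ge0 // sumr_ge0 // => i _; apply: sumr_ge0.
have phi_lip (x : 'rV[R]_n) (e : R) : 0 <= e -> e <= 1 -> e <= r4 -> (forall i, `|x 0 i - p 0 i| <= e) ->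
    forall i, `|phi x 0 i - phi p 0 i| <= Lam * e.
  move=> e0 e1 er xe i; have := lC x e e0 xe er i.
  set S := \sum_j _ => H.
  have HS : `|S| <= (\sum_i \sum_j `|l i j|) * e.
    apply: le_trans (ler_norm_sum _ _ _) _.
    rewrite [X in _ <= X * _](bigD1 i) //= mulrDl mulr_suml.
    apply: (@le_trans _ _ (\sum_j `|l i j| * e)).
      by apply: ler_sum => j _; rewrite normrM ler_wpM2l.
    by rewrite lerDl mulr_ge0 // sumr_ge0 // => k _; apply: sumr_ge0.
  rewrite -[_ - _](subrK S); apply: le_trans (ler_normD _ _) _.
  rewrite /Lam mulrDl; apply: lerD => //; apply: le_trans H _.
  by rewrite ler_wpM2l // expr2 ler_piMr.
(* The point v below is displaced by at most 2 Lam e; q e dominates this as well as Lam e. The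
   inverse sum r is a common lower bound of 1, r1, r2, r4, r3 / q and r5 / q. *)
pose q := 1 + Lam * 2.
have q_gt0 : 0 < q by rewrite ltr_pwDl // mulr_ge0.
pose r := (1 + r1^-1 + r2^-1 + r4^-1 + q / r3 + q / r5)^-1.
have r_gt0 : 0 < r.
  by rewrite invr_gt0 !ltr_wpDr // ?divr_ge0 ?invr_ge0 ?ltW.
have r_le s : 0 < s -> s^-1 <= 1 + r1^-1 + r2^-1 + r4^-1 + q / r3 + q / r5 -> r <= s.
  move=> s0 H; have D0 := lt_le_trans (_ : 0 < s^-1) H.
  by rewrite -(invrK s) lef_pV2 ?posrE ?invr_gt0 ?D0 // invr_gt0.
have pos : [/\ 0 < r1^-1, 0 < r2^-1, 0 < r4^-1, 0 < q / r3 & 0 < q / r5].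
  by rewrite !divr_gt0 ?invr_gt0.
have rr1 : r <= r1 by apply: r_le => //; case: pos => *; lra.
have rr2 : r <= r2 by apply: r_le => //; case: pos => *; lra.
have rr4 : r <= r4 by apply: r_le => //; case: pos => *; lra.
have r_1 : r <= 1 by apply: r_le => //; rewrite invr1; case: pos => *; lra.
have qr s : 0 < s -> q / s <= 1 + r1^-1 + r2^-1 + r4^-1 + q / r3 + q / r5 -> q * r <= s.
  move=> s0 H; rewrite mulrC -ler_pdivlMr //; apply: r_le; first by rewrite divr_gt0.
  by rewrite invf_div.
have qr3 : q * r <= r3 by apply: qr => //; case: pos => *; lra.
have qr5 : q * r <= r5 by apply: qr => //; case: pos => *; lra.
(* The linear parts of the inverse chart at v, [phi x] and [phi y] cancel; each of the three
   expansions leaves an error C' (q e)^2. *)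
exists (3 * C' * q ^+ 2), r; split=> //; first by rewrite mulr_ge0 ?exprn_ge0 ?(ltW q_gt0) // mulr_ge0.
move=> x y e Xx Xy e0 er xe ye.
have chart (w : 'rV[R]_n) : X w -> (forall i, `|w 0 i - p 0 i| <= e) ->
    [/\ U w, V (phi w), forall i, `|phi w 0 i - phi p 0 i| <= Lam * e &
      forall i : 'I_n, (d <= i)%N -> phi w 0 i = 0].
  move=> Xw we; have Uw : U w by apply: r1U => i; apply: le_trans (we i) (le_trans er rr1).
  split=> //; first exact: phiU.
    by apply: phi_lip => //; [exact: le_trans er r_1|exact: le_trans er rr4].
  have : ((X `&` U0) `&` U) w.
    by split=> //; split=> //; apply: r2U0 => i; apply: le_trans (we i) (le_trans er rr2).
  by rewrite XU => -[].
have [Ux Vx x_lip x0] := chart x Xx xe.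
have [Uy Vy y_lip y0] := chart y Xy ye.
have [//|_ Vp _ p0] := chart p Xp; first by move=> i; rewrite subrr normr0.
pose v := phi x + phi y - phi p.
have vE i : v 0 i - phi p 0 i = (phi x 0 i - phi p 0 i) + (phi y 0 i - phi p 0 i).
  by rewrite /v !mxE; ring.
have qe0 : 0 <= q * e by rewrite mulr_ge0 // ltW.
have le_qe : Lam * e <= q * e by rewrite ler_wpM2r // /q; lra.
have v_lip i : `|v 0 i - phi p 0 i| <= q * e.
  rewrite vE; apply: le_trans (ler_normD _ _) _; apply: le_trans (lerD (x_lip i) (y_lip i)) _.
  by rewrite /q; nra.
have qer : q * e <= q * r by rewrite ler_wpM2l // ltW.
have Vv : V v by apply: r3V => i; apply: le_trans (v_lip i) (le_trans qer qr3).
have Ez : ((X `&` U0) `&` U) (psi v).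
  rewrite XU; split; first exact: psiV.
  by move=> i di; rewrite psiK // !mxE x0 // y0 // p0 // addr0 subr0.
exists (psi v); first by case: Ez => -[].
move=> i; have qe5 : q * e <= r5 := le_trans qer qr5.
have Hv := l'C' v _ qe0 v_lip qe5 i.
have Hx := l'C' (phi x) _ qe0 (fun j => le_trans (x_lip j) le_qe) qe5 i.
have Hy := l'C' (phi y) _ qe0 (fun j => le_trans (y_lip j) le_qe) qe5 i.
rewrite !phiK // in Hv Hx Hy.
have lv : \sum_j l' i j * (v 0 j - phi p 0 j) =
    \sum_j l' i j * (phi x 0 j - phi p 0 j) + \sum_j l' i j * (phi y 0 j - phi p 0 j).
  by rewrite -big_split /=; apply: eq_bigr => j _; rewrite vE mulrDr.
rewrite lv in Hv; rewrite -[leRHS]mulrA -exprMn -mulrA; set W := C' * _ in Hv Hx Hy *.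
move: Hv Hx Hy.
move: (\sum_j l' i j * (phi x 0 j - phi p 0 j)) (\sum_j l' i j * (phi y 0 j - phi p 0 j)).
move=> sx sy; clear.
rewrite !ler_norml => /andP[? ?] /andP[? ?] /andP[? ?].
apply/andP; split; lra.
Qed.

(** * Stresses of the linkage *)

Section StretchedLegs.
Variable R : rcfType.

(** Half-angle coordinates make the equations of the stretched legs factor: 1 - c = 2 y^2 and s = 2
    x y share the factor y. *)
Lemma half_angle (c s : R) : c ^+ 2 + s ^+ 2 = 1 ->
  exists x y : R, [/\ x ^+ 2 + y ^+ 2 = 1, c = x ^+ 2 - y ^+ 2 & s = 2 * x * y].
Proof.
move=> cs; have [c1|c1] := eqVneq c (-1).
  have s2 : s ^+ 2 = 0 by rewrite c1 in cs; lra.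
  have s0 : s = 0 by apply/eqP; rewrite -sqrf_eq0 s2.
  by exists 0, 1; rewrite c1 s0; split; ring.
have c_gt : 0 < 1 + c.
  have c_ge : 0 <= 1 + c by nra.
  rewrite lt_neqAle c_ge andbT eq_sym; apply: contra c1 => /eqP c0; apply/eqP; lra.
pose x := Num.sqrt ((1 + c) / 2).
have x2 : x ^+ 2 = (1 + c) / 2 by rewrite sqr_sqrtr // divr_ge0 // ltW.
have x0 : x != 0 by rewrite sqrtr_eq0 -ltNge divr_gt0.
have y2 : (s / (2 * x)) ^+ 2 = (1 - c) / 2.
  rewrite expr_div_n exprMn x2; have -> : s ^+ 2 = (1 + c) * (1 - c) by lra.
  by field; rewrite gt_eqF.
exists x, (s / (2 * x)); by split; rewrite ?y2 ?x2; field.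
Qed.

(* (p, q) is twice the link 1, (c, s) is the link 6 and (a, b) the link 3 of a
   configuration with three stretched legs; the last hypothesis is the condition
   for the legs to carry a stress. *)
Lemma stretched_legs_regular (p q c s a b w : R) :
  c ^+ 2 + s ^+ 2 = 1 -> w ^+ 2 = 3 -> 2 * a = c - w * s -> 2 * b = s + w * c ->
  p ^+ 2 + q ^+ 2 = 4 -> (1 - c - p) ^+ 2 + (- s - q) ^+ 2 = 4 ->
  (1 - a - p) ^+ 2 + (1 - b - q) ^+ 2 = 4 ->
  (a * (1 - b - q) - b * (1 - a - p)) * (p * (- s - q) - q * (1 - c - p)) =
  (c * (- s - q) - s * (1 - c - p)) * (p * (1 - b - q) - q * (1 - a - p)) -> False.
Proof.
move=> cs w2 a2 b2 E1 E3 E2 D.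
have ab : a ^+ 2 + b ^+ 2 = 1.
  have : (2 * a) ^+ 2 + (2 * b) ^+ 2 = (1 + w ^+ 2) * (c ^+ 2 + s ^+ 2) by rewrite a2 b2; ring.
  by rewrite w2 cs => ?; lra.
have [x [y [xy cE sE]]] := half_angle cs.
have [y0|y0] := eqVneq y 0.
  have c1 : c = 1 by move: cE xy; rewrite y0 => ? ?; lra.
  have s0 : s = 0 by rewrite sE y0 mulr0.
  move: a2 b2 D E2; rewrite c1 s0 => a2 b2 D E2.
  have {}a2 : a = 1 / 2 by lra.
  have : q * (q - (2 - w) * p) = 0.
    have {}b2 : b = w / 2 by lra.
    by move: D; rewrite a2 b2 => D; lra.
  move=> /eqP; rewrite mulf_eq0 => /orP[/eqP q0|/eqP q1].
    have : p ^+ 2 = 2 ^+ 2 by move: E1; rewrite q0 => ?; lra.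
    move=> /eqP; rewrite eqf_sqr => /orP[] /eqP pE; move: E2; rewrite pE q0 a2 => E2.
      by have : w = 0 by [lra|nra]; move=> w0; move: w2; rewrite w0 => ?; lra.
    by have : w = 4 by [lra|nra]; move=> w0; move: w2; rewrite w0 => ?; lra.
  have p1 : p ^+ 2 * (2 - w) = 1.
    have : p ^+ 2 + ((2 - w) * p) ^+ 2 = 4 by rewrite -E1; congr (_ + _ ^+ 2); lra.
    have -> : p ^+ 2 + ((2 - w) * p) ^+ 2 = p ^+ 2 * (5 - 4 * w + w ^+ 2) by ring.
    by rewrite w2 => ?; lra.
  have w_neq2 : 2 - w != 0.
    by apply/eqP => w0; move: p1; rewrite w0 mulr0 => /eqP; rewrite eq_sym oner_eq0.
  have : (2 - w) * (1 - 4 * p) = 0.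
    have qE : q = (2 - w) * p by lra.
    have bE : b = w / 2 by lra.
    have : 1 / 4 - p + (1 - w + w ^+ 2 / 4) - (2 - w) * q = 0.
      by move: E2; rewrite a2 bE => ?; lra.
    rewrite qE w2 => H; have -> : (2 - w) * (1 - 4 * p) = 2 - w - (8 - 4 * w) * p by ring.
    have : (2 - w) * ((2 - w) * p) = (7 - 4 * w) * p.
      have -> : 7 - 4 * w = 4 - 4 * w + w ^+ 2 by rewrite w2; ring.
      by ring.
    by move=> ?; lra.
  move=> /eqP; rewrite mulf_eq0 (negbTE w_neq2) /= => /eqP p4.
  have pE : p = 1 / 4 by lra.
  have wE : w = -14 by move: p1; rewrite pE => ?; lra.
  by move: w2; rewrite wE => ?; lra.
(* The first and third legs have the same length; subtracting E1 from E3 makes (p - 1, q) a multiple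
   of (x, y), with factor rho. *)
have parallel : y * (1 - p) + x * q = 0.
  have : (1 - c) * (1 - p) + s * q = 0 by lra.
  have -> : 1 - c = 2 * y ^+ 2 by rewrite cE; lra.
  rewrite sE; have -> : 2 * y ^+ 2 * (1 - p) + 2 * x * y * q = (2 * y) * (y * (1 - p) + x * q).
    by ring.
  by move=> /eqP; rewrite !mulf_eq0 pnatr_eq0 (negbTE y0) /= => /eqP.
pose rho := (p - 1) * x + q * y.
have pE : p = 1 + rho * x.
  have -> : 1 + rho * x = 1 + (p - 1) * (x ^+ 2 + y ^+ 2) + y * (y * (1 - p) + x * q).
    by rewrite /rho; ring.
  by rewrite xy parallel; ring.
have qE : q = rho * y.
  have -> : rho * y = q * (x ^+ 2 + y ^+ 2) - x * (y * (1 - p) + x * q) by rewrite /rho; ring.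
  by rewrite xy parallel; ring.
move: rho pE qE => rho pE qE {parallel}; rewrite {p}pE {q}qE in E1 E2 E3 D.
have {}E1 : rho ^+ 2 + 2 * rho * x = 3.
  have : (1 + rho * x) ^+ 2 + (rho * y) ^+ 2 = 1 + 2 * rho * x + rho ^+ 2 * (x ^+ 2 + y ^+ 2).
    by ring.
  by rewrite E1 xy => ?; lra.
have x2 : x ^+ 2 = 1 - y ^+ 2 by lra.
(* Modulo w^2 = 3 and x^2 + y^2 = 1, the difference of the equations of the second and first legs
   splits into two linear factors. *)
have F : (x + (2 + w) * y) * ((1 - w) * (x - y) - rho) = 0.
  have E2' : rho ^+ 2 * (x ^+ 2 + y ^+ 2) - 2 - 2 * rho * y + rho * x * (2 * a) -
      (2 * b) * (1 - rho * y) = 0.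
    have -> : rho ^+ 2 * (x ^+ 2 + y ^+ 2) - 2 - 2 * rho * y + rho * x * (2 * a) -
      (2 * b) * (1 - rho * y) = (1 - a - (1 + rho * x)) ^+ 2 + (1 - b - rho * y) ^+ 2 -
      (a ^+ 2 + b ^+ 2) - 3 by ring.
    by rewrite E2 ab; lra.
  rewrite a2 b2 cE sE in E2'.
  transitivity (rho ^+ 2 * (x ^+ 2 + y ^+ 2) - 2 - 2 * rho * y +
    rho * x * (x ^+ 2 - y ^+ 2 - w * (2 * x * y)) -
    (2 * x * y + w * (x ^+ 2 - y ^+ 2)) * (1 - rho * y) - (rho ^+ 2 + 2 * rho * x - 3)).
    by ring: x2 w2.
  by rewrite E2' E1; ring.
(* The stress condition D, from which a factor y is cancelled. *)
have G : rho * ((1 + rho * x) * (2 - 2 * b - 2 * rho * y) -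
      rho * y * (2 - 2 * a - 2 * (1 + rho * x))) +
    2 * (x + rho) * (2 * a * (1 - rho * y) + 2 * b * rho * x) = 0.
  apply: (mulfI y0); rewrite mulr0.
  have H1 : (1 + rho * x) * (- s - rho * y) - rho * y * (1 - c - (1 + rho * x)) = - 2 * y * (x + rho).
    by rewrite cE sE; ring: x2.
  have H2 : c * (- s - rho * y) - s * (1 - c - (1 + rho * x)) = rho * y.
    by rewrite cE sE; ring: x2.
  by rewrite H1 H2 in D; lra.
rewrite a2 b2 cE sE in G.
move: F => /eqP; rewrite mulf_eq0 => /orP[/eqP xE|/eqP rhoE].
  have {}xE : x = - (2 + w) * y by lra.
  have y2 : 4 * y ^+ 2 = 2 - w.
    have : (2 - w) * ((2 + w) ^+ 2 + 1) * y ^+ 2 = 2 - w.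
      transitivity ((2 - w) * (x ^+ 2 + y ^+ 2)); first by rewrite xE; ring.
      by rewrite xy mulr1.
    have -> : (2 - w) * ((2 + w) ^+ 2 + 1) = 4 by ring: w2.
    by [].
  rewrite xE in G E1.
  (* The cofactors come from reducing G modulo E1 and the value of y^2 until it is linear in rho.
     Put back into E1, the result gives 76 w = -99. *)
  have rhoE : (w - 2) * rho = (16 * w + 30) * y.
    have E1' : rho ^+ 2 - 3 - 2 * rho * (2 + w) * y = 0 by lra.
    have y2' : 4 * y ^+ 2 - (2 - w) = 0 by lra.
    apply/eqP; rewrite -subr_eq0 -[X in _ == X]G -subr_eq0.
    apply/eqP; transitivity (- ((- 24 * y ^+ 3 * w - 40 * y ^+ 3 - 2 * y * w - 6 * y) *
      (rho ^+ 2 - 3 - 2 * rho * (2 + w) * y) + (- 32 * y * w - 54 * y - 2 * rho * w - 5 * rho) *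
      (4 * y ^+ 2 - (2 - w)))); first by ring: w2.
    by rewrite E1' y2'; ring.
  have : (w - 2) ^+ 2 * (rho ^+ 2 + 2 * rho * (- (2 + w) * y)) = 3 * (w - 2) ^+ 2.
    by rewrite E1; ring.
  have -> : (w - 2) ^+ 2 * (rho ^+ 2 + 2 * rho * (- (2 + w) * y)) =
    ((w - 2) * rho) ^+ 2 + 2 * ((w - 2) * rho) * y * (4 - w ^+ 2) by ring.
  rewrite rhoE w2 => H.
  have : (432 + 248 * w) * (4 * y ^+ 2) = 3 * (w - 2) ^+ 2 by rewrite -H; ring: w2.
  rewrite y2 => H'.
  have wE : 76 * w = - 99.
    have : (432 + 248 * w) * (2 - w) = 864 + 64 * w - 248 * w ^+ 2 by ring.
    have : (w - 2) ^+ 2 = w ^+ 2 - 4 * w + 4 by ring.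
    by rewrite w2 => ? ?; lra.
  have : (76 * w) ^+ 2 = 5776 * w ^+ 2 by ring.
  by rewrite wE w2 => ?; lra.
have {}rhoE : rho = (1 - w) * (x - y) by lra.
rewrite rhoE in G E1.
have Q : (3 - 4 * w) * x ^+ 2 + (6 * w - 10) * x * y + (1 - 2 * w) * y ^+ 2 = 0.
  transitivity (((1 - w) * (x - y)) ^+ 2 + 2 * ((1 - w) * (x - y)) * x - 3); first by ring: x2 w2.
  by rewrite E1; ring.
have C : (5 - 3 * w) * x ^+ 3 + (3 - 3 * w) * x ^+ 2 * y + (w - 7) * x * y ^+ 2 +
    (w - 1) * y ^+ 3 = 0.
  by rewrite -[RHS]G; ring: x2 w2.
(* A Euclidean step: the cofactors eliminate the higher powers of x from the binary cubic C and the
   binary quadratic Q. Substituted in Q, the linear relation leaves 49 w = 90. *)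
have lin : (2609 - 1899 * w) * x = - ((657 * w - 869) * y).
  have : 4 * y ^+ 2 * ((2609 - 1899 * w) * x + (657 * w - 869) * y) = 0.
    transitivity (507 * ((5 - 3 * w) * x ^+ 3 + (3 - 3 * w) * x ^+ 2 * y +
      (w - 7) * x * y ^+ 2 + (w - 1) * y ^+ 3) - ((273 - 143 * w) * x + (887 - 347 * w) * y) *
      ((3 - 4 * w) * x ^+ 2 + (6 * w - 10) * x * y + (1 - 2 * w) * y ^+ 2)); first by ring: w2.
    by rewrite C Q; ring.
  move=> /eqP; rewrite !mulf_eq0 pnatr_eq0 ?expf_eq0 (negbTE y0) /= => /eqP ?; lra.
have : (2609 - 1899 * w) ^+ 2 * ((3 - 4 * w) * x ^+ 2 + (6 * w - 10) * x * y +
    (1 - 2 * w) * y ^+ 2) = 0 by rewrite Q mulr0.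
have -> : (2609 - 1899 * w) ^+ 2 * ((3 - 4 * w) * x ^+ 2 + (6 * w - 10) * x * y +
    (1 - 2 * w) * y ^+ 2) = (3 - 4 * w) * ((2609 - 1899 * w) * x) ^+ 2 +
    (6 * w - 10) * ((2609 - 1899 * w) * x) * (2609 - 1899 * w) * y +
    (1 - 2 * w) * (2609 - 1899 * w) ^+ 2 * y ^+ 2 by ring.
rewrite lin => H.
have : 120 * (2197 * ((49 * w - 90) * y ^+ 2)) = 0 by rewrite -[RHS]H; ring: w2.
move=> /eqP; rewrite !mulf_eq0 !pnatr_eq0 ?expf_eq0 (negbTE y0) /= orbF => /eqP H'.
move: H' w2; clear => H' w2.
have : (49 * w) ^+ 2 = 2401 * w ^+ 2 by ring.
have -> : 49 * w = 90 by lra.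
by rewrite w2 => ?; lra.
Qed.

End StretchedLegs.

Definition linkage (R : pzRingType) (c s : nat -> R) : Prop :=
  [/\ c 1%N + c 2%N + c 3%N + c 4%N + c 5%N = 1,
      s 1%N + s 2%N + s 3%N + s 4%N + s 5%N = 1,
      c 1%N + c 2%N + c 6%N + c 7%N + c 8%N = 1,
      s 1%N + s 2%N + s 6%N + s 7%N + s 8%N = 0 &
      [/\ c 6%N + c 9%N = c 3%N, s 6%N + s 9%N = s 3%N &
      forall i, (0 < i < 10)%N -> c i ^+ 2 + s i ^+ 2 = 1]].

(* An equilibrium stress: a, b, g are the forces transmitted through the three
   loop equations, and each link must be parallel to the force it carries. *)
Definition stress (R : pzRingType) (c s : nat -> R) (a1 a2 b1 b2 g1 g2 : R) : Prop :=
  let par u v i := u * s i = v * c i in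
  [/\ par (a1 + b1) (a2 + b2) 1%N, par (a1 + b1) (a2 + b2) 2%N,
      par (a1 - g1) (a2 - g2) 3%N, par a1 a2 4%N &
      [/\ par a1 a2 5%N, par (b1 + g1) (b2 + g2) 6%N, par b1 b2 7%N, par b1 b2 8%N &
      par g1 g2 9%N]].

Section Stress.
Variable R : rcfType.
Implicit Types (c s : nat -> R).

Lemma unit_sign (c s c' s' : R) : c ^+ 2 + s ^+ 2 = 1 -> c' ^+ 2 + s' ^+ 2 = 1 ->
  c * s' = s * c' -> (c' = c /\ s' = s) \/ (c' = - c /\ s' = - s).
Proof.
move=> u u' par; pose d := c * c' + s * s'.
have cE : c' = d * c.
  have -> : d * c = c' * (c ^+ 2 + s ^+ 2) + s * (c * s' - s * c') by rewrite /d; ring.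
  by rewrite u par; ring.
have sE : s' = d * s.
  have -> : d * s = s' * (c ^+ 2 + s ^+ 2) - c * (c * s' - s * c') by rewrite /d; ring.
  by rewrite u par; ring.
have : d ^+ 2 = 1 ^+ 2.
  have : (d * c) ^+ 2 + (d * s) ^+ 2 = d ^+ 2 * (c ^+ 2 + s ^+ 2) by ring.
  by rewrite -cE -sE u u' => ?; lra.
move=> /eqP; rewrite eqf_sqr => /orP[] /eqP dE; [left|right]; rewrite cE sE dE; split; ring.
Qed.

Lemma parallel_links (u v c s c' s' : R) : (u != 0) || (v != 0) ->
  u * s = v * c -> u * s' = v * c' -> c * s' = s * c'.
Proof.
move=> uv H H'; have E1 : u * (c * s' - s * c') = 0.
  have -> : u * (c * s' - s * c') = c * (u * s') - c' * (u * s) by ring.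
  by rewrite H H'; ring.
have E2 : v * (c * s' - s * c') = 0.
  have -> : v * (c * s' - s * c') = s' * (v * c) - s * (v * c') by ring.
  by rewrite -H -H'; ring.
apply/eqP; rewrite -subr_eq0; apply: contraT => nz.
move/eqP: E1; move/eqP: E2; rewrite !mulf_eq0 (negbTE nz) !orbF.
by move: uv => /orP[] /negbTE ->.
Qed.

Lemma both_parallel (u v c s c' s' : R) : c * s' - s * c' != 0 ->
  u * s = v * c -> u * s' = v * c' -> u = 0 /\ v = 0.
Proof.
move=> nz H H'; have [/andP[/eqP -> /eqP ->] //|uv] := boolP ((u == 0) && (v == 0)).
case/eqP: nz; apply/eqP; rewrite subr_eq0; apply/eqP.
by apply: (parallel_links _ H H'); rewrite -negb_and.
Qed.

(** All five numbers are x1 up to sign, so the sum is n x1 for an integer n, and n^2 = 2 is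
    impossible. *)
Lemma five_diagonals (x1 x2 x3 x4 x5 : R) :
  x1 ^+ 2 = 1 / 2 -> x2 ^+ 2 = 1 / 2 -> x3 ^+ 2 = 1 / 2 -> x4 ^+ 2 = 1 / 2 ->
  x5 ^+ 2 = 1 / 2 -> x1 + x2 + x3 + x4 + x5 = 1 -> False.
Proof.
move=> d1 d2 d3 d4 d5.
have sign x : x ^+ 2 = 1 / 2 -> exists b : bool, x = (-1) ^+ b * x1.
  rewrite -d1 => /eqP; rewrite eqf_sqr => /orP[/eqP ->|/eqP ->]; [exists false|exists true].
    by rewrite mul1r.
  by rewrite mulN1r.
have [b2 ->] := sign _ d2; have [b3 ->] := sign _ d3.
have [b4 ->] := sign _ d4; have [b5 ->] := sign _ d5.
have -> : x1 + (-1) ^+ b2 * x1 + (-1) ^+ b3 * x1 + (-1) ^+ b4 * x1 + (-1) ^+ b5 * x1 =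
  (1 + (-1) ^+ b2 + (-1) ^+ b3 + (-1) ^+ b4 + (-1) ^+ b5) * x1 by ring.
set n := (X in X * x1) => n1; have : n ^+ 2 * x1 ^+ 2 = 1 by rewrite -exprMn n1 expr1n.
rewrite d1 /n {n n1}; case: b2 b3 b4 b5 => [] [] [] []; rewrite !(expr0, expr1) => ?; lra.
Qed.

Section Platform.
Variables (c s : nat -> R).
Hypothesis cs : linkage c s.

(** Three unit vectors with u_6 + u_9 = u_3 span an equilateral triangle; the sign of w is its
    orientation. *)
Lemma platform : exists w : R, [/\ w ^+ 2 = 3, 2 * c 3%N = c 6%N - w * s 6%N,
  2 * s 3%N = s 6%N + w * c 6%N, 2 * c 9%N = - c 6%N - w * s 6%N &
  2 * s 9%N = - s 6%N + w * c 6%N].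
Proof.
case: cs => _ _ _ _ [C1 C2 U]; have := U 3%N isT; have := U 6%N isT; have := U 9%N isT.
rewrite -C1 -C2 => U9 U6 U3; have dot : 2 * (c 6%N * c 9%N + s 6%N * s 9%N) = -1 by lra.
pose w := 2 * (c 6%N * s 9%N - s 6%N * c 9%N).
have w2 : w ^+ 2 = 3.
  have -> : w ^+ 2 = 4 * (c 6%N ^+ 2 + s 6%N ^+ 2) * (c 9%N ^+ 2 + s 9%N ^+ 2) -
    (2 * (c 6%N * c 9%N + s 6%N * s 9%N)) ^+ 2 by rewrite /w; ring.
  by rewrite U6 U9 dot; ring.
have E1 : c 6%N * (2 * (c 6%N * c 9%N + s 6%N * s 9%N)) - s 6%N * w =
    2 * c 9%N * (c 6%N ^+ 2 + s 6%N ^+ 2) by rewrite /w; ring.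
have E2 : s 6%N * (2 * (c 6%N * c 9%N + s 6%N * s 9%N)) + c 6%N * w =
    2 * s 9%N * (c 6%N ^+ 2 + s 6%N ^+ 2) by rewrite /w; ring.
rewrite dot U6 in E1 E2; move: w w2 E1 E2 => w w2 E1 E2.
by exists w; split=> //; lra.
Qed.

(* With a leg unloaded, the two loaded legs and a side of the platform are
   parallel to a side of the base. *)
Lemma two_leg_stress a1 a2 b1 b2 g1 g2 : stress c s a1 a2 b1 b2 g1 g2 ->
  [|| a1 != 0, a2 != 0, b1 != 0, b2 != 0, g1 != 0 | g2 != 0] ->
  (a1 = 0 /\ a2 = 0) \/ (b1 = 0 /\ b2 = 0) \/ (a1 + b1 = 0 /\ a2 + b2 = 0) ->
  [/\ s 1%N = 0, s 2%N = 0, s 6%N = 0, s 7%N = 0 & s 8%N = 0] \/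
  [/\ c 4%N = 0, c 5%N = 0, c 7%N = 0, c 8%N = 0 & c 9%N = 0].
Proof.
have [w [w2 c3 s3 c9 s9]] := platform.
case: (cs) => A1 A2 B1 B2 [C1 C2 U] [S1 S2 S3 S4 [S5 S6 S7 S8 S9]] nz.
have U6 := U 6%N isT.
have w0 : w != 0 by apply/eqP => w0; move: w2; rewrite w0; lra.
(* Two sides of the platform are never parallel. Hence, once a leg is unloaded, the two sides
   meeting at it carry the same force up to sign, and that force vanishes. *)
have cross39 : c 3%N * s 9%N - s 3%N * c 9%N != 0.
  apply/eqP => H; case/eqP: w0.
  have : (2 * c 3%N) * (2 * s 9%N) - (2 * s 3%N) * (2 * c 9%N) =
    2 * w * (c 6%N ^+ 2 + s 6%N ^+ 2) by rewrite c3 s3 c9 s9; ring.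
  by rewrite U6 => ?; lra.
have cross69 : c 6%N * s 9%N - s 6%N * c 9%N != 0.
  apply/eqP => H; case/eqP: w0.
  have : c 6%N * (2 * s 9%N) - s 6%N * (2 * c 9%N) =
    w * (c 6%N ^+ 2 + s 6%N ^+ 2) by rewrite c9 s9; ring.
  by rewrite U6 => ?; lra.
have cross36 : c 3%N * s 6%N - s 3%N * c 6%N != 0.
  apply/eqP => H; case/eqP: w0.
  have : (2 * c 3%N) * s 6%N - (2 * s 3%N) * c 6%N =
    - w * (c 6%N ^+ 2 + s 6%N ^+ 2) by rewrite c3 s3; ring.
  by rewrite U6 => ?; lra.
case=> [[a10 a20]|[[b10 b20]|[ab1 ab2]]].
- subst a1 a2; have [g10 g20] : g1 = 0 /\ g2 = 0.
    by apply: both_parallel cross39 _ _ => //; lra.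
  subst g1 g2; left; have b20 : b2 = 0.
    have : b1 * (s 1%N + s 2%N + s 6%N + s 7%N + s 8%N) =
      b2 * (c 1%N + c 2%N + c 6%N + c 7%N + c 8%N) by lra.
    by rewrite B1 B2 mulr0 mulr1.
  have b10 : b1 != 0 by move: nz; rewrite b20 !eqxx !orbF.
  by subst b2; split; apply: (mulfI b10); rewrite mulr0; lra.
(* The loop 1, ..., 5 has vector sum (1, 1), so its five parallel links would all be diagonal. *)
- subst b1 b2; have [g10 g20] : g1 = 0 /\ g2 = 0.
    by apply: both_parallel cross69 _ _ => //; lra.
  subst g1 g2; exfalso; have a21 : a2 = a1.
    have : a1 * (s 1%N + s 2%N + s 3%N + s 4%N + s 5%N) =
      a2 * (c 1%N + c 2%N + c 3%N + c 4%N + c 5%N) by lra.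
    by rewrite A1 A2 !mulr1.
  have a10 : a1 != 0 by move: nz; rewrite a21 !eqxx !orbF orbb.
  subst a2.
  have diag i : (0 < i < 10)%N -> a1 * s i = a1 * c i -> c i ^+ 2 = 1 / 2.
    by move=> /U u /(mulfI a10) E; move: u; rewrite E; lra.
  have d1 := diag 1%N isT; have d2 := diag 2%N isT; have d3 := diag 3%N isT.
  have d4 := diag 4%N isT; have d5 := diag 5%N isT.
  have {}d1 : c 1%N ^+ 2 = 1 / 2 by apply: d1; lra.
  have {}d2 : c 2%N ^+ 2 = 1 / 2 by apply: d2; lra.
  have {}d3 : c 3%N ^+ 2 = 1 / 2 by apply: d3; lra.
  have {}d4 : c 4%N ^+ 2 = 1 / 2 by apply: d4; lra.
  have {}d5 : c 5%N ^+ 2 = 1 / 2 by apply: d5; lra.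
  exact: five_diagonals d1 d2 d3 d4 d5 A1.
(* The forces in the links 4, 5, 7, 8, 9 are a up to sign, and u_9 + u_4 + u_5 - u_7 - u_8 = (0, 1)
   makes a vertical. *)
- have b1E : b1 = - a1 by lra.
  have b2E : b2 = - a2 by lra.
  subst b1 b2; have [ag1 ag2] : a1 - g1 = 0 /\ a2 - g2 = 0.
    by apply: both_parallel cross36 _ _ => //; lra.
  have g1E : g1 = a1 by lra.
  have g2E : g2 = a2 by lra.
  subst g1 g2; right; have a10 : a1 = 0.
    have : a1 * (s 9%N + s 4%N + s 5%N - s 7%N - s 8%N) =
      a2 * (c 9%N + c 4%N + c 5%N - c 7%N - c 8%N) by lra.
    have -> : s 9%N + s 4%N + s 5%N - s 7%N - s 8%N = 1 by lra.
    have -> : c 9%N + c 4%N + c 5%N - c 7%N - c 8%N = 0 by lra.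
    by rewrite mulr0 mulr1.
  have a20 : a2 != 0 by apply: contraTneq nz => ->; rewrite a10 oppr0 !eqxx.
  by subst a1; split; apply: (mulfI a20); rewrite mulr0; lra.
Qed.

End Platform.
End Stress.

Section ThreeLegs.
Variable R : rcfType.
Variables (c s : nat -> R).
Hypothesis cs : linkage c s.

Lemma parallel_scale (u v x y : R) : x ^+ 2 + y ^+ 2 = 1 -> u * y = v * x ->
  exists al, u = al * x /\ v = al * y.
Proof.
move=> xy uv; exists (u * x + v * y); split.
  transitivity (u * (x ^+ 2 + y ^+ 2) - y * (u * y - v * x)); last by ring.
  by rewrite xy uv; ring.
transitivity (v * (x ^+ 2 + y ^+ 2) + x * (u * y - v * x)); last by ring.
by rewrite xy uv; ring.
Qed.

(** With a = al u_4 and b = be u_7, the torque balance of the platform and the direction of leg 1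
    are two linear equations in al and be. The vanishing of their determinant is the last hypothesis
    of [stretched_legs_regular]. *)
Lemma stretched_legs_unstressed a1 a2 b1 b2 : (a1 != 0) || (a2 != 0) -> (b1 != 0) || (b2 != 0) ->
  a1 * s 4%N = a2 * c 4%N -> b1 * s 7%N = b2 * c 7%N ->
  (a1 + b1) * s 1%N = (a2 + b2) * c 1%N ->
  a1 * s 3%N - a2 * c 3%N + b1 * s 6%N - b2 * c 6%N = 0 ->
  c 2%N = c 1%N -> s 2%N = s 1%N -> c 5%N = c 4%N -> s 5%N = s 4%N ->
  c 8%N = c 7%N -> s 8%N = s 7%N -> False.
Proof.
move=> a0 b0 S4 S7 S1 tor c2 s2 c5 s5 c8 s8.
have [w [w2 c3 s3 _ _]] := platform cs.
case: cs => A1 A2 B1 B2 [_ _ U].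
have U1 := U 1%N isT; have U4 := U 4%N isT; have U7 := U 7%N isT.
rewrite c2 c5 in A1; rewrite s2 s5 in A2; rewrite c2 c8 in B1; rewrite s2 s8 in B2.
apply: (stretched_legs_regular (p := 2 * c 1%N) (q := 2 * s 1%N) (U 6%N isT) w2 c3 s3).
- by lra.
- have -> : 1 - c 6%N - 2 * c 1%N = 2 * c 7%N by lra.
  have -> : - s 6%N - 2 * s 1%N = 2 * s 7%N by lra.
  by lra.
- have -> : 1 - c 3%N - 2 * c 1%N = 2 * c 4%N by lra.
  have -> : 1 - s 3%N - 2 * s 1%N = 2 * s 4%N by lra.
  by lra.
have -> : 1 - c 6%N - 2 * c 1%N = 2 * c 7%N by lra.
have -> : - s 6%N - 2 * s 1%N = 2 * s 7%N by lra.
have -> : 1 - c 3%N - 2 * c 1%N = 2 * c 4%N by lra.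
have -> : 1 - s 3%N - 2 * s 1%N = 2 * s 4%N by lra.
have [al [a1E a2E]] := parallel_scale U4 S4; have [be [b1E b2E]] := parallel_scale U7 S7.
have al0 : (al != 0) || (- be != 0).
  apply/orP; left; apply: contraTneq a0 => al0.
  by rewrite a1E a2E al0 !mul0r eqxx.
rewrite a1E a2E b1E b2E in tor S1.
have : (c 7%N * s 6%N - s 7%N * c 6%N) * (c 4%N * s 1%N - s 4%N * c 1%N) =
  (c 4%N * s 3%N - s 4%N * c 3%N) * (c 7%N * s 1%N - s 7%N * c 1%N).
  by apply: (parallel_links al0); lra.
by move=> ?; lra.
Qed.

(** The two links of a loaded leg are parallel unit vectors, hence equal or opposite. A folded leg
    has length 0, which fixes the other links up to finitely many cases, all incompatible with the
    unit lengths. *)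
Lemma three_leg_stress a1 a2 b1 b2 g1 g2 : stress c s a1 a2 b1 b2 g1 g2 ->
  (a1 != 0) || (a2 != 0) -> (b1 != 0) || (b2 != 0) -> (a1 + b1 != 0) || (a2 + b2 != 0) -> False.
Proof.
case=> S1 S2 S3 S4 [S5 S6 S7 S8 S9] a0 b0 ab0.
have [w [w2 c3 s3 c9 s9]] := platform cs.
have dot69 : c 6%N * c 9%N + s 6%N * s 9%N = - 1 / 2.
  have [_ _ _ _ [_ _ U]] := cs; have U6 := U 6%N isT.
  have : c 6%N * (2 * c 9%N) + s 6%N * (2 * s 9%N) = - (c 6%N ^+ 2 + s 6%N ^+ 2).
    by rewrite c9 s9; ring.
  by rewrite U6 => ?; lra.
(* The torque balance of the platform: in the sum of the conditions on its three sides, g drops out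
   because u_6 + u_9 = u_3. *)
have tor : a1 * s 3%N - a2 * c 3%N + b1 * s 6%N - b2 * c 6%N = 0.
  by case: cs => _ _ _ _ [C1 C2 _]; rewrite -C1 -C2 in S3 *; lra.
case: (cs) => A1 A2 B1 B2 [C1 C2 U].
have U3 := U 3%N isT; have U6 := U 6%N isT; have U9 := U 9%N isT.
have U1 := U 1%N isT; have U4 := U 4%N isT; have U7 := U 7%N isT.
have leg1 := unit_sign U1 (U 2%N isT) (parallel_links ab0 S1 S2).
have leg2 := unit_sign U4 (U 5%N isT) (parallel_links a0 S4 S5).
have leg3 := unit_sign U7 (U 8%N isT) (parallel_links b0 S7 S8).
have stretched := stretched_legs_unstressed a0 b0 S4 S7 S1 tor.
clear S1 S2 S3 S4 S5 S6 S7 S8 S9 tor a0 b0 ab0 w w2 c3 s3 c9 s9.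
have sq0 (x : R) : x ^+ 2 = 0 -> x = 0 by move=> /eqP; rewrite sqrf_eq0 => /eqP.
have half (x y : R) : x = 2 * y -> x ^+ 2 = 4 * y ^+ 2 by move=> ->; ring.
case: leg1 => [[c2 s2]|[c2 s2]]; case: leg3 => [[c8 s8]|[c8 s8]];
  rewrite c2 c8 in A1 B1; rewrite s2 s8 in A2 B2.
- case: leg2 => [[c5 s5]|[c5 s5]].
    exact: stretched c2 s2 c5 s5 c8 s8.
  rewrite c5 in A1; rewrite s5 in A2.
  have c7E : c 9%N = 2 * c 7%N by lra.
  have s7E : s 9%N - 1 = 2 * s 7%N by lra.
  have s9m : s 9%N = - 1 by have := half _ _ c7E; have := half _ _ s7E => ? ?; lra.
  have c90 : c 9%N = 0 by apply: sq0; rewrite s9m in U9; lra.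
  have s61 : s 6%N = 1 / 2 by rewrite s9m c90 in dot69; lra.
  have s31 : s 3%N = - 1 / 2 by lra.
  have c1E : 1 - c 3%N = 2 * c 1%N by lra.
  have s1E : 1 - s 3%N = 2 * s 1%N by lra.
  have c30 : c 3%N = 0 by have := half _ _ c1E; have := half _ _ s1E => ? ?; lra.
  by rewrite c30 s31 in U3; lra.
- have c1E : 1 - c 6%N = 2 * c 1%N by lra.
  have s1E : - s 6%N = 2 * s 1%N by lra.
  have c6m : c 6%N = - 1 by have := half _ _ c1E; have := half _ _ s1E => ? ?; lra.
  have s60 : s 6%N = 0 by apply: sq0; rewrite c6m in U6; lra.
  have c9E : c 9%N = 1 / 2 by rewrite c6m s60 in dot69; lra.
  case: leg2 => [[c5 s5]|[c5 s5]]; rewrite c5 in A1; rewrite s5 in A2; last by lra.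
  have c4E : - c 9%N = 2 * c 4%N by lra.
  have s4E : 1 - s 9%N = 2 * s 4%N by lra.
  have s9m : s 9%N = - 1 by have := half _ _ c4E; have := half _ _ s4E => ? ?; lra.
  by rewrite c9E s9m in U9; lra.
- have c7E : 1 - c 6%N = 2 * c 7%N by lra.
  have s7E : - s 6%N = 2 * s 7%N by lra.
  have c6m : c 6%N = - 1 by have := half _ _ c7E; have := half _ _ s7E => ? ?; lra.
  have s60 : s 6%N = 0 by apply: sq0; rewrite c6m in U6; lra.
  have c9E : c 9%N = 1 / 2 by rewrite c6m s60 in dot69; lra.
  case: leg2 => [[c5 s5]|[c5 s5]]; rewrite c5 in A1; rewrite s5 in A2; last by lra.
  have c3E : c 3%N = - 1 / 2 by lra.
  have c4E : 1 - c 3%N = 2 * c 4%N by lra.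
  have s4E : 1 - s 3%N = 2 * s 4%N by lra.
  rewrite c3E in U3 c4E.
  have s30 : s 3%N = 0 by have := half _ _ c4E; have := half _ _ s4E => ? ?; lra.
  by rewrite s30 in U3; lra.
- have c6m : c 6%N = 1 by lra.
  have s60 : s 6%N = 0 by lra.
  have c9E : c 9%N = - 1 / 2 by rewrite c6m s60 in dot69; lra.
  case: leg2 => [[c5 s5]|[c5 s5]]; rewrite c5 in A1; rewrite s5 in A2; last by lra.
  have c3E : c 3%N = 1 / 2 by lra.
  have c4E : 1 - c 3%N = 2 * c 4%N by lra.
  have s4E : 1 - s 3%N = 2 * s 4%N by lra.
  rewrite c3E in U3 c4E.
  have s3m : s 3%N = - 1 by have := half _ _ c4E; have := half _ _ s4E => ? ?; lra.
  by rewrite s3m in U3; lra.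
Qed.

Lemma stress_links a1 a2 b1 b2 g1 g2 : stress c s a1 a2 b1 b2 g1 g2 ->
  [|| a1 != 0, a2 != 0, b1 != 0, b2 != 0, g1 != 0 | g2 != 0] ->
  [/\ s 1%N = 0, s 2%N = 0, s 6%N = 0, s 7%N = 0 & s 8%N = 0] \/
  [/\ c 4%N = 0, c 5%N = 0, c 7%N = 0, c 8%N = 0 & c 9%N = 0].
Proof.
move=> st nz; apply: (two_leg_stress cs st nz).
have [a0|] := boolP ((a1 != 0) || (a2 != 0)); last first.
  by rewrite negb_or !negbK => /andP[/eqP -> /eqP ->]; left.
have [b0|] := boolP ((b1 != 0) || (b2 != 0)); last first.
  by rewrite negb_or !negbK => /andP[/eqP -> /eqP ->]; right; left.
have [ab0|] := boolP ((a1 + b1 != 0) || (a2 + b2 != 0)); last first.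
  by rewrite negb_or !negbK => /andP[/eqP -> /eqP ->]; right; right.
by case: (three_leg_stress st a0 b0 ab0).
Qed.

End ThreeLegs.

Lemma link_cases (P : nat -> Prop) : P 1%N -> P 2%N -> P 3%N -> P 4%N -> P 5%N -> P 6%N -> P 7%N ->
  P 8%N -> P 9%N -> forall i, (0 < i < 10)%N -> P i.
Proof. by move=> ? ? ? ? ? ? ? ? ?; do 10 ?case=> //. Qed.

(** * Coordinates of configurations and the linkage equations *)

Section Equations.
Variable R : realType.
Implicit Types x p : 'rV[R]_18.

Definition cos_of x (i : nat) : R := x 0 (c_index i).
Definition sin_of x (i : nat) : R := x 0 (s_index i).

Lemma c_index_val i : (0 < i < 10)%N -> c_index i = i.-1.*2 :> nat.
Proof. by move=> i10; rewrite /c_index inordK //; lia. Qed.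

Lemma s_index_val i : (0 < i < 10)%N -> s_index i = i.-1.*2.+1 :> nat.
Proof. by move=> i10; rewrite /s_index inordK //; lia. Qed.

Lemma c_index_eq i j : (0 < i < 10)%N -> (0 < j < 10)%N -> (c_index i == c_index j) = (i == j).
Proof.
by move=> i10 j10; rewrite -val_eqE /= !c_index_val //; apply/eqP/eqP; lia.
Qed.

Lemma s_index_eq i j : (0 < i < 10)%N -> (0 < j < 10)%N -> (s_index i == s_index j) = (i == j).
Proof.
by move=> i10 j10; rewrite -val_eqE /= !s_index_val //; apply/eqP/eqP; lia.
Qed.

Lemma cs_index_neq i j : (0 < i < 10)%N -> (0 < j < 10)%N -> (c_index i == s_index j) = false.
Proof.
by move=> i10 j10; apply/negbTE; rewrite -val_eqE /= c_index_val ?s_index_val //; lia.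
Qed.

Lemma index_cases (k : 'I_18) : exists2 i, (0 < i < 10)%N & k = c_index i \/ k = s_index i.
Proof.
exists (k./2).+1; first by have := ltn_ord k; lia.
have k18 := ltn_ord k; have h10 : (0 < k./2.+1 < 10)%N by lia.
have [ok|ok] := boolP (odd k); [right|left]; apply: val_inj.
  by rewrite /= s_index_val //=; have := odd_double_half k; rewrite ok; lia.
by rewrite /= c_index_val //=; have := odd_double_half k; rewrite (negbTE ok); lia.
Qed.

Lemma rrr_zeros x : rrr_space R x <-> forall f, f \in rrr_polys R -> meval (x 0) f = 0.
Proof.
split=> [xX f fs|H f [m [a [s [sP ->]]]]].
  apply: xX; exists 1%N, (fun=> 1), (fun=> f); split=> //.
  by rewrite big_ord1 mul1r.
rewrite [LHS]raddf_sum big1 // => i _.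
by rewrite [LHS]mevalM (H (s i)) ?mulr0 //; exact: sP.
Qed.

Lemma rrr_spaceP x : rrr_space R x <-> linkage (cos_of x) (sin_of x).
Proof.
rewrite rrr_zeros; have mc i : meval (x 0) (cvar R i) = cos_of x i by exact: mevalXU.
have ms i : meval (x 0) (svar R i) = sin_of x i by exact: mevalXU.
have circle i : meval (x 0) (cvar R i ^+ 2 + svar R i ^+ 2 - 1) =
    cos_of x i ^+ 2 + sin_of x i ^+ 2 - 1.
  by rewrite mevalB meval1 mevalD !expr2 !mevalM mc ms.
split=> [H|[A1 A2 B1 B2 [C1 C2 U]] f].
  have lin (n : nat) : (n < 15)%N -> meval (x 0) (nth 0 (rrr_polys R) n) = 0.
    by move=> n15; apply/H/mem_nth.
  have := lin 0%N isT; have := lin 1%N isT; have := lin 2%N isT.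
  have := lin 3%N isT; have := lin 4%N isT; have := lin 5%N isT.
  rewrite /= !(mevalB, mevalD, meval1, mc, ms).
  move=> *; split; try lra; split; try lra.
  move=> i i10; have := H (cvar R i ^+ 2 + svar R i ^+ 2 - 1).
  rewrite circle => /(_ _)Hi; apply/eqP; rewrite -subr_eq0; apply/eqP/Hi.
  by rewrite mem_cat; apply/orP; right; apply/mapP; exists i => //; rewrite mem_iota; lia.
rewrite mem_cat => /orP[|/mapP[ i ]]; last first.
  by rewrite mem_iota => i10 ->; rewrite circle U ?subrr //; lia.
rewrite !inE => /orP[|/orP[|/orP[|/orP[|/orP[]]]]] /eqP ->;
  rewrite !(mevalB, mevalD, meval1, mc, ms); lra.
Qed.

End Equations.

(** * From a rank drop of the Jacobian to a stress *)

Section JacobianStress.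
Variable R : realType.
Variable p : 'rV[R]_18.
Hypothesis pX : rrr_space R p.
Let c := cos_of p.
Let s := sin_of p.

(** The type [15 + 3], convertible to 18, has the shape [c + d] of the Jacobian criterion. *)
Definition rrr_family (j : 'I_15) : mpoly (15 + 3) R := nth 0 (rrr_polys R) j.

(** The multipliers L times the Jacobian, evaluated on the direction (dc, ds). Multipliers 0 to 5
    belong to the loops and 5 + i to the circle of link i. *)
Let jac_form (L dc ds : nat -> R) : R :=
  L 0%N * (dc 1%N + dc 2%N + dc 3%N + dc 4%N + dc 5%N) +
  L 1%N * (ds 1%N + ds 2%N + ds 3%N + ds 4%N + ds 5%N) +
  L 2%N * (dc 1%N + dc 2%N + dc 6%N + dc 7%N + dc 8%N) +
  L 3%N * (ds 1%N + ds 2%N + ds 6%N + ds 7%N + ds 8%N) +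
  L 4%N * (dc 6%N + dc 9%N - dc 3%N) + L 5%N * (ds 6%N + ds 9%N - ds 3%N) +
  \sum_(i < 9) L (6 + i)%N * (2 * c i.+1 * dc i.+1 + 2 * s i.+1 * ds i.+1).

Let eq_jac_form L dc ds dc' ds' : (forall i, (0 < i < 10)%N -> dc i = dc' i) ->
  (forall i, (0 < i < 10)%N -> ds i = ds' i) -> jac_form L dc ds = jac_form L dc' ds'.
Proof.
move=> ec es; rewrite /jac_form !ec // !es //; congr (_ + _).
by apply: eq_bigr => i _; rewrite ec ?es //; have := ltn_ord i; lia.
Qed.

Let jac_formE (L : nat -> R) (k : 'I_18) :
  \sum_(j < 15) L j * meval (p 0) (mderiv k (nth 0 (rrr_polys R) j)) =
  jac_form L (fun i => (c_index i == k)%:R) (fun i => (s_index i == k)%:R).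
Proof.
pose D f := meval (p 0) (mderiv k f).
have DD f g : D (f + g) = D f + D g by rewrite /D mderivD mevalD.
have DB f g : D (f - g) = D f - D g by rewrite /D mderivB mevalB.
have D1 : D 1 = 0 by rewrite /D mderivC meval0.
have DX j : D (mpolyX R (mnm1 j)) = (j == k)%:R.
  rewrite /D mderivX mnm1E mevalZ; case: eqP => [->|_]; last by rewrite mul0r.
  have -> : mnm_sub (mnm1 k) (mnm1 k) = mnm0 by apply/mnmP => i; rewrite mnmBE subnn mnm0E.
  by rewrite mpolyX0 meval1 mulr1.
have Dc i : D (cvar R i) = (c_index i == k)%:R by exact: DX.
have Ds i : D (svar R i) = (s_index i == k)%:R by exact: DX.
have DQ i : D (cvar R i ^+ 2 + svar R i ^+ 2 - 1) =
    2 * c i * (c_index i == k)%:R + 2 * s i * (s_index i == k)%:R.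
  rewrite DB [D (GRing.one _)]D1 subr0 DD /D !expr2 !mderivM !mevalD !mevalM -!/(D _) Dc Ds !mevalXU.
  by rewrite /c /s /cos_of /sin_of; ring.
have -> : \sum_(j < 15) L j * meval (p 0) (mderiv k (nth 0 (rrr_polys R) j)) =
  \sum_(j < 15) L j * D (nth 0 (rrr_polys R) j) by [].
rewrite (@big_split_ord _ _ _ 6 9) /=; congr (_ + _); last first.
  apply: eq_bigr => i _; rewrite -DQ; congr (_ * D _).
  by case: i => m; do 9 (case: m => [//|m]).
rewrite !big_ord_recl big_ord0 /= !DB ![D (GRing.one _)]D1 !DD !Dc !Ds /bump !leq0n !add1n; ring.
Qed.

(** In a linear relation between the differentials, the multipliers of the loop equations are the
    forces, and the circle equation of a link says that its force is parallel to it. If all forces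
    vanish, so do the circle multipliers, the links being unit vectors. *)
Lemma stress_of_jacobian : ~~ row_free (jacobian (c := 15) (d := 3) (p 0) rrr_family) ->
  exists a1 a2 b1 b2 g1 g2, stress c s a1 a2 b1 b2 g1 g2 /\
    [|| a1 != 0, a2 != 0, b1 != 0, b2 != 0, g1 != 0 | g2 != 0].
Proof.
rewrite -kermx_eq0 => /rowV0Pn[v /sub_kermxP vJ v0].
pose L n := v 0 (inord n).
have form0 k : jac_form L (fun i => (c_index i == k)%:R) (fun i => (s_index i == k)%:R) = 0.
  rewrite -jac_formE; transitivity ((v *m jacobian (c := 15) (d := 3) (p 0) rrr_family) 0 k).
    by rewrite mxE; apply: eq_bigr => j _; rewrite mxE /L inord_val.
  by rewrite vJ mxE.
have [_ _ _ _ [_ _ U]] := (rrr_spaceP p).1 pX.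
have fc i : (0 < i < 10)%N -> jac_form L (fun j => (j == i)%:R) (fun=> 0) = 0.
  move=> i10; rewrite -(form0 (c_index i)); apply: eq_jac_form => j j10.
    by rewrite c_index_eq.
  by rewrite eq_sym cs_index_neq.
have fs i : (0 < i < 10)%N -> jac_form L (fun=> 0) (fun j => (j == i)%:R) = 0.
  move=> i10; rewrite -(form0 (s_index i)); apply: eq_jac_form => j j10.
    by rewrite cs_index_neq.
  by rewrite s_index_eq.
have single (F : nat -> R) (i : nat) : (0 < i < 10)%N ->
    (forall j, j != i -> F j = 0) -> \sum_(j < 9) F j.+1 = F i.
  move=> i10 F0; have i9 : (i.-1 < 9)%N by lia.
  rewrite (bigD1 (Ordinal i9)) //= big1 ?addr0 ?prednK //; first by case/andP: i10.
  by move=> j; rewrite -val_eqE /= => ji; apply: F0; apply: contra ji => /eqP <-.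
have sumc i : (0 < i < 10)%N -> \sum_(j < 9) L (6 + j)%N *
    (2 * c j.+1 * (j.+1 == i)%:R + 2 * s j.+1 * 0) = L (5 + i)%N * (2 * c i).
  move=> i10; transitivity (\sum_(j < 9) L (5 + j.+1)%N *
    (2 * c j.+1 * (j.+1 == i)%:R + 2 * s j.+1 * 0)); first by [].
  rewrite (single (fun j => L (5 + j)%N * (2 * c j * (j == i)%:R + 2 * s j * 0)) i i10).
    by rewrite eqxx !(mulr0, mulr1, addr0, add0r).
  by move=> j /negbTE ->; rewrite !(mulr0, addr0).
have sums i : (0 < i < 10)%N -> \sum_(j < 9) L (6 + j)%N *
    (2 * c j.+1 * 0 + 2 * s j.+1 * (j.+1 == i)%:R) = L (5 + i)%N * (2 * s i).
  move=> i10; transitivity (\sum_(j < 9) L (5 + j.+1)%N *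
    (2 * c j.+1 * 0 + 2 * s j.+1 * (j.+1 == i)%:R)); first by [].
  rewrite (single (fun j => L (5 + j)%N * (2 * c j * 0 + 2 * s j * (j == i)%:R)) i i10).
    by rewrite eqxx !(mulr0, mulr1, addr0, add0r).
  by move=> j /negbTE ->; rewrite !(mulr0, addr0).
(* ([fx i], [fy i]) is the total force in link i, summed over the loops through it. *)
pose fx i := L 0%N * (i \in [:: 1; 2; 3; 4; 5])%N%:R + L 2%N * (i \in [:: 1; 2; 6; 7; 8])%N%:R +
  L 4%N * ((i \in [:: 6; 9])%N%:R - (i == 3)%N%:R).
pose fy i := L 1%N * (i \in [:: 1; 2; 3; 4; 5])%N%:R + L 3%N * (i \in [:: 1; 2; 6; 7; 8])%N%:R +
  L 5%N * ((i \in [:: 6; 9])%N%:R - (i == 3)%N%:R).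
have force i : (0 < i < 10)%N -> fx i = - (L (5 + i)%N * 2) * c i /\ fy i = - (L (5 + i)%N * 2) * s i.
  move=> i10; have := fc i i10; have := fs i i10; rewrite /jac_form sumc // sums //.
  move: i i10; apply: link_cases; rewrite /fx /fy /= => ? ?; split; lra.
have par i : (0 < i < 10)%N -> fx i * s i = fy i * c i.
  by move=> /force[-> ->]; ring.
exists (L 0%N), (L 1%N), (L 2%N), (L 3%N), (L 4%N), (L 5%N); split.
  have := par 1%N isT; have := par 2%N isT; have := par 3%N isT; have := par 4%N isT.
  have := par 5%N isT; have := par 6%N isT; have := par 7%N isT; have := par 8%N isT.
  have := par 9%N isT; rewrite /fx /fy /= => *.
  by split; last split; lra.
apply: contraNT v0; rewrite !negb_or !negbK.
move=> /and5P[/eqP L0 /eqP L1 /eqP L2 /eqP L3 /andP[/eqP L4 /eqP L5]].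
have L6 i : (0 < i < 10)%N -> L (5 + i)%N = 0.
  move=> i10; have [] := force i i10; rewrite /fx /fy L0 L1 L2 L3 L4 L5 => Ec Es.
  have := U i i10; rewrite -/c -/s => Ui.
  transitivity (L (5 + i)%N * (cos_of p i ^+ 2 + sin_of p i ^+ 2)); first by rewrite Ui mulr1.
  rewrite -/(c i) -/(s i) in Ec Es *.
  have -> : L (5 + i)%N * (c i ^+ 2 + s i ^+ 2) =
    - 1 / 2 * (- (L (5 + i)%N * 2) * c i * c i + - (L (5 + i)%N * 2) * s i * s i) by field.
  by rewrite -Ec -Es; ring.
apply/eqP/rowP => j; rewrite mxE -[j]inord_val -/(L _).
case: j => m /= m15; have [m6|m6] := ltnP m 6.
  by move: m m6 {m15}; do 6 ?case=> //.
by rewrite -(subnKC (leq_trans (isT : 5 <= 6)%N m6)); apply: L6; lia.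
Qed.

End JacobianStress.

(** * Configurations with a horizontal loop *)

Section TwoLinks.
Variable R : rcfType.

(* With L the sum of the two links, the links are L / 2 +- h J L, where J is the
   rotation by a right angle and h = +- sqrt (1 / |L|^2 - 1 / 4). *)
Lemma two_link_adjust (c s c' s' : R) : c ^+ 2 + s ^+ 2 = 1 -> c' ^+ 2 + s' ^+ 2 = 1 ->
  c * s' != s * c' ->
  exists K d : R, [/\ 0 <= K, 0 < d & forall l m e, 0 <= e -> e <= d ->
    `|l - (c + c')| <= e -> `|m - (s + s')| <= e ->
    exists x y x' y', [/\ x ^+ 2 + y ^+ 2 = 1, x' ^+ 2 + y' ^+ 2 = 1, x + x' = l, y + y' = m &
      [/\ `|x - c| <= K * e, `|y - s| <= K * e, `|x' - c'| <= K * e & `|y' - s'| <= K * e]]].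
Proof.
move=> u u' nz; pose l0 := c + c'; pose m0 := s + s'; pose N0 := l0 ^+ 2 + m0 ^+ 2.
pose k := c * s' - s * c'; have k0 : k != 0 by rewrite subr_eq0.
(* N0 is the squared length of the leg; k nonzero puts it strictly between 0 and 4, away from the
   folded and the stretched position. *)
have kN : 4 * k ^+ 2 = N0 * (4 - N0).
  have -> : N0 = 2 + 2 * (c * c' + s * s') by rewrite /N0 /l0 /m0; lra.
  have -> : 4 * k ^+ 2 = 4 * ((c ^+ 2 + s ^+ 2) * (c' ^+ 2 + s' ^+ 2) - (c * c' + s * s') ^+ 2).
    by rewrite /k; ring.
  by rewrite u u'; ring.
have k2 : 0 < k ^+ 2 by rewrite lt_neqAle sqr_ge0 eq_sym sqrf_eq0 k0.
have N0_ge0 : 0 <= N0 by rewrite addr_ge0 ?sqr_ge0.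
have N0_gt0 : 0 < N0 by rewrite lt_neqAle N0_ge0 andbT; apply/eqP => N00; rewrite -N00 in kN; lra.
have N0_lt4 : N0 < 4 by rewrite ltNge; apply/negP => N4; nra.
pose h0 := - k / N0; pose A0 := 1 / N0 - 1 / 4.
have A0E : h0 ^+ 2 = A0.
  have -> : h0 ^+ 2 = 4 * k ^+ 2 / (4 * N0 ^+ 2) by rewrite /h0; field; rewrite gt_eqF.
  by rewrite kN /A0; field; rewrite gt_eqF.
have h0_neq0 : h0 != 0 by rewrite mulf_neq0 ?oppr_eq0 // invr_eq0 gt_eqF.
have A0_gt0 : 0 < A0 by rewrite -A0E lt_neqAle sqr_ge0 eq_sym sqrf_eq0 h0_neq0.
have diff_c : (c - c') * N0 = 2 * k * m0.
  transitivity (2 * k * m0 + 2 * (c' * (c ^+ 2 + s ^+ 2) - c * (c' ^+ 2 + s' ^+ 2)) +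
    (c - c') * ((c ^+ 2 + s ^+ 2) + (c' ^+ 2 + s' ^+ 2))).
    by rewrite /N0 /k /l0 /m0; ring.
  by rewrite u u'; ring.
have diff_s : (s - s') * N0 = - 2 * k * l0.
  transitivity (- 2 * k * l0 + 2 * (s' * (c ^+ 2 + s ^+ 2) - s * (c' ^+ 2 + s' ^+ 2)) +
    (s - s') * ((c ^+ 2 + s ^+ 2) + (c' ^+ 2 + s' ^+ 2))).
    by rewrite /N0 /k /l0 /m0; ring.
  by rewrite u u'; ring.
have hm0 : c - c' = - 2 * (h0 * m0).
  by rewrite -[LHS](mulfK (negbT (gt_eqF N0_gt0))) diff_c /h0; field; rewrite gt_eqF.
have hl0 : s - s' = 2 * (h0 * l0).
  by rewrite -[LHS](mulfK (negbT (gt_eqF N0_gt0))) diff_s /h0; field; rewrite gt_eqF.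
(* N changes by at most 10 e, so e <= N0 / 20 keeps N >= N0 / 2, and A changes by at most 20 e /
   N0^2, so the last bound in d keeps A >= 0. Dividing by sqrt A0 = |h0| gives the Lipschitz
   constant K1 of h; it is multiplied by 3 below because the coordinates of the leg stay below 3. *)
pose K1 := 20 / (N0 ^+ 2 * `|h0|); have K1_ge0 : 0 <= K1 by rewrite divr_ge0 ?mulr_ge0 ?exprn_ge0.
pose d := Num.min 1 (Num.min (N0 / 20) (A0 * N0 ^+ 2 / 20)).
exists (1 / 2 + 3 * K1 + `|h0|), d; split.
- by have := normr_ge0 h0; lra.
- by rewrite !lt_min ltr01 divr_gt0 //= divr_gt0 // mulr_gt0 // exprn_gt0.
move=> l m e e0; rewrite !le_min => /and3P[e1 eN eA] la mb.
rewrite -/l0 in la; rewrite -/m0 in mb.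
pose al := l - l0; pose be := m - m0; rewrite -/al in la; rewrite -/be in mb.
have normM (x y a b : R) : `|x| <= a -> `|y| <= b -> `|x * y| <= a * b.
  by move=> xa yb; rewrite normrM ler_pM.
have l02 : `|l0| <= 2.
  by rewrite -(@ler_sqr _ `|l0|) ?nnegrE // real_normK ?num_real //; have := sqr_ge0 m0; rewrite /N0 in N0_lt4; lra.
have m02 : `|m0| <= 2.
  by rewrite -(@ler_sqr _ `|m0|) ?nnegrE // real_normK ?num_real //; have := sqr_ge0 l0; rewrite /N0 in N0_lt4; lra.
pose N := l ^+ 2 + m ^+ 2.
have NN0 : `|N - N0| <= 10 * e.
  have -> : N - N0 = 2 * (l0 * al) + al * al + 2 * (m0 * be) + be * be.
    by rewrite /N /N0 /al /be; ring.
  have := normM _ _ _ _ l02 la; have := normM _ _ _ _ m02 mb.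
  have := normM _ _ _ _ la la; have := normM _ _ _ _ mb mb.
  rewrite !ler_norml => /andP[? ?] /andP[? ?] /andP[? ?] /andP[? ?].
  have : e * e <= e by rewrite ler_piMr.
  by move=> ?; apply/andP; split; lra.
have N_half : N0 / 2 <= N by move: NN0; rewrite ler_norml => /andP[? ?]; lra.
have N_gt0 : 0 < N by lra.
pose A := 1 / N - 1 / 4.
have AA0 : `|A - A0| <= 20 / N0 ^+ 2 * e.
  have -> : A - A0 = (N0 - N) / (N * N0).
    by rewrite /A /A0; field; rewrite !gt_eqF.
  have NN0_gt0 : 0 < N * N0 by rewrite mulr_gt0.
  have NN0V : 0 <= (N * N0)^-1 by rewrite invr_ge0 ltW.
  rewrite normrM (ger0_norm NN0V).
  rewrite ler_pdivrMr // distrC; apply: le_trans NN0 _.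
  have -> : 20 / N0 ^+ 2 * e * (N * N0) = 20 * e * (N / N0) by field; rewrite gt_eqF.
  have : 1 / 2 <= N / N0 by rewrite ler_pdivlMr //; lra.
  by move=> ?; nra.
have A_ge0 : 0 <= A.
  have : 20 / N0 ^+ 2 * e <= A0.
    by rewrite mulrAC ler_pdivrMr ?exprn_gt0 //; lra.
  by move: AA0; rewrite ler_norml => /andP[? ?] ?; lra.
pose h := Num.sg h0 * Num.sqrt A.
have h0E : h0 = Num.sg h0 * Num.sqrt A0 by rewrite -A0E sqrtr_sqr -numEsg.
have hh0 : `|h - h0| <= K1 * e.
  rewrite [in X in `|_ - X|]h0E /h -mulrBr normrM normr_sg h0_neq0 mul1r.
  have sA0 : Num.sqrt A0 = `|h0| by rewrite -A0E sqrtr_sqr.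
  have h0_gt0 : 0 < `|h0| by rewrite normr_gt0.
  have -> : K1 * e = 20 / N0 ^+ 2 * e / `|h0|.
    by rewrite /K1; field; rewrite !gt_eqF.
  rewrite ler_pdivlMr //; apply: le_trans AA0.
  have -> : A - A0 = (Num.sqrt A - Num.sqrt A0) * (Num.sqrt A + Num.sqrt A0).
    by rewrite -subr_sqr !sqr_sqrtr // ltW.
  rewrite [leRHS]normrM ler_wpM2l // -sA0 ger0_norm ?addr_ge0 ?sqrtr_ge0 //.
  by rewrite lerDr sqrtr_ge0.
have hN : (1 / 4 + h ^+ 2) * N = 1.
  rewrite /h exprMn sqr_sqrtr // sqr_sg h0_neq0 (mul1r A) /A addrC subrK mul1r mulVf //.
  by rewrite gt_eqF.
have l3 : `|l| <= 3.
  by move: l02 la; rewrite /al !ler_norml => /andP[? ?] /andP[? ?]; apply/andP; split; lra.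
have m3 : `|m| <= 3.
  by move: m02 mb; rewrite /be !ler_norml => /andP[? ?] /andP[? ?]; apply/andP; split; lra.
have hm := normM _ _ _ _ hh0 m3; have hl := normM _ _ _ _ hh0 l3.
have ha := normM _ _ _ _ (lexx `|h0|) la; have hb := normM _ _ _ _ (lexx `|h0|) mb.
exists (l / 2 - h * m), (m / 2 + h * l), (l / 2 + h * m), (m / 2 - h * l); split.
- by rewrite -[RHS]hN /N; field.
- by rewrite -[RHS]hN /N; field.
- by field.
- by field.
have -> : l / 2 - h * m - c = al / 2 - (h - h0) * m - h0 * be.
  by rewrite /al /be; move: hm0; rewrite /l0 => ?; lra.
have -> : m / 2 + h * l - s = be / 2 + (h - h0) * l + h0 * al.
  by rewrite /al /be; move: hl0; rewrite /m0 => ?; lra.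
have -> : l / 2 + h * m - c' = al / 2 + (h - h0) * m + h0 * be.
  by rewrite /al /be; move: hm0; rewrite /l0 => ?; lra.
have -> : m / 2 - h * l - s' = be / 2 - (h - h0) * l - h0 * al.
  by rewrite /al /be; move: hl0; rewrite /m0 => ?; lra.
clearbody al be K1.
move: la mb hm hl ha hb; clear; rewrite !ler_norml.
by split; apply/andP; split; lra.
Qed.

End TwoLinks.

Section Collinear.
Variable R : realType.

(** Polarization of the square with an error h. It is used with E of order e^2, so that the bound is
    of order e^3. *)
Lemma sqr_sum3_near (a b h e E : R) : `|a| <= e -> `|b| <= e -> `|h| <= E ->
  `|(a + b + h) ^+ 2 - a ^+ 2 - b ^+ 2 - 2 * (a * b)| <= (4 * e + E) * E.
Proof.
move=> ae be hE; have -> : (a + b + h) ^+ 2 - a ^+ 2 - b ^+ 2 - 2 * (a * b) = (2 * (a + b) + h) * h.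
  by ring.
rewrite normrM ler_pM //; move: ae be hE; rewrite !ler_norml.
by move=> /andP[? ?] /andP[? ?] /andP[? ?]; apply/andP; split; lra.
Qed.

Definition rrr_vector (c s : nat -> R) : 'rV[R]_18 :=
  \row_k (if odd k then s k./2.+1 else c k./2.+1).

Lemma cos_of_vector c s i : (0 < i < 10)%N -> cos_of (rrr_vector c s) i = c i.
Proof.
move=> i10; rewrite /cos_of mxE c_index_val // odd_double doubleK prednK //.
by case/andP: i10.
Qed.

Lemma sin_of_vector c s i : (0 < i < 10)%N -> sin_of (rrr_vector c s) i = s i.
Proof.
move=> i10; rewrite /sin_of mxE s_index_val //= odd_double /= uphalf_double prednK //.
by case/andP: i10.
Qed.

Lemma eq_linkage (c s c' s' : nat -> R) : (forall i, (0 < i < 10)%N -> c' i = c i) ->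
  (forall i, (0 < i < 10)%N -> s' i = s i) -> linkage c s -> linkage c' s'.
Proof.
move=> ec es [A1 A2 B1 B2 [C1 C2 U]]; split; rewrite ?ec ?es //.
by split; rewrite ?ec ?es // => i i10; rewrite ec ?es ?U.
Qed.

Variable p : 'rV[R]_18.
Hypothesis pX : rrr_space R p.
Let c := cos_of p.
Let s := sin_of p.
Hypotheses (s1 : s 1%N = 0) (s2 : s 2%N = 0) (s6 : s 6%N = 0) (s7 : s 7%N = 0) (s8 : s 8%N = 0).

Let cs : linkage c s := (rrr_spaceP p).1 pX.

Let unit_c i : (0 < i < 10)%N -> s i = 0 -> c i ^+ 2 = 1.
Proof.
by move=> i10 si; have [_ _ _ _ [_ _ /(_ i i10)]] := cs; rewrite si expr0n addr0.
Qed.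

Let sign_c i : (0 < i < 10)%N -> s i = 0 -> c i = 1 \/ c i = - 1.
Proof.
by move=> i10 si; have /eqP := unit_c i10 si; rewrite sqrf_eq1 => /orP[]/eqP; [left|right].
Qed.

(** This leg can then absorb small perturbations of the first loop. Stretched, its length would make
    w one of 0, 2, -2, 4, -4, 10, -10; folded, it would give w c_6 = 2; both contradict w^2 = 3. *)
Let leg_generic : c 4%N * s 5%N != s 4%N * c 5%N.
Proof.
apply/eqP => par; have [w [w2 c3 s3 _ _]] := platform cs.
have [A1 A2 _ _ [_ _ U]] := cs.
have U4 := U 4%N isT; rewrite s6 !mulr0 in c3 s3.
have c1s := sign_c (i := 1) isT s1; have c2s := sign_c (i := 2) isT s2.
have c6s := sign_c (i := 6) isT s6.
have [[c5 s5]|[c5 s5]] := unit_sign U4 (U 5%N isT) par; rewrite c5 s1 s2 in A1 A2; rewrite s5 in A2.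
  have c4E : 2 * c 4%N = 1 - c 1%N - c 2%N - c 3%N by lra.
  have s4E : 2 * s 4%N = 1 - s 3%N by lra.
  have E : (2 * c 4%N) ^+ 2 + (2 * s 4%N) ^+ 2 = 4 by lra.
  have c3E : c 3%N = c 6%N / 2 by lra.
  have s3E : s 3%N = w * c 6%N / 2 by lra.
  rewrite c4E s4E c3E s3E in E; clear U cs par U4 c4E s4E c5 s5 A1 A2 c3 s3 c3E s3E.
  have wP r : r ^+ 2 != 3 -> w != r by move=> r3; apply: contra r3 => /eqP <-; rewrite w2.
  have [w0 [w4 [w10 w_2]]] : w != 0 /\ w != 4 /\ w != 10 /\ w != - 2.
    by rewrite !wP //; apply/eqP; lra.
  have [v4 [v10 v2]] : w != - 4 /\ w != - 10 /\ w != 2 by rewrite !wP //; apply/eqP; lra.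
  case: c1s => c1E; case: c2s => c2E; case: c6s => c6E; rewrite c1E c2E c6E in E;
    first [move: w0; rewrite (_ : w = 0) ?eqxx //; lra | move: w4; rewrite (_ : w = 4) ?eqxx //; lra
    | move: w10; rewrite (_ : w = 10) ?eqxx //; lra | move: w_2; rewrite (_ : w = -2) ?eqxx //; lra
    | move: v4; rewrite (_ : w = - 4) ?eqxx //; lra
    | move: v10; rewrite (_ : w = - 10) ?eqxx //; lra | move: v2; rewrite (_ : w = 2) ?eqxx //; lra].
have wc : w * c 6%N = 2 by lra.
have : (w * c 6%N) ^+ 2 = 3 by rewrite exprMn w2 unit_c ?mulr1.
by rewrite wc; lra.
Qed.

(** Five signs with sum 1 are three +1 and two -1, so among the four links other than 6 one is
    opposite to two others. Link 6 is left out because turning it would turn the platform. *)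
Let pivot : exists j k k', [/\ j \in [:: 1; 2; 7; 8]%N, k \in [:: 1; 2; 7; 8]%N,
  k' \in [:: 1; 2; 7; 8]%N, [&& j != k, j != k' & k != k'] & c j + c k = 0 /\ c j + c k' = 0].
Proof.
have [_ _ B1 _ _] := cs.
have [] := sign_c (i := 1) isT s1; have [] := sign_c (i := 2) isT s2;
have [] := sign_c (i := 6) isT s6; have [] := sign_c (i := 7) isT s7;
have [] := sign_c (i := 8) isT s8; move=> c8E c7E c6E c2E c1E.
all: rewrite c1E c2E c6E c7E c8E in B1.
all: try by exfalso; lra.
all: let P := (fun j k k' => exists j, k, k'; split=> //; rewrite ?c1E ?c2E ?c7E ?c8E; split; lra) in
  first [P 1%N 2%N 7%N | P 1%N 2%N 8%N | P 1%N 7%N 8%N | P 2%N 1%N 7%N | P 2%N 1%N 8%N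
  | P 2%N 7%N 8%N | P 7%N 1%N 2%N | P 7%N 1%N 8%N | P 7%N 2%N 8%N | P 8%N 1%N 2%N
  | P 8%N 1%N 7%N | P 8%N 2%N 7%N].
Qed.

(** Opposite links j and k are turned by the same angle, of sine t; they stay opposite, so the
    second loop stays closed. The platform is kept fixed, and the links 4 and 5 repair the first
    loop. *)
Let tilted : exists2 K : R, 0 < K & exists2 d : R, 0 < d & forall j k t,
  j \in [:: 1; 2; 7; 8]%N -> k \in [:: 1; 2; 7; 8]%N -> j != k -> c j + c k = 0 ->
  0 <= t -> t <= d -> exists x, [/\ rrr_space R x, forall i, `|x 0 i - p 0 i| <= K * t &
  forall i, i \in [:: 1; 2; 6; 7; 8]%N ->
  cos_of x i = (if (i == j) || (i == k) then c i * Num.sqrt (1 - t ^+ 2) else c i) /\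
  sin_of x i = if (i == j) || (i == k) then c i * t else 0].
Proof.
have [A1 A2 B1 B2 [C1 C2 U]] := cs.
have [K [d [K0 d0 adj]]] := two_link_adjust (U 4%N isT) (U 5%N isT) leg_generic.
exists (1 + 2 * K); first by lra.
(* Both links 1 and 2 may move by t, so the leg 4-5 must absorb an error of 2 t <= d. *)
exists (Num.min 1 (d / 2)); first by rewrite lt_min ltr01 divr_gt0.
move=> j k t jI kI jk cjk t0; rewrite le_min => /andP[t1 td].
pose m := Num.sqrt (1 - t ^+ 2).
have m2 : m ^+ 2 = 1 - t ^+ 2 by rewrite sqr_sqrtr // subr_ge0 expr_le1.
have m0 : 0 <= m by rewrite sqrtr_ge0.
have m1 : m <= 1 by rewrite -(@ler_pXn2r _ 2) ?nnegrE // m2 expr1n lerBlDr lerDl sqr_ge0.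
have mt : 1 - m <= t by nra.
pose g i := (i == j) || (i == k).
pose C i := if g i then c i * m else c i; pose S i := if g i then c i * t else s i.
have cs_near i : (0 < i < 10)%N -> s i = 0 -> `|c i * m - c i| <= t /\ `|c i * t| <= t.
  move=> i10 si; have [->|->] := sign_c i10 si; rewrite !ler_norml; split; apply/andP; split; lra.
have gP i : g i -> i \in [:: 1; 2; 7; 8]%N by move=> /orP[]/eqP ->.
have g_flat i : g i -> (0 < i < 10)%N /\ s i = 0.
  by move=> /gP; rewrite !inE => /or4P[]/eqP ->.
have gN i : i \notin [:: 1; 2; 7; 8]%N -> g i = false by move=> iN; apply: contraNF iN => /gP.
have CS_near i : `|C i - c i| <= t /\ `|S i - s i| <= t.
  rewrite /C /S; have [/g_flat[i10 si]|_] := boolP (g i); last by rewrite !subrr normr0.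
  by rewrite [in X in _ /\ X]si subr0; apply: cs_near.
have flat i : i \in [:: 1; 2; 6; 7; 8]%N -> s i = 0.
  by rewrite !inE => /orP[|/or4P[]] /eqP ->.
have loop : C 1%N + C 2%N + C 6%N + C 7%N + C 8%N = 1 /\
    S 1%N + S 2%N + S 6%N + S 7%N + S 8%N = 0.
  have cm : c j * m + c k * m = c j + c k by rewrite -mulrDl cjk mul0r.
  have ct : c j * t + c k * t = 0 by rewrite -mulrDl cjk mul0r.
  rewrite /C /S /g !flat //; clear adj CS_near gN g_flat gP cs_near cjk U A1 A2.
  move: jI kI jk cm ct; rewrite !inE => /or4P[]/eqP -> /or4P[]/eqP -> //= _ cm ct;
    split; lra.
have leg1 : `|(1 - C 1%N - C 2%N - c 3%N) - (c 4%N + c 5%N)| <= 2 * t /\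
  `|(1 - S 1%N - S 2%N - s 3%N) - (s 4%N + s 5%N)| <= 2 * t.
  have [] := CS_near 1%N; have [] := CS_near 2%N.
  rewrite s1 s2 in A2 *; rewrite !ler_norml => /andP[? ?] /andP[? ?] /andP[? ?] /andP[? ?].
  by split; apply/andP; split; lra.
have t2 : 2 * t <= d by lra.
have [x [y [x' [y' [xy xy' xx yy [nx ny nx' ny']]]]]] :=
  adj _ _ _ (mulr_ge0 (ler0n _ 2) t0) t2 leg1.1 leg1.2.
pose C' i := if i == 4%N then x else if i == 5%N then x' else C i.
pose S' i := if i == 4%N then y else if i == 5%N then y' else S i.
exists (rrr_vector C' S'); split.
- apply/rrr_spaceP; apply: (@eq_linkage C' S').
  + exact: cos_of_vector.
  + exact: sin_of_vector.
  have [loop1 loop2] := loop.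
  have E i : i \notin [:: 1; 2; 4; 5; 7; 8]%N -> C' i = c i /\ S' i = s i.
    rewrite !inE !negb_or => /and5P[i1 i2 i4 i5 /andP[i7 i8]].
    rewrite /C' /S' (negbTE i4) (negbTE i5) /C /S gN //.
    by rewrite !inE !negb_or i1 i2 i7.
  have [E3 E3'] := E 3%N isT; have [E6 E6'] := E 6%N isT; have [E9 E9'] := E 9%N isT.
  split.
  + by rewrite E3 /C' /=; lra.
  + by rewrite E3' /S' /=; lra.
  + by rewrite /C' /=.
  + by rewrite /S' /=.
  split; rewrite ?E3 ?E3' ?E6 ?E6' ?E9 ?E9' // => i i10.
  rewrite /C' /S'; case: ifP => // _; case: ifP => // _; rewrite /C /S.
  have [/g_flat[_ si]|_] := boolP (g i); last exact: U.
  by rewrite !exprMn m2 (unit_c i10 si) // !mul1r subrK.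
- have Kt a b : `|a - b| <= t -> `|a - b| <= (1 + 2 * K) * t.
    by move=> ab; apply: le_trans ab _; rewrite ler_peMl //; lra.
  have Kt' a b : `|a - b| <= K * (2 * t) -> `|a - b| <= (1 + 2 * K) * t.
    by move=> ab; apply: le_trans ab _; rewrite [leRHS]mulrDl mulrCA -mulrA mul1r lerDr.
  move=> i; have [l l10 [->|->]] := index_cases i.
  + rewrite -/(cos_of _ l) -/(cos_of p l) cos_of_vector // /C'.
    case: ifP => [/eqP ->|_]; first exact: Kt'.
    by case: ifP => [/eqP ->|_]; [exact: Kt'|apply/Kt/(CS_near l).1].
  rewrite -/(sin_of _ l) -/(sin_of p l) sin_of_vector // /S'.
  case: ifP => [/eqP ->|_]; first exact: Kt'.
  by case: ifP => [/eqP ->|_]; [exact: Kt'|apply/Kt/(CS_near l).2].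
move=> i iI; rewrite cos_of_vector ?sin_of_vector; last 2 first.
- by move: iI; rewrite !inE => /orP[|/or4P[]] /eqP ->.
- by move: iI; rewrite !inE => /orP[|/or4P[]] /eqP ->.
have [i4 i5] : (i == 4%N) = false /\ (i == 5%N) = false.
  by move: iI; rewrite !inE => /orP[|/or4P[]] /eqP ->.
by rewrite /C' /S' i4 i5 /C /S flat.
Qed.

Let Q x i := c i * ((cos_of x i - c i) ^+ 2 + sin_of x i ^+ 2).

(** Since c_i^2 = 1 and x lies on the circles, Q x i = 2 (c_i - cos_i x), and the sum is twice the
    difference of one loop equation at p and at x. *)
Let sumQ x : rrr_space R x -> Q x 1%N + Q x 2%N + Q x 6%N + Q x 7%N + Q x 8%N = 0.
Proof.
move=> xX; have [_ _ B1 _ [_ _ U]] := cs.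
have [_ _ B1' _ [_ _ U']] := (rrr_spaceP x).1 xX.
have QE i : (0 < i < 10)%N -> s i = 0 -> Q x i = 2 * (c i - cos_of x i).
  move=> i10 si; have c2 := unit_c i10 si; have U'i := U' i i10.
  have -> : Q x i = c i * (cos_of x i ^+ 2 + sin_of x i ^+ 2) - 2 * cos_of x i * c i ^+ 2 +
    c i * c i ^+ 2 by rewrite /Q; ring.
  by rewrite c2 U'i; ring.
by rewrite !QE //; lra.
Qed.

(* The links of the second loop are horizontal, so the sum of their c_i moves by
   the quadratic form Q, which has to vanish on the configuration space. The motions that turn the pairs (j, k) and
   (j, k') are not orthogonal for Q, hence cannot be added up. *)
Lemma collinear_not_additive : ~ additive_at (rrr_space R) p.
Proof.
move=> [B [r [B0 r0 add]]].
have [j [k [k' [jI kI k'I /and3P[jk jk' kk'] [cjk cjk']]]]] := pivot.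
have [K K0 [d d0 tilt]] := tilted.
(* Five links, with two coordinates each, contribute errors of at most (4 B + B^2) e^3 with e = K t;
   the total is M t^3, which t <= 1 / (M + 1) keeps below the main term 2 t^2. *)
pose M := 5 * (8 * B + 2 * B ^+ 2) * K ^+ 3.
have M0 : 0 <= M by rewrite !mulr_ge0 ?addr_ge0 ?mulr_ge0 ?exprn_ge0 // ltW.
pose t := Num.min (Num.min 1 d) (Num.min (r / K) (Num.min (1 / K) (1 / (M + 1)))).
have M1 : 0 < M + 1 by lra.
have t0 : 0 < t by rewrite !lt_min ltr01 d0 !divr_gt0.
have : t <= t by [].
rewrite {2}/t !le_min => /andP[/andP[t1 td] /and3P[tr tK tM]].
have eK : K * t <= r by rewrite mulrC -ler_pdivlMr.
have e1 : K * t <= 1 by rewrite mulrC -ler_pdivlMr.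
have Mt : M * t <= 1.
  by move: tM; rewrite ler_pdivlMr // mulrDr mulr1 mulrC; lra.
have e0 : 0 <= K * t by rewrite mulr_ge0 // ltW.
have [x [xX xp xT]] := tilt j k t jI kI jk cjk (ltW t0) td.
have [y [yX yp yT]] := tilt j k' t jI k'I jk' cjk' (ltW t0) td.
have [z zX zn] := add x y (K * t) xX yX e0 eK xp yp.
set e := K * t in e0 eK e1 xp yp zn.
pose m := Num.sqrt (1 - t ^+ 2).
pose P i := c i * (2 * ((cos_of x i - c i) * (cos_of y i - c i)) + 2 * (sin_of x i * sin_of y i)).
pose F := (4 * e + B * e ^+ 2) * (B * e ^+ 2).
have norm_c i : (0 < i < 10)%N -> s i = 0 -> `|c i| = 1.
  by move=> i10 si; have [->|->] := sign_c i10 si; rewrite ?normrN normr1.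
have Qz i : (0 < i < 10)%N -> s i = 0 -> `|Q z i - Q x i - Q y i - P i| <= F + F.
  move=> i10 si.
  have near l : `|(z 0 l - p 0 l) ^+ 2 - (x 0 l - p 0 l) ^+ 2 - (y 0 l - p 0 l) ^+ 2 -
      2 * ((x 0 l - p 0 l) * (y 0 l - p 0 l))| <= F.
    have -> : z 0 l - p 0 l = (x 0 l - p 0 l) + (y 0 l - p 0 l) + (z 0 l - (x 0 l + y 0 l - p 0 l)).
      by ring.
    exact: sqr_sum3_near.
  have Ec := near (c_index i); have Es := near (s_index i).
  have sE (v : 'rV[R]_18) : v 0 (s_index i) - p 0 (s_index i) = sin_of v i.
    by rewrite -/(sin_of p i) -/(s i) si subr0.
  rewrite !sE in Es.
  apply: le_trans (lerD Ec Es); apply: le_trans (ler_normD _ _).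
  rewrite -[X in _ <= X]mul1r -[X in _ <= X * _](norm_c i i10 si) -normrM.
  rewrite le_eqVlt; apply/orP; left; apply/eqP; congr (`|_|).
  by rewrite /Q /P /c /cos_of; ring.
(* Only link j moves in both motions, so the polar form reduces to its term at j. *)
have PN i : i \in [:: 1; 2; 6; 7; 8]%N -> i != j -> P i = 0.
  move=> iI /negbTE ij; have [Xi Si] := xT i iI; have [Yi Ti] := yT i iI.
  move: Xi Si Yi Ti; rewrite ij /= /P => -> -> -> ->.
  by case: eqP => [->|_]; rewrite ?(negbTE kk') ?subrr ?(mulr0, mul0r, addr0).
have Pj : 2 * t ^+ 2 <= `|P j|.
  have jT : j \in [:: 1; 2; 6; 7; 8]%N by move: jI; rewrite !inE => /or4P[]/eqP ->.
  have [Xi Si] := xT j jT; have [Yi Ti] := yT j jT.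
  move: Xi Si Yi Ti; rewrite eqxx /= /P => -> -> -> ->.
  have [j10 sj] : (0 < j < 10)%N /\ s j = 0 by move: jI; rewrite !inE => /or4P[]/eqP ->.
  rewrite -/m (_ : _ + _ = c j ^+ 2 * (2 * ((m - 1) ^+ 2 + t ^+ 2))); last by ring.
  rewrite unit_c // mul1r normrM norm_c // mul1r ger0_norm; last first.
    by rewrite mulr_ge0 // addr_ge0 ?sqr_ge0.
  by rewrite ler_pM2l // lerDr sqr_ge0.
have sumP : P 1%N + P 2%N + P 6%N + P 7%N + P 8%N = P j.
  by move: jI PN; rewrite !inE => /or4P[]/eqP -> PN; rewrite ?(PN 1%N isT isT) ?(PN 2%N isT isT)
    ?(PN 6%N isT isT) ?(PN 7%N isT isT) ?(PN 8%N isT isT) ?(addr0, add0r).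
have Fe : F <= (4 * B + B ^+ 2) * e ^+ 3.
  have -> : F = 4 * B * e ^+ 3 + B ^+ 2 * e ^+ 3 * e by rewrite /F; ring.
  by rewrite [leRHS]mulrDl lerD2l ler_piMr // mulr_ge0 ?exprn_ge0.
have M3 : 5 * (2 * ((4 * B + B ^+ 2) * e ^+ 3)) = M * t * t ^+ 2 by rewrite /M /e; ring.
have Mt2 : M * t * t ^+ 2 <= t ^+ 2 by rewrite ler_piMl // sqr_ge0.
have t2 : 0 < t ^+ 2 by rewrite exprn_gt0.
have Qx0 := sumQ xX; have Qy0 := sumQ yX; have Qz0 := sumQ zX.
pose dev i := Q z i - Q x i - Q y i - P i.
have Pdev : P j = - (dev 1%N + dev 2%N + dev 6%N + dev 7%N + dev 8%N).
  transitivity (P 1%N + P 2%N + P 6%N + P 7%N + P 8%N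
    - (Q z 1%N + Q z 2%N + Q z 6%N + Q z 7%N + Q z 8%N)
    + (Q x 1%N + Q x 2%N + Q x 6%N + Q x 7%N + Q x 8%N)
    + (Q y 1%N + Q y 2%N + Q y 6%N + Q y 7%N + Q y 8%N)).
    by rewrite Qx0 Qy0 Qz0 sumP subr0 !addr0.
  by rewrite /dev; ring.
have := Qz 1%N isT s1; have := Qz 2%N isT s2; have := Qz 6%N isT s6.
have := Qz 7%N isT s7; have := Qz 8%N isT s8; rewrite -!/(dev _) => D8 D7 D6 D2 D1.
have : `|P j| <= 5 * (F + F).
  rewrite Pdev normrN.
  have add2 a b u v : `|a| <= u -> `|b| <= v -> `|a + b| <= u + v :> R.
    by move=> au bv; apply: le_trans (ler_normD _ _) (lerD au bv).
  rewrite (_ : 5 * (F + F) = (F + F) + (F + F) + (F + F) + (F + F) + (F + F)); last by ring.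
  by do 4 apply: (add2) => //.
by move=> Pj'; lra.
Qed.

End Collinear.

Section Mirror.
Variable R : realType.
Implicit Types x p : 'rV[R]_18.

(* The reflection in the diagonal exchanges the two loops of the links 1, ..., 5
   and 5, 4, 9, 7, 8, whose vector sums (1, 1) and (0, 1) it maps to (1, 1) and
   (1, 0). *)
Definition mirror_link (i : nat) : nat := nth 0%N [:: 0; 5; 4; 3; 2; 1; 9; 7; 8; 6]%N i.
(** The loop 5, 4, 9, 7, 8 runs through the links 7 and 8 backwards. *)
Definition mirror_sign (i : nat) : R := if (i == 7%N) || (i == 8%N) then -1 else 1.
Definition mirror x : 'rV[R]_18 :=
  rrr_vector (fun i => mirror_sign i * sin_of x (mirror_link i))
             (fun i => mirror_sign i * cos_of x (mirror_link i)).

Lemma mirror_link_range i : (0 < i < 10)%N -> (0 < mirror_link i < 10)%N.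
Proof. by move: i; apply: link_cases. Qed.

Lemma cos_of_mirror x i : (0 < i < 10)%N ->
  cos_of (mirror x) i = mirror_sign i * sin_of x (mirror_link i).
Proof. exact: cos_of_vector. Qed.

Lemma sin_of_mirror x i : (0 < i < 10)%N ->
  sin_of (mirror x) i = mirror_sign i * cos_of x (mirror_link i).
Proof. exact: sin_of_vector. Qed.

Lemma mirror_space x : rrr_space R x -> rrr_space R (mirror x).
Proof.
move=> /rrr_spaceP[A1 A2 B1 B2 [C1 C2 U]]; apply/rrr_spaceP.
split; last split.
1-6: rewrite ?cos_of_mirror ?sin_of_mirror // /mirror_sign /=; lra.
move=> i i10; rewrite cos_of_mirror ?sin_of_mirror // !exprMn -mulrDr addrC U ?mirror_link_range //.
by rewrite mulr1 /mirror_sign; case: ifP => _; rewrite ?sqrrN expr1n.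
Qed.

Lemma mirrorK : involutive mirror.
Proof.
have signK i : mirror_sign i * mirror_sign i = 1.
  by rewrite /mirror_sign; case: ifP => _; rewrite ?mulrNN mulr1.
have signL i : (0 < i < 10)%N -> mirror_sign (mirror_link i) = mirror_sign i.
  by move: i; apply: link_cases.
have linkK i : (0 < i < 10)%N -> mirror_link (mirror_link i) = i by move: i; apply: link_cases.
move=> x; apply/rowP => k; have [i i10 [->|->]] := index_cases k.
  rewrite -/(cos_of _ i) cos_of_mirror // sin_of_mirror ?mirror_link_range //.
  by rewrite signL // mulrA signK mul1r linkK.
rewrite -/(sin_of _ i) sin_of_mirror // cos_of_mirror ?mirror_link_range //.
by rewrite signL // mulrA signK mul1r linkK.
Qed.

(** The mirror thus preserves the coordinatewise bounds of [additive_at], with the same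
    constants. *)
Lemma mirror_coordinate k : exists l (u : R), `|u| = 1 /\ forall x, mirror x 0 k = u * x 0 l.
Proof.
have norm_sign i : `|mirror_sign i| = 1.
  by rewrite /mirror_sign; case: ifP => _; rewrite ?normrN normr1.
have [i i10 [->|->]] := index_cases k.
  exists (s_index (mirror_link i)), (mirror_sign i); split=> // x.
  exact: cos_of_mirror.
exists (c_index (mirror_link i)), (mirror_sign i); split=> // x.
exact: sin_of_mirror.
Qed.

Lemma mirror_additive p : additive_at (rrr_space R) p -> additive_at (rrr_space R) (mirror p).
Proof.
move=> [C [r [C0 r0 add]]]; exists C, r; split=> // x y e xX yX e0 er xp yp.
have near (v : 'rV[R]_18) : (forall i, `|v 0 i - mirror p 0 i| <= e) -> forall i, `|mirror v 0 i - p 0 i| <= e.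
  move=> vp i; have [l [u [u1 mE]]] := mirror_coordinate i.
  by rewrite -[p in X in `|X|]mirrorK !mE -mulrBr normrM u1 mul1r.
have [z zX zn] := add _ _ e (mirror_space xX) (mirror_space yX) e0 er (near _ xp) (near _ yp).
exists (mirror z); first exact: mirror_space.
move=> i; have [l [u [u1 mE]]] := mirror_coordinate i.
rewrite -[x]mirrorK -[y]mirrorK !(mE _).
rewrite -mulrDr -mulrBr -mulrBr normrM u1 mul1r; exact: zn.
Qed.

End Mirror.

(** * Singularities are not manifold points *)

Lemma aligned_not_manifold (R : realType) (p : 'rV[R]_18) : rrr_space R p ->
  [/\ sin_of p 1 = 0, sin_of p 2 = 0, sin_of p 6 = 0, sin_of p 7 = 0 & sin_of p 8 = 0] \/
  [/\ cos_of p 4 = 0, cos_of p 5 = 0, cos_of p 7 = 0, cos_of p 8 = 0 & cos_of p 9 = 0] ->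
  ~ manifold_point (rrr_space R) p.
Proof.
move=> pX [[s1 s2 s6 s7 s8]|[c4 c5 c7 c8 c9]] /(manifold_point_additive pX) add.
  exact: (collinear_not_additive pX s1 s2 s6 s7 s8).
apply: (collinear_not_additive (mirror_space pX) _ _ _ _ _ (mirror_additive add));
  by rewrite sin_of_mirror //= ?c4 ?c5 ?c7 ?c8 ?c9 mulr0.
Qed.

Lemma singularity_aligned (R : realType) (p : 'rV[R]_18) : rrr_space R p ->
  singularity (rrr_ideal R) p ->
  [/\ sin_of p 1 = 0, sin_of p 2 = 0, sin_of p 6 = 0, sin_of p 7 = 0 & sin_of p 8 = 0] \/
  [/\ cos_of p 4 = 0, cos_of p 5 = 0, cos_of p 7 = 0, cos_of p 8 = 0 & cos_of p 9 = 0].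
Proof.
move=> pX [Ip sing]; have [free|nfree] := boolP (row_free (jacobian (c := 15) (d := 3) (p 0) (rrr_family R))).
  case: sing; apply: (regular_of_free_jacobian (c := 15) (d := 3) (f := rrr_family R)) free.
    move=> j; exists 1%N, (fun=> 1), (fun=> rrr_family R j); split=> [_|].
      by apply: mem_nth; exact: ltn_ord.
    by rewrite big_ord1 mul1r.
  move=> J [J0 JD] Jf f [n [a [g [gI ->]]]].
  have JDD u v : J u -> J v -> J (u + v) by move=> /(JD 1)JDu /JDu; rewrite mul1r.
  apply: big_ind => // i _.
  rewrite -[X in J X]addr0; apply: JD => //.
  have /(nthP 0)[l l15 <-] := gI i.
  exact: (Jf (Ordinal (l15 : (l < 15)%N))).
have [a1 [a2 [b1 [b2 [g1 [g2 [str nz]]]]]]] := stress_of_jacobian pX nfree.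
exact: (stress_links ((rrr_spaceP p).1 pX) str nz).
Qed.

Lemma rrr_point_space (R : realType) : rrr_space R (rrr_point R).
Proof.
have coord (n : nat) : (n < 18)%N -> rrr_point R 0 (inord n) = nth 0
    [:: Num.sqrt 3%:R / 2%:R; - (1 / 2%:R); 1; 0; - (Num.sqrt 3%:R / 2%:R); - (1 / 2%:R); 0; 1; 0; 1;
        - (Num.sqrt 3%:R / 2%:R); 1 / 2%:R; 0; 1; 0; -1; 0; -1] n.
  by move=> n18; rewrite mxE inordK.
have w2 : Num.sqrt 3%:R ^+ 2 = 3%:R :> R by rewrite sqr_sqrtr ?ler0n.
apply/rrr_spaceP; split; last split.
1-6: rewrite /cos_of /sin_of /c_index /s_index /= !coord //=; lra.
apply: link_cases; rewrite /cos_of /sin_of /c_index /s_index /= !coord //=; lra.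
Qed.

Theorem mainTheorem4 (R : realType) :
  (forall p : 'rV[R]_18,
     rrr_space R p -> singularity (rrr_ideal R) p ->
     ~ isolated (rrr_space R) p -> ~ manifold_point (rrr_space R) p) /\
  (rrr_space R (rrr_point R) /\
   ~ manifold_point (rrr_space R) (rrr_point R)).
Proof.
split=> [p pX sing _|].
  exact: aligned_not_manifold pX (singularity_aligned pX sing).
split; first exact: rrr_point_space.
(* The links 4, 5, 7, 8, 9 are vertical at this point, so its singularity need not be checked. *)
apply: (aligned_not_manifold (@rrr_point_space R)); right.
by split; rewrite /cos_of /c_index /= mxE inordK.
Qed.
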